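(* Let $\Sigma$ be the system $\dot x = f(x)+u\,g(x)$, $y=h(x)$ on $\mathbb{R}^n$, where $f,g$ are smooth vector fields on $\mathbb{R}^n$, $h:\mathbb{R}^n\to\mathbb{R}$ is smooth, and $f(0)=0$, $h(0)=0$. Suppose that: (1) $\Sigma$ has a uniform relative degree $r$: there is a positive integer $r$ such that $L_gL_f^kh\equiv 0$ for all $0\le k<r-1$, and $L_gL_f^{r-1}h(x)\neq 0$ for all $x\in\mathbb{R}^n$; (2) each of the vector fields $\tau_1,\ldots,\tau_r$ defined by $$\widetilde g(x)=\frac{1}{L_gL_f^{r-1}h(x)}\,g(x),\qquad \widetilde f(x)=f(x)-\bigl(L_f^rh(x)\bigr)\widetilde g(x),\qquad \tau_i=\mathrm{ad}_{\widetilde f}^{\,i-1}\widetilde g\quad(i=1,\ldots,r)$$ is complete; (3) the vector fields $\tau_1,\ldots,\tau_r$ commute with each other: $[\tau_i,\tau_j]=0$ for all $i,j\in\{1,\ldots,r\}$. Let $\mathcal{U}$ be a class of functions $[0,\infty)\to\mathbb{R}$ generated by a Poisson-stable exosystem, and suppose that $\Sigma$ adapts to inputs in $\mathcal{U}$. Then $\Sigma$ contains an output-driven internal model of $\mathcal{U}$.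
   Context: Notation. For a vector field $X$ and a function $h$, $(L_Xh)(x)=\nabla h(x)\cdot X(x)$ is the Lie derivative. $\mathrm{ad}_XY=[X,Y]$ is the Lie bracket of vector fields, and $\mathrm{ad}_X^0Y=Y$. A vector field $X$ on $\mathbb{R}^n$ is complete if for every $x^0$ the solution of $\dot x=X(x)$, $x(0)=x^0$ is defined for all $t\in\mathbb{R}$. Class generated by an exosystem. An exosystem $\Gamma$ is a system $\dot w=Q(w)$, $u=\theta(w)$ evolving on a differentiable manifold, with $Q$ a smooth vector field and $\theta$ a smooth real-valued function. The class $\mathcal{U}$ is generated by $\Gamma$ if $\mathcal{U}$ consists exactly of the functions $u(t)=\theta(w(t))$, $t\ge 0$, for all possible solutions $w(\cdot)$ of $\dot w=Q(w)$. The exosystem is Poisson-stable if for every state $w^0$ the solution $w(\cdot)$ of $\dot w=Q(w)$, $w(0)=w^0$, is defined for all $t>0$ and $w^0$ belongs to its omega-limit set, i.e. there is a sequence of times $t_i\to\infty$ with $w(t_i)\to w^0$. Adaptation. $\Sigma$ adapts to inputs in $\mathcal{U}$ if for each $u\in\mathcal{U}$ and each $x^0\in\mathbb{R}^n$, the solution of $\dot x(t)=f(x(t))+u(t)g(x(t))$ with $x(0)=x^0$ exists for all $t\ge 0$ and is bounded, and the output $y(t)=h(x(t))$ converges to $0$ as $t\to\infty$. Output-driven internal model. $\Sigma$ contains an output-driven internal model of $\mathcal{U}$ if there exist an integer $q\le n$, differentiable manifolds $Z_1$ and $Z_2$ of dimensions $q$ and $n-q$ respectively, a smooth function $\kappa:Z_1\to\mathbb{R}$,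 vector fields $F$ and $G$ on $Z_1\times Z_2$ of the partitioned form $$F(z_1,z_2)=\begin{pmatrix} f_1(z_1,z_2)\\ f_2(\kappa(z_1),z_2)\end{pmatrix},\qquad G(z_1,z_2)=\begin{pmatrix} g_1(z_1,z_2)\\ 0\end{pmatrix}$$ (where $f_2(y,z_2)$ is, for each $y\in\mathbb{R}$, a vector field on $Z_2$), and a diffeomorphism $\Phi:\mathbb{R}^n\to Z_1\times Z_2$ such that for all $x\in\mathbb{R}^n$ $$\Phi_*(x)f(x)=F(\Phi(x)),\qquad \Phi_*(x)g(x)=G(\Phi(x)),\qquad \kappa(\Phi_1(x))=h(x),$$ where $\Phi_1$ is the $Z_1$-component of $\Phi$ and $\Phi_*$ is the Jacobian (differential) of $\Phi$; so in the new coordinates the system is $\dot z_1=f_1(z_1,z_2)+u\,g_1(z_1,z_2)$, $\dot z_2=f_2(y,z_2)$, $y=\kappa(z_1)$. In addition, the $z_2$-subsystem must be capable of generating all functions in $\mathcal{U}$: there is a scalar function $\varphi:Z_2\to\mathbb{R}$ such that for each $u\in\mathcal{U}$ there is some solution $z_2(\cdot)$ of $\dot z_2=f_2(0,z_2)$ satisfying $\varphi(z_2(t))=u(t)$ for all $t\ge 0$. *)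

(* Defs.v *)
From HB Require Import structures.
From mathcomp Require Import all_boot all_order all_algebra.
From mathcomp Require Import all_classical all_reals all_analysis.
Set Implicit Arguments.
Unset Strict Implicit.
Unset Printing Implicit Defensive.
Import Order.TTheory GRing.Theory Num.Theory.
Import numFieldNormedType.Exports.

Local Open Scope classical_set_scope.
Local Open Scope ring_scope.

Section Smooth.
Context {R : realType}.

Definition iter_derive (V W : normedModType R) (vs : seq V) (F : V -> W) : V -> W :=
  foldr (fun v G => 'D_v G) F vs.

(* C^oo on U, for U open: the iterated directional derivatives of all orders
   exist on U and are (Frechet) differentiable there; F is arbitrary off U. *)
Definition smooth_on (V W : normedModType R) (U : set V) (F : V -> W) :=
  forall (vs : seq V) (x : V), U x -> differentiable (iter_derive vs F) x.

Fact near_eq_differentiable (V W : normedModType R) (F G : V -> W) (x : V) :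
  (\near x, F x = G x) -> differentiable G x -> differentiable F x.
Proof.
move=> FG dG; pose H y := F y - G y.
have -> : F = G + H by apply/funext => y; rewrite !fctE /H addrC subrK.
apply: differentiableD => //.
have H0 : H x = 0 by rewrite /H (nbhs_singleton FG) subrr.
have [c e] : continuous (\0 : V -> W) /\
    H \o shift x = cst (H x) + (\0 : V -> W) +o_ 0 id.
  split; first exact: cst_continuous.
  apply/eqaddoP => _/posnumP[e]; rewrite H0.
  have FG' : \forall y \near 0, F (y + x) = G (y + x).
    by move: FG; rewrite (near_shift 0) subr0.
  near=> y.
  rewrite !fctE /= /H (near FG' y) // subrr !addr0 subr0 normr0.
  by rewrite mulr_ge0.
have dE : 'd H x = \0 :> (V -> W) by exact: diff_unique.
by apply/diff_locallyP; rewrite dE.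
Unshelve. all: by end_near. Qed.

Fact eq_iter_derive (V W : normedModType R) (U : set V) (F G : V -> W) :
  open U -> (forall x, U x -> F x = G x) ->
  forall vs x, U x -> iter_derive vs F x = iter_derive vs G x.
Proof.
move=> oU FG; elim=> [|v vs IH] x Ux; first exact: FG.
apply: near_eq_derive; apply: (@filterS _ _ _ U) => //.
by move: oU; rewrite openE; apply.
Qed.

Fact eq_smooth_on (V W : normedModType R) (U : set V) (F G : V -> W) :
  open U -> (forall x, U x -> F x = G x) -> smooth_on U G -> smooth_on U F.
Proof.
move=> oU FG sG vs x Ux; apply: near_eq_differentiable (sG vs x Ux).
apply: (@filterS _ _ _ U); first by move=> y; exact: eq_iter_derive.
by move: oU; rewrite openE; apply.
Qed.

Fact iter_derive_id (V : normedModType R) (vs : seq V) :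
  iter_derive vs (@id V) = id \/ exists c, iter_derive vs (@id V) = cst c.
Proof.
elim: vs => [|v vs [IH|[c IH]]]; first by left.
  by right; exists v; apply/funext => x; rewrite /= IH derive_id.
by right; exists 0; apply/funext => x; rewrite /= IH derive_cst.
Qed.

Fact smooth_on_id (V : normedModType R) (U : set V) : smooth_on U (@id V).
Proof.
by move=> vs x _; have [->|[c ->]] := iter_derive_id vs; [exact: ex_diff|].
Qed.

Fact cvg_row_mx (T : Type) (F : set_system T) (FF : Filter F) p q
    (a : T -> 'rV[R]_p) (b : T -> 'rV[R]_q) (u : 'rV[R]_p) (v : 'rV[R]_q) :
  a @ F --> u -> b @ F --> v -> row_mx (a x) (b x) @[x --> F] --> row_mx u v.
Proof.
move=> au bv A [P Pn PA].
have H : forall j : 'I_(p + q), \forall x \near F, P ord0 j (row_mx (a x) (b x) ord0 j).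
  move=> j; have := Pn ord0 j; rewrite -(fintype.splitK j); case: (fintype.split j) => k /=.
    rewrite row_mxEl => Pk.
    have Fa : F (fun x => P ord0 (lshift q k) (a x ord0 k)).
      exact: au (@coord_continuous R _ _ ord0 k _ _ Pk).
    by apply: filterS Fa => x; rewrite /= row_mxEl.
  rewrite row_mxEr => Pk.
  have Fb : F (fun x => P ord0 (rshift p k) (b x ord0 k)).
    exact: bv (@coord_continuous R _ _ ord0 k _ _ Pk).
  by apply: filterS Fb => x; rewrite /= row_mxEr.
have : \forall x \near F, forall j, P ord0 j (row_mx (a x) (b x) ord0 j).
  exact: filter_forall.
by apply: filterS => x Hx; apply: PA => i j; rewrite ord1.
Qed.

Definition row_pair p q (uv : 'rV[R]_p * 'rV[R]_q) : 'rV[R]_(p + q) :=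
  row_mx uv.1 uv.2.

Fact row_pair_linear p q : linear (@row_pair p q).
Proof.
by move=> k [u v] [u' v']; rewrite /row_pair /= scale_row_mx add_row_mx.
Qed.

HB.instance Definition _ p q := GRing.isLinear.Build R
  ('rV[R]_p * 'rV[R]_q)%type 'rV[R]_(p + q) _ (@row_pair p q)
  (@row_pair_linear p q).

Fact row_pair_continuous p q : continuous (@row_pair p q).
Proof.
move=> [u v]; rewrite /row_pair; apply: cvg_row_mx; [exact: cvg_fst|exact: cvg_snd].
Qed.

Definition row_map p q p' q' (A : 'rV[R]_p -> 'rV[R]_p') (B : 'rV[R]_q -> 'rV[R]_q')
  (z : 'rV[R]_(p + q)) : 'rV[R]_(p' + q') :=
  row_mx (A (lsubmx z)) (B (rsubmx z)).

Fact is_diff_row_map p q p' q' (A : 'rV[R]_p -> 'rV[R]_p')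
    (B : 'rV[R]_q -> 'rV[R]_q') (z : 'rV[R]_(p + q)) :
  differentiable A (lsubmx z) -> differentiable B (rsubmx z) ->
  is_diff z (row_map A B) (row_map ('d A (lsubmx z)) ('d B (rsubmx z))).
Proof.
move=> dA dB.
have E : row_map A B = @row_pair p' q' \o (fun z => ((A \o lsubmx) z, (B \o rsubmx) z)).
  by [].
have dl := @differentiable_lsubmx R 1 p q z.
have dr := @differentiable_rsubmx R 1 p q z.
have dA' : differentiable (A \o lsubmx) z by exact: differentiable_comp.
have dB' : differentiable (B \o rsubmx) z by exact: differentiable_comp.
have dP := differentiable_pair dA' dB'.
have dR : differentiable (@row_pair p' q') ((A \o lsubmx) z, (B \o rsubmx) z).
  exact/linear_differentiable/row_pair_continuous.
have eA : 'd (A \o lsubmx) z = 'd A (lsubmx z) \o lsubmx :> ('rV[R]_(p + q) -> _).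
  rewrite (diff_comp dl dA); congr (_ \o _).
  exact: (diff_lin z (@continuous_lsubmx _ _ _ _)).
have eB : 'd (B \o rsubmx) z = 'd B (rsubmx z) \o rsubmx :> ('rV[R]_(p + q) -> _).
  rewrite (diff_comp dr dB); congr (_ \o _).
  exact: (diff_lin z (@continuous_rsubmx _ _ _ _)).
rewrite E; apply: DiffDef; first exact: (differentiable_comp dP dR).
rewrite (diff_comp dP dR) (diff_pair dA' dB') eA eB.
by rewrite (diff_lin _ (@row_pair_continuous p' q')).
Qed.

Fact smooth_on_row_map p q p' q' (A : 'rV[R]_p -> 'rV[R]_p')
    (B : 'rV[R]_q -> 'rV[R]_q') (U : set 'rV[R]_p) (V : set 'rV[R]_q) :
  open U -> open V -> smooth_on U A -> smooth_on V B ->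
  smooth_on [set z | U (lsubmx z) /\ V (rsubmx z)] (row_map A B).
Proof.
move=> oU oV sA sB.
have oW : open [set z : 'rV[R]_(p + q) | U (lsubmx z) /\ V (rsubmx z)].
  apply: (@openI _ (lsubmx @^-1` U) (rsubmx @^-1` V)).
    by apply: open_comp => // ? _; exact: continuous_lsubmx.
  by apply: open_comp => // ? _; exact: continuous_rsubmx.
have nW z : U (lsubmx z) /\ V (rsubmx z) ->
    nbhs z [set z : 'rV[R]_(p + q) | U (lsubmx z) /\ V (rsubmx z)].
  by move: oW; rewrite openE; exact.
have D vs z : U (lsubmx z) -> V (rsubmx z) -> iter_derive vs (row_map A B) z =
    row_map (iter_derive (map lsubmx vs) A) (iter_derive (map rsubmx vs) B) z.
  elim: vs z => [//|v vs IH] z Uz Vz /=.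
  rewrite (@near_eq_derive _ _ _ _ (row_map (iter_derive (map lsubmx vs) A)
    (iter_derive (map rsubmx vs) B)) z v); last first.
    by apply: filterS (nW z (conj Uz Vz)) => y [Uy Vy]; exact: IH.
  have dA := sA (map lsubmx vs) _ Uz; have dB := sB (map rsubmx vs) _ Vz.
  have [d dE] := is_diff_row_map dA dB.
  by rewrite deriveE // dE /row_map !deriveE.
move=> vs z [Uz Vz].
apply: (@near_eq_differentiable _ _ _ (row_map (iter_derive (map lsubmx vs) A)
    (iter_derive (map rsubmx vs) B))).
  by apply: filterS (nW z (conj Uz Vz)) => y [Uy Vy]; exact: D.
have dA := sA (map lsubmx vs) _ Uz; have dB := sB (map rsubmx vs) _ Vz.
by have [d _] := is_diff_row_map dA dB.
Qed.

End Smooth.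

Section Curves.
Context {R : realType}.

(* One-sided at the endpoints of the time interval J. *)
Definition has_deriv_within (V : normedModType R) (J : set R) (x : R -> V)
    (t : R) (v : V) :=
  (fun s => (s - t)^-1 *: (x s - x t)) @ within J t^' --> v.

Definition solves (V : normedModType R) (J : set R) (F : R -> V -> V)
    (x : R -> V) :=
  forall t, J t -> has_deriv_within J x t (F t (x t)).

Definition half_line : set R := [set t | 0 <= t].

End Curves.

Section VectorFieldsRn.
Context {R : realType} {n : nat}.
Implicit Types (X Y f g : 'rV[R]_n -> 'rV[R]_n) (h : 'rV[R]_n -> R).

Definition gradient h (x : 'rV[R]_n) : 'rV[R]_n :=
  \row_i 'D_(delta_mx 0 i) h x.

Definition lie_derivative X h (x : 'rV[R]_n) : R :=
  \sum_i gradient h x 0 i * X x 0 i.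

(* Sign convention: [X, Y] = DY X - DX Y, i.e. L_[X,Y] = L_X L_Y - L_Y L_X. *)
Definition lie_bracket X Y (x : 'rV[R]_n) : 'rV[R]_n :=
  'd Y x (X x) - 'd X x (Y x).

Definition iter_lie X k h := iter k (lie_derivative X) h.

Definition iter_ad X k Y := iter k (lie_bracket X) Y.

Definition complete_field X :=
  forall x0, exists x : R -> 'rV[R]_n, x 0 = x0 /\ solves setT (fun _ => X) x.

Definition uniform_relative_degree f g h (r : nat) :=
  [/\ (0 < r)%N,
      forall k, (k < r.-1)%N -> forall x, lie_derivative g (iter_lie f k h) x = 0 &
      forall x, lie_derivative g (iter_lie f r.-1 h) x != 0].

Definition gtilde f g h (r : nat) (x : 'rV[R]_n) :=
  (lie_derivative g (iter_lie f r.-1 h) x)^-1 *: g x.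

Definition ftilde f g h (r : nat) (x : 'rV[R]_n) :=
  f x - iter_lie f r h x *: gtilde f g h r x.

Definition tau f g h (r i : nat) : 'rV[R]_n -> 'rV[R]_n :=
  iter_ad (ftilde f g h r) i.-1 (gtilde f g h r).

(* An input is a function on [0, +oo[, represented by a function on R of which
   only the values at nonnegative times are used. *)
Definition adapts f g h (U : set (R -> R)) :=
  forall u, U u -> forall x0 : 'rV[R]_n, exists x : R -> 'rV[R]_n,
    [/\ x 0 = x0,
        solves half_line (fun t z => f z + u t *: g z) x,
        exists B, forall t, 0 <= t -> `|x t| <= B &
        h (x t) @[t --> +oo] --> (0 : R)].

End VectorFieldsRn.

Section Manifolds.
Context {R : realType}.

(* Second countable Hausdorff space with a smooth atlas.  [psi c] is the inverse
   of the chart [phi c]; both are total functions, with junk values outside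
   [dom c] and [phi c @` dom c]. *)
Record manifold (d : nat) := Manifold {
  carrier :> topologicalType;
  chart : Type;
  dom : chart -> set carrier;
  phi : chart -> carrier -> 'rV[R]_d;
  psi : chart -> 'rV[R]_d -> carrier;
  dom_open : forall c, open (dom c);
  cod_open : forall c, open (phi c @` dom c);
  phiK : forall c p, dom c p -> psi c (phi c p) = p;
  phi_continuous : forall c p, dom c p -> {for p, continuous (phi c)};
  psi_continuous : forall c a, (phi c @` dom c) a -> {for a, continuous (psi c)};
  dom_cover : forall p, exists c, dom c p;
  transition_smooth : forall c c',
    smooth_on (phi c @` (dom c `&` dom c')) (phi c' \o psi c);
  manifold_hausdorff : hausdorff_space carrier;
  manifold_second_countable : @second_countable carrier }.

Definition smooth_fun d (M : manifold d) (theta : M -> R) :=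
  forall c : chart M, smooth_on (phi c @` dom c) (theta \o psi c).

Definition smooth_map d e (M : manifold d) (N : manifold e) (F : M -> N) :=
  continuous F /\
  forall (c : chart M) (c' : chart N),
    smooth_on (phi c @` (dom c `&` F @^-1` dom c')) (phi c' \o F \o psi c).

Definition diffeomorphism d e (M : manifold d) (N : manifold e) (F : M -> N) :=
  exists G : N -> M,
    [/\ cancel F G, cancel G F, smooth_map F & smooth_map G].

(* A tangent vector at p is given by its coordinates in every chart at p, related
   by the differentials of the transition maps; the coordinates in charts not
   containing p are irrelevant. *)
Record tangent d (M : manifold d) (p : M) := Tangent {
  tcoord : chart M -> 'rV[R]_d;
  tcoord_compat : forall c c', dom c p -> dom c' p ->
    tcoord c' = 'd (phi c' \o psi c) (phi c p) (tcoord c) }.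

Definition vector_field d (M : manifold d) := forall p : M, tangent p.

Definition smooth_vector_field d (M : manifold d) (X : vector_field M) :=
  forall c : chart M, smooth_on (phi c @` dom c) (fun a => tcoord (X (psi c a)) c).

Definition tangent0 d (M : manifold d) (p : M) : tangent p.
Proof. by exists (fun=> 0) => c c' _ _; rewrite linear0. Defined.

(* The differential of F maps X p to Y (F p) for every p. *)
Definition pushes_forward d e (M : manifold d) (N : manifold e) (F : M -> N)
    (X : vector_field M) (Y : vector_field N) :=
  forall (p : M) (c : chart M) (c' : chart N), dom c p -> dom c' (F p) ->
    'd (phi c' \o F \o psi c) (phi c p) (tcoord (X p) c) = tcoord (Y (F p)) c'.

Definition integral_curve d (M : manifold d) (X : vector_field M) (J : set R)
    (w : R -> M) :=
  forall t, J t ->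
    w @ within J (nbhs t) --> w t /\
    forall c : chart M, dom c (w t) ->
      has_deriv_within J (phi c \o w) t (tcoord (X (w t)) c).

Definition poisson_stable d (M : manifold d) (Q : vector_field M) :=
  forall w0 : M, exists w : R -> M,
    [/\ w 0 = w0, integral_curve Q half_line w &
        exists s : nat -> R, s @ \oo --> +oo /\ w (s i) @[i --> \oo] --> w0].

Definition generated d (M : manifold d) (Q : vector_field M) (theta : M -> R)
    (U : set (R -> R)) :=
  forall u : R -> R, U u <->
    exists w : R -> M, integral_curve Q half_line w /\
      forall t, 0 <= t -> u t = theta (w t).

Fact transition_open d (M : manifold d) (c c' : chart M) :
  open (phi c @` (dom c `&` dom c')).
Proof.
rewrite openE => _ [p [cp c'p] <-].
have a_cod : (phi c @` dom c) (phi c p) by exists p.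
have := @cod_open _ M c; rewrite openE => /(_ _ a_cod) na.
have nb : nbhs (phi c p) (psi c @^-1` dom c').
  apply: (psi_continuous a_cod); rewrite phiK //.
  by have := @dom_open _ M c'; rewrite openE; apply.
apply: filterS2 na nb => _ [q cq <-] /=; rewrite phiK // => c'q.
by exists q.
Qed.

End Manifolds.

Arguments manifold R d : clear implicits.

Section Euclid.
Context {R : realType} (n : nat).

Fact rV_second_countable : @second_countable 'rV[R]_n.
Proof.
pose f (rk : 'rV[rat]_n * nat) : set 'rV[R]_n :=
  (ball (map_mx ratr rk.1 : 'rV[R]_n) rk.2.+1%:R^-1)°.
exists (range f); first exact: card_le_trans (card_image_le _ _) (countableP _).
split=> [_ [rk _ <-]|x V /nbhs_ballP[_/posnumP[e] xeV]]; first exact: open_interior.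
have [//|k] := @ltr_add_invr R 0 (e%:num / 2); rewrite add0r => ke.
have k0 : (0 : R) < k.+1%:R^-1 by rewrite invr_gt0.
have /choice[q xq] : forall j, exists q : rat, `|ratr q - x ord0 j| < k.+1%:R^-1 / 2.
  move=> j; have [|q] := @rat_in_itvoo R (x ord0 j) (x ord0 j + k.+1%:R^-1 / 2).
    by rewrite ltrDl divr_gt0.
  rewrite in_itv /= => /andP[lq rq]; exists q.
  by rewrite gtr0_norm ?subr_gt0 // ltrBlDl.
pose r : 'rV[rat]_n := \row_j q j.
have br : ball (map_mx ratr r : 'rV[R]_n) (k.+1%:R^-1 / 2) x.
  by split=> [|i j]; [rewrite divr_gt0 | rewrite !mxE ord1; exact: xq].
exists (f (r, k)).
  split; first by exists (r, k).
  apply/nbhs_ballP; exists (k.+1%:R^-1 / 2) => /=; first by rewrite divr_gt0.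
  by move=> y xy; rewrite (splitr k.+1%:R^-1); exact: ball_triangle br xy.
move=> y /interior_subset /= ry; apply: xeV.
have xr : ball x (e%:num / 2) (map_mx ratr r : 'rV[R]_n).
  apply/ball_sym; apply: le_ball br; apply: ltW; apply: le_lt_trans ke.
  by rewrite ler_pdivrMr // ler_peMr ?ler1n // ltW.
have ry' : ball (map_mx ratr r : 'rV[R]_n) (e%:num / 2) y.
  by apply: le_ball ry; exact: ltW.
by rewrite /= [e%:num]splitr; exact: ball_triangle xr ry'.
Qed.

(* R^n as a manifold, with the identity as its only chart. *)
Definition euclid : manifold R n.
Proof.
refine (@Manifold R n 'rV[R]_n unit (fun=> setT) (fun=> id) (fun=> id)
  _ _ _ _ _ _ _ _ rV_second_countable).
- by move=> _; exact: openT.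
- by move=> _; rewrite image_id; exact: openT.
- by [].
- by move=> _ p _; exact: cvg_id.
- by move=> _ p _; exact: cvg_id.
- by move=> p; exists tt.
- by move=> _ _; exact: smooth_on_id.
- exact: norm_hausdorff.
Defined.

Definition euclid_field (X : 'rV[R]_n -> 'rV[R]_n) : vector_field euclid.
Proof.
move=> x; exists (fun=> X x) => c c' _ _ /=.
by rewrite diff_val.
Defined.

End Euclid.

Fact open_setX (S T : topologicalType) (A : set S) (B : set T) :
  open A -> open B -> open (A `*` B).
Proof.
rewrite !openE => oA oB z [Az Bz]; exists (A, B) => //.
by split; [exact: oA|exact: oB].
Qed.

Section Product.
Context {R : realType} (d e : nat) (M : manifold R d) (N : manifold R e).

Let pdom (c : chart M * chart N) : set (M * N)%type := dom c.1 `*` dom c.2.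
Let pphi (c : chart M * chart N) (z : M * N) : 'rV[R]_(d + e) :=
  row_mx (phi c.1 z.1) (phi c.2 z.2).
Let ppsi (c : chart M * chart N) (a : 'rV[R]_(d + e)) : (M * N)%type :=
  (psi c.1 (lsubmx a), psi c.2 (rsubmx a)).

Let pphi_image c (A : set M) (B : set N) :
  pphi c @` (A `*` B) =
  [set a | (phi c.1 @` A) (lsubmx a) /\ (phi c.2 @` B) (rsubmx a)].
Proof.
apply/seteqP; split=> [_ [z [Az Bz] <-]|a [[x Ax xa] [y By yb]]] /=.
  by rewrite row_mxKl row_mxKr; split; [exists z.1|exists z.2].
by exists (x, y) => //; rewrite /pphi /= xa yb hsubmxK.
Qed.

Let open_sub (U : set 'rV[R]_d) (V : set 'rV[R]_e) : open U -> open V ->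
  open [set a : 'rV[R]_(d + e) | U (lsubmx a) /\ V (rsubmx a)].
Proof.
move=> oU oV; apply: (@openI _ (lsubmx @^-1` U) (rsubmx @^-1` V)).
  by apply: open_comp => // ? _; exact: continuous_lsubmx.
by apply: open_comp => // ? _; exact: continuous_rsubmx.
Qed.

Let pdomI c c' :
  pdom c `&` pdom c' = (dom c.1 `&` dom c'.1) `*` (dom c.2 `&` dom c'.2).
Proof. by apply/seteqP; split=> z /= [[? ?] [? ?]]. Qed.

Let ptransition c c' : pphi c' \o ppsi c =
  row_map (phi c'.1 \o psi c.1) (phi c'.2 \o psi c.2).
Proof. by []. Qed.

Definition prod_manifold : manifold R (d + e).
Proof.
refine (@Manifold R (d + e) (M * N)%type (chart M * chart N)%type pdom pphi ppsi
  _ _ _ _ _ _ _ _ _).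
- by move=> c; apply: open_setX; exact: dom_open.
- by move=> c; rewrite pphi_image; apply: open_sub; exact: cod_open.
- move=> c [x y] [/= cx cy].
  by rewrite /ppsi /pphi /= row_mxKl row_mxKr !phiK.
- move=> c [x y] [/= cx cy]; apply: cvg_row_mx.
    apply: (@cvg_comp _ _ _ fst (phi c.1) (nbhs (x, y)) (nbhs x)); first exact: cvg_fst.
    exact: phi_continuous.
  apply: (@cvg_comp _ _ _ snd (phi c.2) (nbhs (x, y)) (nbhs y)); first exact: cvg_snd.
  exact: phi_continuous.
- move=> c a; rewrite pphi_image => -[ca1 ca2].
  have L : psi c.1 (lsubmx b) @[b --> a] --> psi c.1 (lsubmx a).
    apply: (@cvg_comp _ _ _ lsubmx (psi c.1) (nbhs a) (nbhs (lsubmx a))).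
      exact: continuous_lsubmx.
    exact: psi_continuous.
  have R' : psi c.2 (rsubmx b) @[b --> a] --> psi c.2 (rsubmx a).
    apply: (@cvg_comp _ _ _ rsubmx (psi c.2) (nbhs a) (nbhs (rsubmx a))).
      exact: continuous_rsubmx.
    exact: psi_continuous.
  exact: cvg_pair L R'.
- move=> [x y]; have [c cx] := dom_cover x; have [c' cy] := dom_cover y.
  by exists (c, c').
- move=> c c'; rewrite pdomI pphi_image ptransition.
  by apply: smooth_on_row_map; first [exact: transition_open
                                     |exact: transition_smooth].
- move=> [x y] [x' y'] H; congr pair.
    apply: manifold_hausdorff => A B nA nB.
    have [||z [[Az _] [Bz _]]] := H (A `*` setT) (B `*` setT).
    + by exists (A, setT) => //; split => //; exact: filterT.
    + by exists (B, setT) => //; split => //; exact: filterT.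
    by exists z.1.
  apply: manifold_hausdorff => A B nA nB.
  have [||z [[_ Az] [_ Bz]]] := H (setT `*` A) (setT `*` B).
  + by exists (setT, A) => //; split => //; exact: filterT.
  + by exists (setT, B) => //; split => //; exact: filterT.
  by exists z.2.
- have [B1 cB1 [oB1 bB1]] := manifold_second_countable M.
  have [B2 cB2 [oB2 bB2]] := manifold_second_countable N.
  exists ((fun AB : set M * set N => AB.1 `*` AB.2) @` (B1 `*` B2)).
    by apply: card_le_trans (card_image_le _ _) _; exact: countableX.
  split=> [_ [[A1 A2] [/= /oB1 o1 /oB2 o2] <-]|[x y] V [[A1 A2] [/= /bB1 n1 /bB2 n2] AV]].
    exact: open_setX.
  have [C1 [/= BC1 C1x] CA1] := n1; have [C2 [/= BC2 C2y] CA2] := n2.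
  exists (C1 `*` C2); first by split; [exists (C1, C2)|].
  by move=> z [z1 z2]; apply: AV; split; [exact: CA1|exact: CA2].
Defined.

Definition pair_tangent (z : prod_manifold) (v : tangent z.1) (w : tangent z.2) :
  tangent z.
Proof.
exists (fun c : chart prod_manifold => row_mx (tcoord v c.1) (tcoord w c.2)).
move=> [c1 c2] [c1' c2'] [/= h1 h2] [h1' h2'].
have D1 : differentiable (phi c1' \o psi c1) (lsubmx (pphi (c1, c2) z)).
  rewrite row_mxKl; apply: (@transition_smooth _ _ M c1 c1' [::]).
  by exists z.1.
have D2 : differentiable (phi c2' \o psi c2) (rsubmx (pphi (c1, c2) z)).
  rewrite row_mxKr; apply: (@transition_smooth _ _ N c2 c2' [::]).
  by exists z.2.
have [_] := is_diff_row_map D1 D2.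
rewrite -[row_map _ _]/(pphi (c1', c2') \o ppsi (c1, c2)) => ->.
rewrite /row_map !row_mxKl !row_mxKr /=.
by rewrite -(tcoord_compat v h1 h1') -(tcoord_compat w h2 h2').
Defined.

End Product.

Section InternalModel.
Context {R : realType}.

(* y |-> f2 y need not be smooth beyond what the smoothness of F imposes. *)
Definition contains_internal_model n (f g : 'rV[R]_n -> 'rV[R]_n)
    (h : 'rV[R]_n -> R) (U : set (R -> R)) :=
  exists q : nat, (q <= n)%N /\
  exists (Z1 : manifold R q) (Z2 : manifold R (n - q)) (kappa : Z1 -> R)
    (f1 g1 : forall z : prod_manifold Z1 Z2, tangent z.1)
    (f2 : R -> vector_field Z2)
    (Phi : euclid n -> prod_manifold Z1 Z2),
  let F : vector_field (prod_manifold Z1 Z2) :=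
    fun z => pair_tangent (f1 z) (f2 (kappa z.1) z.2) in
  let G : vector_field (prod_manifold Z1 Z2) :=
    fun z => pair_tangent (g1 z) (tangent0 z.2) in
  [/\ [/\ smooth_fun kappa, smooth_vector_field F, smooth_vector_field G &
          forall y, smooth_vector_field (f2 y)],
      diffeomorphism Phi,
      [/\ pushes_forward Phi (euclid_field f) F,
          pushes_forward Phi (euclid_field g) G &
          forall x, kappa (Phi x).1 = h x] &
      exists varphi : Z2 -> R, forall u, U u ->
        exists z2 : R -> Z2, integral_curve (f2 0) half_line z2 /\
          forall t, 0 <= t -> varphi (z2 t) = u t].

End InternalModel.

(* Main.v *)
(* Let xi = (h, L_f h, ..., L_f^(r-1) h).  Up to order and sign the fields tau_i are
   dual to the components of xi; being complete and commuting, they generate an action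
   E of R^r on R^n with xi (E s x) = xi x + s.  Hence Z1 = R^r, the level set
   Z2 = {xi = 0} and x |-> (xi x, E (- xi x) x) give a global splitting, charts of Z2
   coming from the inverse function theorem.  Functions constant along all tau_i have
   an f-derivative constant along all of them but tau_r, so that the Z2-component of f
   depends on xi only through h, while that of g vanishes.

   For the generation property, let u come from a Poisson-stable w, with w (t_i)
   tending to w 0, and let x be a bounded trajectory driven by u.  Along a subsequence
   x (t_i) tends to some p, and by continuous dependence for the joint system the
   trajectory from p driven by u has output lim h (x (t + t_i)) = 0.  It therefore
   stays in Z2 and u = - L_f^r h / L_g L_f^(r-1) h along it. *)
Require Import Defs.
From HB Require Import structures.
From mathcomp Require Import all_boot all_order all_algebra.
From mathcomp Require Import all_classical all_reals all_analysis.
From mathcomp Require Import ring lra.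
Set Implicit Arguments.
Unset Strict Implicit.
Unset Printing Implicit Defensive.
Import Order.TTheory GRing.Theory Num.Theory.
Import numFieldNormedType.Exports.
Local Open Scope classical_set_scope.
Local Open Scope ring_scope.

(** * Functions of class C^k *)

(** Why tau_r is singled out: for a function l constant along all tau_i, the identity L_[X, Y] = L_X
    L_Y - L_Y L_X gives L_tau_i (L_f l) = - L_tau_(i+1) l = 0 as long as i < r, where f may be
    replaced by ftilde because gtilde = tau_1 kills l. For i = r the next bracket is not one of the
    given fields. Since tau_r is dual, up to sign, to h itself, the dependence left open is exactly
    the dependence on y that the form of F allows.

    The analytic core is the smoothness of E. Completeness only gives a solution through each point.
    Gronwall estimates make the flow differentiable; its derivative is a component of the flow of
    the tangent lift, so differentiability for all fields at once bootstraps to every order.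
    Smoothness in s follows by treating s as a state with zero velocity.

    In the limit argument Poisson stability preserves the input: the shifted inputs come from
    exosystem states tending to w 0, so the limit trajectory is driven by u itself and not by
    another member of the class. *)

Section Ck.
Context {R : realType}.

(** The order is made explicit so that closure properties can be proved by induction on it.
    Derivatives up to order k are required to be Frechet differentiable, so [Ck 0] is
    differentiability, and [Ck 1] already makes the first derivatives continuous. *)
Definition Ck (k : nat) (V W : normedModType R) (U : set V) (F : V -> W) :=
  forall vs x, (size vs <= k)%N -> U x -> differentiable (iter_derive vs F) x.

Lemma smooth_onP (V W : normedModType R) (U : set V) (F : V -> W) :
  smooth_on U F <-> forall k, Ck k U F.
Proof.
split=> [sF k vs x _ Ux|sF vs x Ux]; first exact: sF.
exact: (sF (size vs)).
Qed.

Lemma smoothCk k (V W : normedModType R) (U : set V) (F : V -> W) :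
  smooth_on U F -> Ck k U F.
Proof. by move=> sF vs x _ Ux; exact: sF. Qed.

Lemma iter_derive_rcons (V W : normedModType R) (F : V -> W) vs v :
  iter_derive (rcons vs v) F = iter_derive vs ('D_v F).
Proof. by rewrite /iter_derive foldr_rcons. Qed.

Lemma CkSP k (V W : normedModType R) (U : set V) (F : V -> W) :
  Ck k.+1 U F <->
  (forall x, U x -> differentiable F x) /\ forall v, Ck k U ('D_v F).
Proof.
split=> [CF|[dF CF] vs x].
  split=> [x Ux|v vs x svs Ux]; first exact: (CF [::]).
  by rewrite -iter_derive_rcons; apply: CF => //; rewrite size_rcons.
elim/last_ind: vs => [_ Ux|vs v _]; first exact: dF.
by rewrite size_rcons iter_derive_rcons; exact: CF.
Qed.

Lemma CkS_diff k (V W : normedModType R) (U : set V) (F : V -> W) :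
  Ck k U F -> forall x, U x -> differentiable F x.
Proof. by move=> CF x Ux; exact: (CF [::]). Qed.

Lemma Ck0P (V W : normedModType R) (U : set V) (F : V -> W) :
  (forall x, U x -> differentiable F x) -> Ck 0 U F.
Proof. by move=> dF [|//] x _; exact: dF. Qed.

Lemma CkW k (V W : normedModType R) (U : set V) (F : V -> W) :
  Ck k.+1 U F -> Ck k U F.
Proof. by move=> CF vs x svs; apply: CF; exact: leqW. Qed.

Lemma CkD k (V W : normedModType R) (U : set V) (F : V -> W) v :
  Ck k.+1 U F -> Ck k U ('D_v F).
Proof. by move=> /CkSP[]. Qed.

Lemma eq_Ck k (V W : normedModType R) (U : set V) (F G : V -> W) :
  open U -> (forall x, U x -> F x = G x) -> Ck k U G -> Ck k U F.
Proof.
move=> oU FG sG vs x svs Ux; apply: near_eq_differentiable (sG vs x svs Ux).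
apply: (@filterS _ _ _ U); first by move=> y; exact: eq_iter_derive.
by move: oU; rewrite openE; apply.
Qed.

Lemma sub_smooth (V W : normedModType R) (U U' : set V) (F : V -> W) :
  U `<=` U' -> smooth_on U' F -> smooth_on U F.
Proof. by move=> UU' sF vs x /UU'; exact: sF. Qed.

Lemma Ck_cst k (V W : normedModType R) (U : set V) (c : W) :
  Ck k U (fun _ : V => c).
Proof.
elim: k c => [|k IH] c; first by apply: Ck0P => x _; exact: differentiable_cst.
apply/CkSP; split=> [x _|v]; first exact: differentiable_cst.
suff -> : 'D_v (fun=> c) = (fun _ : V => 0 : W) by exact: IH.
by apply/funext => x; exact: derive_cst.
Qed.

Lemma Ck_add k (V W : normedModType R) (U : set V) (F G : V -> W) :
  open U -> Ck k U F -> Ck k U G -> Ck k U (fun x => F x + G x).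
Proof.
move=> oU; elim: k F G => [|k IH] F G CF CG.
  apply: Ck0P => x Ux.
  exact: differentiableD (CkS_diff CF Ux) (CkS_diff CG Ux).
apply/CkSP; split=> [x Ux|v].
  exact: differentiableD (CkS_diff CF Ux) (CkS_diff CG Ux).
apply: (eq_Ck (G := fun x => 'D_v F x + 'D_v G x)) => // [x Ux|].
  rewrite deriveD //; apply: diff_derivable.
    exact: (CkS_diff CF Ux).
  exact: (CkS_diff CG Ux).
by apply: IH; exact: CkD.
Qed.

Lemma Ck_sum k (V W : normedModType R) (U : set V) (I : Type) (r : seq I)
    (P : pred I) (F : I -> V -> W) :
  open U -> (forall i, P i -> Ck k U (F i)) ->
  Ck k U (fun x => \sum_(i <- r | P i) F i x).
Proof.
move=> oU CF; elim: r => [|i r IH].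
  rewrite (_ : (fun x => _) = fun=> 0); first exact: Ck_cst.
  by apply/funext => x; rewrite big_nil.
rewrite (_ : (fun x => _) = fun x => if P i then F i x + \sum_(j <- r | P j) F j x
  else \sum_(j <- r | P j) F j x); last by apply/funext => x; rewrite big_cons.
case: (boolP (P i)) => // Pi; apply: Ck_add => //; exact: CF.
Qed.

Lemma derive_comp (V W X : normedModType R) (F : W -> X) (G : V -> W) x v :
  differentiable G x -> differentiable F (G x) ->
  'D_v (F \o G) x = 'd F (G x) ('D_v G x).
Proof.
move=> dG dF; rewrite !deriveE //; last exact: differentiable_comp.
by rewrite diff_comp.
Qed.

Lemma Ck_lin k (V W X : normedModType R) (U : set V) (L : W -> X)
    (F : V -> W) :
  open U -> linear L -> continuous L -> Ck k U F -> Ck k U (fun x => L (F x)).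
Proof.
move=> oU lL cL.
pose LM := GRing.isLinear.Build _ _ _ _ _ lL.
pose L' : {linear _ -> _} := HB.pack L LM.
have dL y : differentiable L y by exact: (@linear_differentiable _ _ _ L').
elim: k F => [|k IH] F CF.
  by apply: Ck0P => x Ux; apply: differentiable_comp (CkS_diff CF Ux) _.
apply/CkSP; split=> [x Ux|v].
  by apply: differentiable_comp (CkS_diff CF Ux) _.
apply: (eq_Ck (G := fun x => L ('D_v F x))) => // [x Ux|].
  rewrite -[fun x => L (F x)]/(L \o F) (derive_comp _ (CkS_diff CF Ux)) //.
  by rewrite (@diff_lin _ _ _ L').
by apply: IH; exact: CkD.
Qed.

Lemma Ck_mul k (V : normedModType R) (U : set V) (a b : V -> R) :
  open U -> Ck k U a -> Ck k U b -> Ck k U (fun x => a x * b x).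
Proof.
move=> oU; elim: k a b => [|k IH] a b Ca Cb.
  apply: Ck0P => x Ux.
  exact: differentiableM (CkS_diff Ca Ux) (CkS_diff Cb Ux).
apply/CkSP; split=> [x Ux|v].
  exact: differentiableM (CkS_diff Ca Ux) (CkS_diff Cb Ux).
apply: (eq_Ck (G := fun x => a x * 'D_v b x + b x * 'D_v a x)) => // [x Ux|].
  rewrite deriveM //; apply: diff_derivable; first exact: (CkS_diff Ca Ux).
  exact: (CkS_diff Cb Ux).
by apply: Ck_add => //; apply: IH; by [exact: CkW|exact: CkD].
Qed.

Lemma Ck_prod k (V : normedModType R) (U : set V) (I : Type) (r : seq I)
    (P : pred I) (F : I -> V -> R) :
  open U -> (forall i, P i -> Ck k U (F i)) ->
  Ck k U (fun x => \prod_(i <- r | P i) F i x).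
Proof.
move=> oU CF; elim: r => [|i r IH].
  rewrite (_ : (fun x => _) = fun=> 1); first exact: Ck_cst.
  by apply/funext => x; rewrite big_nil.
rewrite (_ : (fun x => _) = fun x => if P i then F i x * \prod_(j <- r | P j) F j x
  else \prod_(j <- r | P j) F j x); last by apply/funext => x; rewrite big_cons.
case: (boolP (P i)) => // Pi; apply: Ck_mul => //; exact: CF.
Qed.

Lemma Ck_inv k (V : normedModType R) (U : set V) (a : V -> R) :
  open U -> (forall x, U x -> a x != 0) -> Ck k U a ->
  Ck k U (fun x => (a x)^-1).
Proof.
move=> oU a0; elim: k => [|k IH] Ca.
  apply: Ck0P => x Ux.
  by apply: differentiableV; [exact: (CkS_diff Ca Ux)|exact: a0].
apply/CkSP; split=> [x Ux|v].
  by apply: differentiableV; [exact: (CkS_diff Ca Ux)|exact: a0].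
apply: (eq_Ck (G := fun x => - 1 * ((a x)^-1 * ((a x)^-1 * 'D_v a x)))) => // [x Ux|].
  rewrite deriveV //; [|exact: a0|exact/diff_derivable/(CkS_diff Ca Ux)].
  by rewrite scaleNr mulN1r mulrA -invfM -expr2.
have Ca' := IH (CkW Ca).
by do 3?[apply: Ck_mul => //]; [exact: Ck_cst|exact: CkD].
Qed.

Lemma Ck_coord k (V : normedModType R) (U : set V) n (F : V -> 'rV[R]_n) i :
  open U -> Ck k U F -> Ck k U (fun x => F x 0 i).
Proof.
move=> oU; apply: (Ck_lin (L := fun N : 'rV[R]_n => N 0 i)) => //.
  by move=> c A B; rewrite !mxE.
exact: coord_continuous.
Qed.

Lemma Ck_scalel k (V W : normedModType R) (U : set V) (a : V -> R) (w : W) :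
  open U -> Ck k U a -> Ck k U (fun x => a x *: w).
Proof.
move=> oU; apply: (Ck_lin (L := fun a : R => a *: w)) => //.
  by move=> c x y; rewrite scalerDl scalerA.
exact: scalel_continuous.
Qed.

Lemma CkP_coord k (V : normedModType R) (U : set V) n (F : V -> 'rV[R]_n) :
  open U -> (forall i, Ck k U (fun x => F x 0 i)) -> Ck k U F.
Proof.
move=> oU CF; have -> : F = fun x => \sum_i F x 0 i *: delta_mx 0 i.
  by apply/funext => x; exact: row_sum_delta.
by apply: Ck_sum => // i _; exact: Ck_scalel.
Qed.

Lemma scale_is_bilinear (W : normedModType R) :
  bilinear_for
    (GRing.Scale.Law.clone _ _ *:%R _) (GRing.Scale.Law.clone _ _ *:%R _)
    (@GRing.scale R W).
Proof.
split=> [u|u] a x y /=; first by rewrite scalerDl -scalerA.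
by rewrite scalerDr !scalerA mulrC.
Qed.

Lemma is_diff_scale (V W : normedModType R) (a : V -> R) (F : V -> W) x :
  differentiable a x -> differentiable F x ->
  is_diff x (fun x => a x *: F x) (fun v => a x *: 'd F x v + 'd a x v *: F x).
Proof.
move=> da dF.
pose M := bilinear_isBilinear.Build R R W W _ _ (@GRing.scale R W)
  (scale_is_bilinear W).
pose B : {bilinear R -> W -> W} := HB.pack (@GRing.scale R W) M.
have cB : continuous (fun p : R * W => B p.1 p.2).
  by move=> p; exact: scale_continuous.
have dp := differentiable_pair da dF.
have dB := differentiable_bilin (a x, F x) cB.
apply: DiffDef; first exact: (differentiable_comp dp dB).
rewrite -[LHS]/('d ((fun p => B p.1 p.2) \o (fun x => (a x, F x))) x : V -> W).
by rewrite (diff_comp dp dB) (diff_bilin _ cB) (diff_pair da dF).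
Qed.

Lemma Ck_scale k (V W : normedModType R) (U : set V) (a : V -> R)
    (F : V -> W) :
  open U -> Ck k U a -> Ck k U F -> Ck k U (fun x => a x *: F x).
Proof.
move=> oU; elim: k a F => [|k IH] a F Ca CF.
  apply: Ck0P => x Ux.
  by have [] := is_diff_scale (CkS_diff Ca Ux) (CkS_diff CF Ux).
have D x : U x -> is_diff x (fun x => a x *: F x) _ := fun Ux =>
  is_diff_scale (CkS_diff Ca Ux) (CkS_diff CF Ux).
apply/CkSP; split=> [x Ux|v]; first by have [] := D x Ux.
apply: (eq_Ck (G := fun x => a x *: 'D_v F x + 'D_v a x *: F x)) => // [x Ux|].
  have [d dE] := D x Ux; rewrite (deriveE v d) dE.
  by rewrite (deriveE v (CkS_diff Ca Ux)) (deriveE v (CkS_diff CF Ux)).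
by apply: Ck_add => //; apply: IH; by [exact: CkW|exact: CkD].
Qed.

Lemma rV_linear_continuous n (W : normedModType R) (L : {linear 'rV[R]_n -> W}) :
  continuous L.
Proof.
have -> : (L : 'rV[R]_n -> W) =
    \sum_(i < n) (fun x : 'rV[R]_n => x 0 i *: L (delta_mx 0 i)).
  apply/funext => x; rewrite fct_sumE [in LHS](row_sum_delta x) linear_sum.
  by apply: eq_bigr => i _; rewrite linearZ.
move=> x; apply: (big_ind (fun f : 'rV[R]_n -> W => {for x, continuous f})).
- exact: cst_continuous.
- by move=> f g; exact: continuousD.
- move=> i _.
  apply: (@cvg_comp _ _ _ (fun x : 'rV[R]_n => x 0 i) ( *:%R^~ (L (delta_mx 0 i)))).
    exact: coord_continuous.
  exact: scalel_continuous.
Qed.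

(** Reduces a derivative in a direction that moves with the point to derivatives in fixed basis
    directions, the only kind that [iter_derive] iterates. *)
Lemma diff_sum_coord n (W : normedModType R) (F : 'rV[R]_n -> W) x v :
  differentiable F x -> 'd F x v = \sum_i v 0 i *: 'D_(delta_mx 0 i) F x.
Proof.
move=> dF; rewrite {1}(row_sum_delta v) linear_sum.
by apply: eq_bigr => i _; rewrite linearZ deriveE.
Qed.

(** The intermediate space is ['rV[R]_n] so that the derivative of the composite is a finite sum of
    products of functions to which the induction hypothesis applies. *)
Lemma Ck_comp k (V W : normedModType R) n (U : set V) (U' : set 'rV[R]_n)
    (F : 'rV[R]_n -> W) (G : V -> 'rV[R]_n) :
  open U -> (forall x, U x -> U' (G x)) -> Ck k U' F -> Ck k U G ->
  Ck k U (fun x => F (G x)).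
Proof.
move=> oU GU; elim: k F => [|k IH] F CF CG.
  apply: Ck0P => x Ux; apply: differentiable_comp (CkS_diff CG Ux) _.
  by apply: (CkS_diff CF); exact: GU.
have dF x : U x -> differentiable F (G x).
  by move=> Ux; apply: (CkS_diff CF); exact: GU.
apply/CkSP; split=> [x Ux|v].
  by apply: differentiable_comp (CkS_diff CG Ux) _; exact: dF.
apply: (eq_Ck (G := fun x => \sum_i 'D_v G x 0 i *: 'D_(delta_mx 0 i) F (G x))) => //.
  move=> x Ux; rewrite -[fun x => _]/(F \o G).
  by rewrite (derive_comp _ (CkS_diff CG Ux) (dF _ Ux)) (diff_sum_coord _ (dF _ Ux)).
apply: Ck_sum => // i _; apply: Ck_scale => //.
  by apply: Ck_coord => //; exact: CkD.
by apply: (IH ('D_(delta_mx 0 i) F)); [exact: CkD|exact: CkW].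
Qed.

Lemma Ck_id k (V : normedModType R) (U : set V) : Ck k U (@id V).
Proof. by move: k; apply/smooth_onP; exact: smooth_on_id. Qed.

Lemma Ck_rVlin k (V W : normedModType R) n (U : set V) (L : 'rV[R]_n -> W)
    (F : V -> 'rV[R]_n) :
  open U -> linear L -> Ck k U F -> Ck k U (fun x => L (F x)).
Proof.
move=> oU lL; apply: Ck_lin => //.
pose LM := GRing.isLinear.Build _ _ _ _ _ lL.
pose L' : {linear _ -> _} := HB.pack L LM.
exact: (rV_linear_continuous (L := L')).
Qed.

Lemma Ck_mulmx k (V : normedModType R) n p (U : set V) (B : 'M[R]_(n, p))
    (F : V -> 'rV[R]_n) :
  open U -> Ck k U F -> Ck k U (fun x => F x *m B).
Proof.
move=> oU; apply: (Ck_rVlin (L := fun u => u *m B)) => // c u v.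
by rewrite mulmxDl -scalemxAl.
Qed.

Lemma Ck_lsubmx k (V : normedModType R) n p (U : set V)
    (F : V -> 'rV[R]_(n + p)) :
  open U -> Ck k U F -> Ck k U (fun x => lsubmx (F x)).
Proof. by move=> oU; apply: (Ck_rVlin (L := lsubmx)) => // c u v; rewrite linearP. Qed.

Lemma Ck_rsubmx k (V : normedModType R) n p (U : set V)
    (F : V -> 'rV[R]_(n + p)) :
  open U -> Ck k U F -> Ck k U (fun x => rsubmx (F x)).
Proof. by move=> oU; apply: (Ck_rVlin (L := rsubmx)) => // c u v; rewrite linearP. Qed.

Lemma Ck_row_mx k (V : normedModType R) n p (U : set V)
    (F : V -> 'rV[R]_n) (G : V -> 'rV[R]_p) :
  open U -> Ck k U F -> Ck k U G -> Ck k U (fun x => row_mx (F x) (G x)).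
Proof.
move=> oU CF CG.
rewrite (_ : (fun x => _) = fun x => row_mx (F x) 0 + row_mx 0 (G x)); last first.
  by apply/funext => x; rewrite add_row_mx addr0 add0r.
apply: Ck_add => //.
  apply: (Ck_rVlin (L := fun u => row_mx u (0 : 'rV_p))) => // c u v.
  by rewrite scale_row_mx add_row_mx scaler0 addr0.
apply: (Ck_rVlin (L := fun u => row_mx (0 : 'rV_n) u)) => // c u v.
by rewrite scale_row_mx add_row_mx scaler0 addr0.
Qed.

Lemma Ck_dir k (V W : normedModType R) n (U : set V) (U' : set 'rV[R]_n)
    (F : 'rV[R]_n -> W) (A B : V -> 'rV[R]_n) :
  open U -> (forall x, U x -> U' (A x)) -> Ck k.+1 U' F -> Ck k U A ->
  Ck k U B -> Ck k U (fun x => 'd F (A x) (B x)).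
Proof.
move=> oU UA CF CA CB.
apply: (eq_Ck (G := fun x => \sum_i B x 0 i *: 'D_(delta_mx 0 i) F (A x))) => //.
  by move=> x Ux; rewrite diff_sum_coord //; apply: (CkS_diff CF); exact: UA.
apply: Ck_sum => // i _; apply: Ck_scale => //; first exact: Ck_coord.
by apply: (Ck_comp (F := 'D_(delta_mx 0 i) F) oU UA) => //; exact: CkD.
Qed.

Lemma Ck_det k (V : normedModType R) n (U : set V) (M : V -> 'M[R]_n) :
  open U -> (forall i j, Ck k U (fun x => M x i j)) ->
  Ck k U (fun x => \det (M x)).
Proof.
move=> oU CM; apply: Ck_sum => // s _; apply: Ck_mul => //; first exact: Ck_cst.
by apply: Ck_prod => // i _; exact: CM.
Qed.

Lemma Ck_invmx k (V : normedModType R) n (U : set V) (M : V -> 'M[R]_n) i j :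
  open U -> (forall x, U x -> M x \in unitmx) ->
  (forall i j, Ck k U (fun x => M x i j)) ->
  Ck k U (fun x => invmx (M x) i j).
Proof.
move=> oU uM CM.
(* Cramer's rule: the entries of the inverse are polynomials in the entries of the matrix divided by
   the determinant. *)
apply: (eq_Ck (G := fun x => (\det (M x))^-1 * cofactor (M x) j i)) => //.
  by move=> x Ux; rewrite /invmx uM // !mxE.
apply: Ck_mul => //.
  apply: Ck_inv => //; last exact: Ck_det.
  by move=> x Ux; rewrite -unitfE -unitmxE; exact: uM.
apply: Ck_mul => //; first exact: Ck_cst.
apply: Ck_det => // i' j'.
by rewrite (_ : (fun x => _) = fun x => M x (lift j i') (lift i j'));
  [exact: CM|apply/funext => x; rewrite !mxE].
Qed.

End Ck.

(** * Lipschitz and Taylor estimates *)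

Section Norm.
Context {R : realType}.

Lemma rV_coord_le n (x : 'rV[R]_n) i : `|x 0 i| <= `|x|.
Proof.
by rewrite [leRHS]/Num.Def.normr/= mx_normrE; exact: (le_bigmax _ _ (0, i)).
Qed.

Lemma rV_norm_le n (x : 'rV[R]_n) e : 0 <= e -> (forall i, `|x 0 i| <= e) ->
  `|x| <= e.
Proof.
move=> e0 xe; rewrite [leLHS]/Num.Def.normr/= mx_normrE.
by apply: bigmax_le => // -[i j] _; rewrite /= ord1.
Qed.

Lemma is_derive_coord n (x : R -> 'rV[R]_n) (t : R) (v : 'rV[R]_n) i :
  is_derive t 1 x v -> is_derive t 1 (fun s => x s 0 i) (v 0 i).
Proof.
move=> [dx <-]; have /derivable_mxP dxi := dx.
by apply: DeriveDef => //; rewrite derive_mx // mxE.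
Qed.

Lemma is_deriveP_coord n (x : R -> 'rV[R]_n) (t : R) (v : 'rV[R]_n) :
  (forall i, is_derive t 1 (fun s : R => x s 0 i : R) (v 0 i)) ->
  is_derive t 1 x v.
Proof.
move=> dx; have D : derivable x t 1.
  by apply/derivable_mxP => i j; rewrite ord1; have [] := dx j.
apply: DeriveDef => //; rewrite derive_mx //; apply/rowP => j.
by rewrite mxE; have [] := dx j.
Qed.

Lemma within_continuous_coord n (x : R -> 'rV[R]_n) i (A : set R) :
  {within A, continuous x} -> {within A, continuous (fun s => x s 0 i)}.
Proof.
move=> cx t; apply: (@cvg_comp _ _ _ x (fun N : 'rV[R]_n => N 0 i) _ _ _ (cx t)).
exact: coord_continuous.
Qed.

(** The norm is the maximum of the coordinates, so the scalar mean value theorem applied to each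
    coordinate keeps the constant [M]. *)
Lemma curve_mvt n (x dx : R -> 'rV[R]_n) (a b M : R) : a <= b -> 0 <= M ->
  (forall t, t \in `]a, b[ -> is_derive t 1 x (dx t)) ->
  (forall t, t \in `]a, b[ -> `|dx t| <= M) ->
  {within `[a, b], continuous x} -> `|x b - x a| <= M * (b - a).
Proof.
move=> ab M0 dX bX cX; apply: rV_norm_le => [|i].
  by rewrite mulr_ge0 ?subr_ge0.
move: ab; rewrite le_eqVlt => /predU1P[->|ab].
  by rewrite !subrr mulr0 mxE normr0.
have [c cab E] := MVT ab (fun t tab => is_derive_coord i (dX t tab))
  (within_continuous_coord (i := i) cX).
have ba : 0 <= b - a by rewrite subr_ge0 ltW.
rewrite !mxE E normrM (ger0_norm ba); apply: ler_wpM2r => //.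
exact: le_trans (rV_coord_le _ _) (bX _ cab).
Qed.

Lemma diff_lip n p (C : set 'rV[R]_n) (F : 'rV[R]_n -> 'rV[R]_p) (M : R)
    (x y : 'rV[R]_n) :
  0 <= M ->
  (forall s : R, 0 <= s <= 1 -> C (y + s *: (x - y))) ->
  (forall c, C c -> differentiable F c) ->
  (forall c v, C c -> `|'d F c v| <= M * `|v|) ->
  `|F x - F y| <= M * `|x - y|.
Proof.
move=> M0 Cxy dF bF; pose z (s : R) := y + s *: (x - y).
have dz (s : R) : is_derive s 1 z (x - y).
  have [d dE] : is_diff s (fun s : R => s *: (x - y)) ( *:%R^~ (x - y)).
    exact: is_diff_scalel.
  have D : is_derive s 1 (fun s : R => s *: (x - y)) (x - y).
    apply: DeriveDef; first exact: diff_derivable.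
    by rewrite deriveE // dE scale1r.
  by have := is_deriveD (is_derive_cst y s 1) D; rewrite add0r.
have dFz (s : R) : 0 <= s <= 1 -> is_derive s 1 (F \o z) ('d F (z s) (x - y)).
  move=> s01; have [dzs Ez] := dz s; have d1 := dF _ (Cxy s s01).
  have d2 : differentiable z s by apply/derivable1_diffP.
  apply: DeriveDef; first by apply/derivable1_diffP/differentiable_comp.
  by rewrite derive_comp // Ez.
have := @curve_mvt _ (F \o z) (fun s => 'd F (z s) (x - y)) 0 1 (M * `|x - y|).
rewrite subr0 mulr1 /z /= scale1r scale0r addr0 addrCA subrr addr0; apply => //.
- by rewrite mulr_ge0.
- move=> s; rewrite in_itv /= => /andP[s0 s1]; apply: dFz.
  by rewrite !ltW.
- move=> s; rewrite in_itv /= => /andP[s0 s1]; apply: bF; apply: Cxy.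
  by rewrite !ltW.
- apply: derivable_within_continuous => s; rewrite in_itv /= => s01.
  by have [] := dFz s s01.
Qed.

Definition cball n (p : 'rV[R]_n) (r : R) : set 'rV[R]_n :=
  [set x | `|x - p| <= r].

Lemma cball_convex n (p : 'rV[R]_n) r x y s : cball p r x -> cball p r y ->
  0 <= s <= 1 -> cball p r (y + s *: (x - y)).
Proof.
rewrite /cball /= => px py /andP[s0 s1].
have -> : y + s *: (x - y) - p = s *: (x - p) + (1 - s) *: (y - p).
  apply/rowP => i; rewrite !mxE; ring.
apply: le_trans (ler_normD _ _) _; rewrite !normrZ ger0_norm //.
rewrite (ger0_norm (x := 1 - s)) ?subr_ge0 //.
have : s * `|x - p| <= s * r by exact: ler_wpM2l.
have : (1 - s) * `|y - p| <= (1 - s) * r by apply: ler_wpM2l; rewrite ?subr_ge0.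
lra.
Qed.

Lemma cball_compact n (p : 'rV[R]_n) r : compact (cball p r).
Proof.
apply: bounded_closed_compact.
  exists (`|p| + r); split; first exact: num_real.
  move=> M ltM x; rewrite /cball /= => px; apply: le_trans (ltW ltM).
  by rewrite -{1}(subrK p x) addrC; apply: le_trans (ler_normD _ _) _; rewrite lerD2l.
rewrite (_ : cball p r = (fun x => `|x - p|) @^-1` [set x | x <= r]) //.
apply: preimage_closed; last exact: closed_le.
move=> x _; apply: (@continuous_comp _ _ _ (fun x : 'rV[R]_n => x - p)
  (fun x : 'rV[R]_n => `|x|)).
  by apply: continuousB => //; exact: cst_continuous.
exact: norm_continuous.
Qed.

Lemma bounded_on_cball n p (U : set 'rV[R]_n) (F : 'rV[R]_n -> 'rV[R]_p) c r :
  cball c r `<=` U -> (forall x, U x -> {for x, continuous F}) ->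
  exists2 M, 0 < M & forall x, cball c r x -> `|F x| <= M.
Proof.
move=> rU cF.
have : compact (F @` cball c r).
  apply: continuous_compact; last exact: cball_compact.
  apply: continuous_in_subspaceT => x; rewrite inE => /rU; exact: cF.
move=> /compact_bounded[M [Mr HM]]; exists (`|M| + 1).
  by rewrite ltr_wpDl.
move=> x cx; apply: HM; last by exists x.
by rewrite (le_lt_trans (ler_norm M)) // ltrDl.
Qed.

Lemma diff_bound n p (U : set 'rV[R]_n) (F : 'rV[R]_n -> 'rV[R]_p) c r :
  Ck 1 U F -> cball c r `<=` U ->
  exists2 M, 0 < M & forall x v, cball c r x -> `|'d F x v| <= M * `|v|.
Proof.
move=> CF rU.
have /choice[M HM] : forall i : 'I_n, exists M, 0 < M /\
    forall x, cball c r x -> `|'D_(delta_mx 0 i) F x| <= M.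
  move=> i; have [|M M0 HM] := @bounded_on_cball _ _ U ('D_(delta_mx 0 i) F) c r rU.
    by move=> x Ux; apply/differentiable_continuous/(CkS_diff (CkD _ CF) Ux).
  by exists M.
(* The added 1 keeps the constant positive when the sum is empty. *)
exists (\sum_i M i + 1) => [|x v cx].
  by rewrite ltr_wpDl // sumr_ge0 // => i _; apply/ltW; have [] := HM i.
rewrite (diff_sum_coord v (CkS_diff CF (rU _ cx))).
apply: le_trans (ler_norm_sum _ _ _) _; rewrite mulrDl mulr_suml.
rewrite -[leLHS]addr0; apply: lerD; last by rewrite mul1r.
apply: ler_sum => i _; rewrite normrZ mulrC; apply: ler_pM => //.
  by have [_] := HM i; apply.
exact: rV_coord_le.
Qed.

Lemma Ck_lip n p (U : set 'rV[R]_n) (F : 'rV[R]_n -> 'rV[R]_p) c r :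
  Ck 1 U F -> cball c r `<=` U ->
  exists2 M, 0 < M & forall x y, cball c r x -> cball c r y ->
    `|F x - F y| <= M * `|x - y|.
Proof.
move=> CF rU; have [M M0 HM] := diff_bound CF rU; exists M => // x y cx cy.
apply: (@diff_lip _ _ (cball c r)) => //; first exact: ltW.
  by move=> s; exact: cball_convex.
by move=> z /rU Uz; exact: (CkS_diff CF Uz).
Qed.

Lemma Ck_diff_lip n p (U : set 'rV[R]_n) (F : 'rV[R]_n -> 'rV[R]_p) c r :
  Ck 2 U F -> cball c r `<=` U ->
  exists2 M, 0 < M & forall x y v, cball c r x -> cball c r y ->
    `|'d F x v - 'd F y v| <= M * `|x - y| * `|v|.
Proof.
move=> CF rU.
have /choice[M HM] : forall i : 'I_n, exists M, 0 < M /\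
    forall x y, cball c r x -> cball c r y ->
    `|'D_(delta_mx 0 i) F x - 'D_(delta_mx 0 i) F y| <= M * `|x - y|.
  by move=> i; have [M M0 HM] := Ck_lip (CkD (delta_mx 0 i) CF) rU; exists M.
exists (\sum_i M i + 1) => [|x y v cx cy].
  by rewrite ltr_wpDl // sumr_ge0 // => i _; apply/ltW; have [] := HM i.
have E z : cball c r z -> 'd F z v = \sum_i v 0 i *: 'D_(delta_mx 0 i) F z.
  by move=> /rU Uz; exact: diff_sum_coord (CkS_diff CF Uz).
rewrite (_ : 'd F x v - 'd F y v = (\sum_i v 0 i *: 'D_(delta_mx 0 i) F x) -
  (\sum_i v 0 i *: 'D_(delta_mx 0 i) F y)); last by congr (_ - _); exact: E.
rewrite -sumrB.
apply: le_trans (ler_norm_sum _ _ _) _; rewrite 2!mulrDl 2!mulr_suml.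
rewrite -[leLHS]addr0; apply: lerD; last by rewrite mul1r mulr_ge0.
apply: ler_sum => i _; rewrite -scalerBr normrZ mulrC; apply: ler_pM => //.
  by have [_] := HM i; apply.
exact: rV_coord_le.
Qed.

Lemma diff_sub_linear (V W : normedModType R) (F : V -> W) (L : {linear V -> W})
    z v : continuous L -> differentiable F z ->
  'd (fun z => F z - L z) z v = 'd F z v - L v.
Proof.
move=> cL dF; have dL : is_diff z L L.
  by apply: DiffDef; [exact: linear_differentiable|exact: diff_lin].
have [_ dE] := is_diffB (differentiableP dF) dL.
exact: (congr1 (@^~ v) dE).
Qed.

(** The mean value inequality is applied to z |-> F z - 'd F y z on the ball of radius [|x - y|]
    about y; there its differential is at most [M * |x - y|], which supplies the second factor. *)
Lemma Ck_taylor n p (U : set 'rV[R]_n) (F : 'rV[R]_n -> 'rV[R]_p) c r :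
  Ck 2 U F -> cball c r `<=` U ->
  exists2 M, 0 < M & forall x y, cball c r x -> cball c r y ->
    `|F x - F y - 'd F y (x - y)| <= M * `|x - y| ^+ 2.
Proof.
move=> CF rU; have [M M0 HM] := Ck_diff_lip CF rU; exists M => // x y cx cy.
have dF z : cball c r z -> differentiable F z by move=> /rU Uz; exact: (CkS_diff CF Uz).
have cl : continuous ('d F y) by apply: diff_continuous; exact: dF.
have dl z : differentiable ('d F y) z by exact: linear_differentiable.
pose G z := F z - 'd F y z.
have -> : F x - F y - 'd F y (x - y) = G x - G y by rewrite /G linearB opprB [X in _ + X]addrC addrACA [X in _ + X]addrC opprB.
rewrite expr2 mulrA.
apply: (@diff_lip _ _ (cball c r `&` cball y `|x - y|)).
- by rewrite mulr_ge0 // ltW.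
- move=> s s01; split; first exact: cball_convex.
  by apply: cball_convex; rewrite /cball //= subrr normr0.
- by move=> z [cz _]; exact: differentiableB (dF _ cz) (dl z).
- move=> z v [cz yz].
  rewrite (diff_sub_linear v cl (dF _ cz)).
  apply: le_trans (HM _ _ _ cz cy) _; apply: ler_wpM2r => //.
  by apply: ler_wpM2l => //; exact: ltW.
Qed.

End Norm.

(** * Real induction and the Gronwall inequality *)

Section Gronwall.
Context {R : realType}.

(** The infimum of the failures satisfies [P] by the first hypothesis, and the second then pushes
    the failures away from their infimum. At t = a the first hypothesis has no premise left and is
    the base case. *)
Lemma real_induction (P : set R) (a b : R) :
  (forall t, a <= t <= b -> (forall s, a <= s < t -> P s) -> P t) ->
  (forall t, a <= t < b -> P t ->
     exists2 d, 0 < d & forall s, t < s < t + d -> s <= b -> P s) ->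
  forall t, a <= t <= b -> P t.
Proof.
move=> Pcl Pop t0 t0ab; apply: contrapT => nP.
pose A := [set t | a <= t <= b /\ ~ P t].
have At0 : A t0 by [].
have lA : has_inf A.
  by split; [exists t0|exists a => t [/andP[]]].
have infle t : A t -> inf A <= t by move=> At; apply: ge_inf => //; exact: lA.2.
have am : a <= inf A by apply: lb_le_inf; [exists t0|move=> t [/andP[]]].
have /andP[at0 t0b] := t0ab.
have mb : inf A <= b by exact: le_trans (infle _ At0) t0b.
have Pm : P (inf A).
  apply: Pcl; first by rewrite am.
  move=> s /andP[as_ sm]; apply: contrapT => nPs.
  have /infle : A s by split=> //; rewrite as_ (le_trans (ltW sm)).
  by rewrite leNgt sm.
have mt0 : inf A < t0.
  rewrite lt_neqAle infle // andbT; apply/eqP => e; apply: nP; by rewrite -e.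
have [|d d0 Hd] := Pop (inf A) _ Pm; first by rewrite am (lt_le_trans mt0).
have [t At tm] := inf_adherent d0 lA.
have := infle _ At; rewrite le_eqVlt => /predU1P[e|mt].
  by case: At => _; rewrite -e; apply.
case: At => /andP[_ tb]; apply; apply: Hd => //; by rewrite mt.
Qed.

(** The squared Euclidean norm. It replaces the maximum norm in differential inequalities because it
    is differentiable. *)
Definition nsq n (x : 'rV[R]_n) : R := \sum_i x 0 i ^+ 2.

Lemma norm_le_nsq n (x : 'rV[R]_n) : `|x| ^+ 2 <= nsq x.
Proof.
have ns : 0 <= nsq x by apply: sumr_ge0 => i _; exact: sqr_ge0.
rewrite -(sqr_sqrtr ns) ler_pXn2r ?nnegrE ?sqrtr_ge0 //.
apply: rV_norm_le => [|i]; first exact: sqrtr_ge0.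
rewrite -sqrtr_sqr ler_sqrt // /nsq (bigD1 i) //= lerDl.
by apply: sumr_ge0 => j _; exact: sqr_ge0.
Qed.

Lemma nsq_le_norm n (x : 'rV[R]_n) : nsq x <= n%:R * `|x| ^+ 2.
Proof.
rewrite mulr_natl -[X in _ *+ X]card_ord -sumr_const; apply: ler_sum => i _.
rewrite -real_normK ?num_real // ler_pXn2r ?nnegrE //; exact: rV_coord_le.
Qed.

(** The leading [n] is the cost of comparing the maximum norm with the Euclidean one at the initial
    time; the exponent is the growth rate of [nsq] found in [gronwall]. *)
Definition gfactor n (K T : R) : R := n%:R * expR ((2 * n%:R * K + n%:R) * T).

(** With a = |y|, the inequality 2 a e <= a^2 + e^2 turns the bound on [dy] into nsq' <= C nsq + n
    e^2. Hence nsq (y t) * exp (- C t) - n e^2 t does not increase on the interval. *)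
Lemma gronwall n (y dy : R -> 'rV[R]_n) (T K e : R) : 0 <= T -> 0 <= K -> 0 <= e ->
  {within `[0, T], continuous y} ->
  (forall t, 0 < t < T -> is_derive t 1 y (dy t)) ->
  (forall t, 0 < t < T -> `|dy t| <= K * `|y t| + e) ->
  `|y T| ^+ 2 <= gfactor n K T * (`|y 0| ^+ 2 + e ^+ 2 * T).
Proof.
move=> T0 K0 e0 cy dY bY; pose C := 2 * n%:R * K + n%:R.
pose g t := nsq (y t) * expR (- C * t) - n%:R * e ^+ 2 * t.
pose dN t := \sum_i (2 * (y t 0 i * dy t 0 i)).
have dn t : 0 < t < T -> is_derive t 1 (fun t => nsq (y t)) (dN t).
  move=> tT.
  have -> : (fun t => nsq (y t)) = \sum_i (fun t => y t 0 i * y t 0 i).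
    by apply/funext => s; rewrite fct_sumE; apply: eq_bigr => i _; rewrite expr2.
  have D i : is_derive t 1 (fun t => y t 0 i * y t 0 i) (2 * (y t 0 i * dy t 0 i)).
    have Di := is_derive_coord i (dY t tT).
    by apply: is_derive_eq (is_deriveM Di Di) _; rewrite /GRing.scale /=; ring.
  apply: DeriveDef; first by apply: derivable_sum => i; have [] := D i.
  rewrite derive_sum; last by move=> i; have [] := D i.
  by apply: eq_bigr => i _; have [] := D i.
have dNle t : 0 < t < T -> dN t <= C * nsq (y t) + n%:R * e ^+ 2.
  move=> tT; have := bY t tT.
  have := norm_le_nsq (y t); set a := `|y t| => aN dyK.
  have a0 : 0 <= a by exact: normr_ge0.
  apply: (@le_trans _ _ (\sum_(i < n) (2 * (a * (K * a + e))))).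
    apply: ler_sum => i _; apply: ler_wpM2l => //.
    apply: le_trans (ler_norm _) _; rewrite normrM.
    apply: ler_pM => //; first exact: rV_coord_le.
    exact: le_trans (rV_coord_le _ _) dyK.
  rewrite sumr_const card_ord -[leLHS]mulr_natl /C.
  have h : 2 * (a * (K * a + e)) <= (2 * K + 1) * nsq (y t) + e ^+ 2.
    have : 2 * K * a ^+ 2 <= 2 * K * nsq (y t) by apply: ler_wpM2l => //; lra.
    have : 0 <= (a - e) ^+ 2 by exact: sqr_ge0.
    by rewrite !expr2 in aN *; nra.
  have n0 : (0 : R) <= n%:R by [].
  have := ler_wpM2l n0 h; lra.
have dE (t : R) : is_derive t 1 (fun t => expR (- C * t)) (expR (- C * t) * - C).
  have d1 : is_derive t 1 (fun t : R => - C * t) (- C).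
    have := @is_deriveZ R R R id (- C) t 1 1 (is_derive_id _ _).
    by rewrite /GRing.scale /= mulr1.
  have := @is_derive1_comp R expR (fun t => - C * t) t _ _ (is_derive_expR _) d1.
  by move/is_derive_eq; apply; rewrite mulrC.
have dg t : 0 < t < T -> is_derive t 1 g
    ((dN t - C * nsq (y t)) * expR (- C * t) - n%:R * e ^+ 2).
  move=> tT.
  have d2 : is_derive t 1 (fun t : R => n%:R * e ^+ 2 * t) (n%:R * e ^+ 2).
    have := @is_deriveZ R R R id (n%:R * e ^+ 2) t 1 1 (is_derive_id _ _).
    by rewrite /GRing.scale /= mulr1.
  have := is_deriveB (is_deriveM (dn t tT) (dE t)) d2.
  by move/is_derive_eq; apply; rewrite /GRing.scale /=; ring.
have gle : g T <= g 0.
  apply: (@ler0_derive1_nincr _ g 0 T) => //.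
  - by move=> t; rewrite in_itv /= => /dg[].
  - move=> t; rewrite in_itv /= => tT; rewrite derive1E.
    have [_ ->] := dg t tT; have h := dNle t tT; have /andP[t0 _] := tT.
    have C0 : 0 <= C by rewrite /C addr_ge0 // !mulr_ge0.
    have E1 : expR (- C * t) <= 1.
      by rewrite -expR0 ler_expR mulNr oppr_le0 mulr_ge0 // ltW.
    have E0 : 0 <= expR (- C * t) := expR_ge0 _.
    have ne : 0 <= n%:R * e ^+ 2 by rewrite mulr_ge0 // sqr_ge0.
    have : (dN t - C * nsq (y t)) * expR (- C * t) <= n%:R * e ^+ 2 * expR (- C * t).
      by apply: ler_wpM2r => //; lra.
    have : n%:R * e ^+ 2 * expR (- C * t) <= n%:R * e ^+ 2 * 1 by apply: ler_wpM2l.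
    lra.
  - move/subspace_continuousP: cy => cy.
    have cyi t i : `[0, T]%classic t ->
        y s 0 i @[s --> within `[0, T] (nbhs t)] --> y t 0 i.
      move=> tT; apply: (cvg_comp y (fun N : 'rV[R]_n => N 0 i)) (cy t tT) _.
      exact: coord_continuous.
    apply/subspace_continuousP => t tT; apply: cvgB; first apply: cvgM.
    + have -> : (fun t => nsq (y t)) = \sum_i (fun t => y t 0 i * y t 0 i).
        by apply/funext => s; rewrite fct_sumE; apply: eq_bigr => i _; rewrite expr2.
      have -> : nsq (y t) = \sum_i (y t 0 i * y t 0 i).
        by apply: eq_bigr => i _; rewrite expr2.
      apply: (big_ind2 (fun (f : R -> R) l =>
          f s @[s --> within `[0, T] (nbhs t)] --> l)).
      * exact: cvg_cst.
      * by move=> f l h m; exact: cvgD.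
      * by move=> i _; apply: cvgM; exact: cyi.
    + apply: cvg_within_filter.
      have cE : {for t, continuous (fun t : R => expR (- C * t))}.
        by apply/differentiable_continuous/derivable1_diffP; have [] := dE t.
      exact: cE.
    + by apply: cvg_within_filter; apply: cvgM; [exact: cvg_cst|exact: cvg_id].
have : nsq (y T) * expR (- C * T) <= nsq (y 0) + n%:R * e ^+ 2 * T.
  move: gle; rewrite /g !mulr0 expR0; lra.
rewrite -ler_pdivlMr ?expR_gt0 // mulNr expRN invrK => h.
apply: le_trans (norm_le_nsq _) _; apply: le_trans h _.
have -> : gfactor n K T * (`|y 0| ^+ 2 + e ^+ 2 * T) =
    n%:R * (`|y 0| ^+ 2 + e ^+ 2 * T) * expR (C * T) by rewrite /gfactor mulrAC.
apply: ler_wpM2r; first exact: expR_ge0.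
by rewrite mulrDr [X in _ <= _ + X]mulrA lerD2r; exact: nsq_le_norm.
Qed.

Lemma gfactor_ge0 n (K T : R) : 0 <= gfactor n K T.
Proof. by rewrite mulr_ge0 // expR_ge0. Qed.

Lemma gfactor_le n (K s t : R) : 0 <= K -> s <= t -> gfactor n K s <= gfactor n K t.
Proof.
move=> K0 st; apply: ler_wpM2l => //; rewrite ler_expR; apply: ler_wpM2l => //.
by rewrite addr_ge0 // !mulr_ge0.
Qed.

(** The bound on [dy] is only assumed while |y| < b, as happens when a Lipschitz constant is valid
    in a tube only. As long as y has stayed below b, [gronwall] puts it below a value smaller than
    b, and continuity carries this further. *)
Lemma gronwall_escape n (y dy : R -> 'rV[R]_n) (T K e b : R) :
  0 <= T -> 0 <= K -> 0 <= e -> 0 < b ->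
  {within `[0, T], continuous y} ->
  (forall t, 0 < t < T -> is_derive t 1 y (dy t)) ->
  (forall t, 0 < t < T -> `|y t| < b -> `|dy t| <= K * `|y t| + e) ->
  gfactor n K T * (`|y 0| ^+ 2 + e ^+ 2 * T) < b ^+ 2 ->
  forall t, 0 <= t <= T ->
    `|y t| < b /\ `|y t| ^+ 2 <= gfactor n K T * (`|y 0| ^+ 2 + e ^+ 2 * T).
Proof.
move=> T0 K0 e0 b0 cy dY bY Hb.
have sub t : 0 <= t <= T -> (forall s, 0 <= s < t -> `|y s| < b) ->
    `|y t| ^+ 2 <= gfactor n K T * (`|y 0| ^+ 2 + e ^+ 2 * T).
  move=> /andP[t0 tT] Hs.
  apply: le_trans (@gronwall n y dy t K e t0 K0 e0 _ _ _) _.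
  - by apply: continuous_subspaceW cy; apply/subset_itvl; rewrite bnd_simp.
  - by move=> s /andP[s0 st]; apply: dY; rewrite s0 (lt_le_trans st).
  - move=> s /andP[s0 st]; apply: bY; first by rewrite s0 (lt_le_trans st).
    by apply: Hs; rewrite st ltW.
  apply: ler_pM; [exact: gfactor_ge0| |exact: gfactor_le|].
    by rewrite addr_ge0 ?mulr_ge0 ?sqr_ge0.
  by rewrite lerD2l; apply: ler_wpM2l => //; exact: sqr_ge0.
have lt t : 0 <= t <= T -> `|y t| < b.
  move: t; apply: (@real_induction (fun t => `|y t| < b)) => [t tT Hs|t tT yt].
    have := le_lt_trans (sub t tT Hs) Hb.
    by rewrite ltr_pXn2r ?nnegrE // ltW.
  have /andP[t0 tT'] := tT.
  have cn : (fun s => `|y s|) @ within `[0, T] (nbhs t) --> `|y t|.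
    apply: (cvg_comp y (fun x : 'rV[R]_n => `|x|)); last exact: norm_continuous.
    by move/subspace_continuousP : cy; apply; rewrite /= in_itv /= t0 ltW.
  have : \forall s \near within `[0, T] (nbhs t), `|y s| < b.
    exact: (cvgr_lt _ cn).
  rewrite /within /= => /nbhs_ballP[d /= d0 Hd]; exists d => // s /andP[ts std] sT.
  apply: Hd; last by rewrite /= in_itv /= sT (le_trans t0 (ltW ts)).
  rewrite /ball /= distrC gtr0_norm ?subr_gt0 //; lra.
move=> t tT; split; first exact: lt.
apply: sub => // s /andP[s0 st]; apply: lt; rewrite s0.
by have /andP[_ tT'] := tT; exact: le_trans (ltW st) tT'.
Qed.

Lemma is_derive_curve_comp (W : normedModType R) (y : R -> W) (s : R -> R)
    (t v : R) (w : W) :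
  is_derive t 1 s v -> is_derive (s t) 1 y w ->
  is_derive t 1 (fun t => y (s t)) (v *: w).
Proof.
move=> [ds <-] [dy <-].
have ds' : differentiable s t by apply/derivable1_diffP.
have dy' : differentiable y (s t) by apply/derivable1_diffP.
apply: DeriveDef; first by apply/derivable1_diffP; exact: (differentiable_comp ds').
rewrite -[fun t => y (s t)]/(y \o s) derive_comp //.
by rewrite (diff1E dy') derive1E.
Qed.

Lemma gronwall_sym n (y dy : R -> 'rV[R]_n) (T K e b : R) :
  0 <= T -> 0 <= K -> 0 <= e -> 0 < b ->
  (forall t : R, is_derive t 1 y (dy t)) ->
  (forall t : R, `|t| < T -> `|y t| < b -> `|dy t| <= K * `|y t| + e) ->
  gfactor n K T * (`|y 0| ^+ 2 + e ^+ 2 * T) < b ^+ 2 ->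
  forall t : R, `|t| <= T ->
    `|y t| < b /\ `|y t| ^+ 2 <= gfactor n K T * (`|y 0| ^+ 2 + e ^+ 2 * T).
Proof.
move=> T0 K0 e0 b0 dY bY Hb.
suff W : forall (y dy : R -> 'rV[R]_n), (forall t : R, is_derive t 1 y (dy t)) ->
    (forall t : R, `|t| < T -> `|y t| < b -> `|dy t| <= K * `|y t| + e) ->
    gfactor n K T * (`|y 0| ^+ 2 + e ^+ 2 * T) < b ^+ 2 ->
    forall t, 0 <= t <= T ->
    `|y t| < b /\ `|y t| ^+ 2 <= gfactor n K T * (`|y 0| ^+ 2 + e ^+ 2 * T).
  move=> t tT; have [t0|t0] := leP 0 t.
    by apply: (W y dy dY bY Hb); rewrite t0 -(ger0_norm t0).
  have := W (fun t => y (- t)) (fun t => - dy (- t)).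
  rewrite oppr0 => /(_ _ _ Hb (- t)); rewrite opprK; apply.
  - move=> s; rewrite -scaleN1r.
    have D : is_derive s 1 (fun t : R => - t) (- 1).
      exact: (is_deriveN (is_derive_id s 1)).
    exact: (is_derive_curve_comp D (dY (- s))).
  - by move=> s sT ys; rewrite normrN; apply: bY => //; rewrite normrN.
  by rewrite oppr_ge0 ltW //= -(ltr0_norm t0).
move=> {Hb bY dY dy}y dy dY bY Hb.
apply: gronwall_escape => //.
- apply: derivable_within_continuous => t _; by have [] := dY t.
- by move=> t /andP[t0 tT]; apply: bY; rewrite gtr0_norm.
Qed.

Lemma gronwall_all n (y dy : R -> 'rV[R]_n) (T K e : R) :
  0 <= T -> 0 <= K -> 0 <= e ->
  (forall t : R, is_derive t 1 y (dy t)) ->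
  (forall t : R, `|t| < T -> `|dy t| <= K * `|y t| + e) ->
  forall t : R, `|t| <= T ->
    `|y t| ^+ 2 <= gfactor n K T * (`|y 0| ^+ 2 + e ^+ 2 * T).
Proof.
move=> T0 K0 e0 dY bY t tT; set B := leRHS.
have B0 : 0 <= B.
  by rewrite mulr_ge0 ?gfactor_ge0 // addr_ge0 ?mulr_ge0 ?sqr_ge0.
(* Any barrier whose square exceeds [B] will do, and B < (B + 1)^2. *)
apply: (gronwall_sym (b := B + 1) T0 K0 e0 _ dY _ _ tT).2 => //.
- by rewrite ltr_wpDl.
- by move=> s sT _; exact: bY.
- rewrite -/B expr2; nra.
Qed.

End Gronwall.

(** * Smoothness of the flow of a complete field *)

Section Flow.
Context {R : realType}.

Lemma quad_is_diff (V W : normedModType R) (F : V -> W) (L : {linear V -> W})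
    x (rho C : R) :
  continuous L -> 0 < rho -> 0 <= C ->
  (forall v, `|v| < rho -> `|F (v + x) - F x - L v| <= C * `|v| ^+ 2) ->
  is_diff x F L.
Proof.
move=> cL rho0 C0 H.
have e : F \o shift x = cst (F x) + L +o_ 0 id.
  apply/eqaddoP => _/posnumP[e].
  have C1 : 0 < C + 1 by rewrite ltr_wpDl.
  near=> v.
  have vr : `|v| < rho by near: v; exact: nbhs0_lt.
  have ve : `|v| < e%:num / (C + 1).
    by near: v; apply: nbhs0_lt; rewrite divr_gt0.
  rewrite !fctE /= opprD addrA; apply: le_trans (H v vr) _.
  rewrite expr2 mulrA; apply: ler_wpM2r => //.
  move: ve; rewrite ltr_pdivlMr // => ve; apply: le_trans (ltW ve).
  rewrite mulrC; apply: ler_wpM2l => //; lra.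
have E := diff_unique cL e.
apply: DiffDef => //; apply/diff_locallyP; rewrite E; split => //; exact: cL.
Unshelve. all: by end_near. Qed.

Lemma curve_bounded n (x : R -> 'rV[R]_n) (T : R) : continuous x ->
  exists2 M, 0 < M & forall t, `|t| <= T -> `|x t| <= M.
Proof.
move=> cx.
have : compact (x @` `[- T, T]%classic).
  apply: continuous_compact; last exact: segment_compact.
  exact: continuous_subspaceT.
move=> /compact_bounded[M [Mr HM]]; exists (`|M| + 1); first by rewrite ltr_wpDl.
move=> t tT; apply: HM; last by exists t => //=; rewrite in_itv /= -ler_norml.
by rewrite (le_lt_trans (ler_norm M)) // ltrDl.
Qed.

Definition sol n (X : 'rV[R]_n -> 'rV[R]_n) (x : R -> 'rV[R]_n) :=
  forall t : R, is_derive t 1 x (X (x t)).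

Definition isflow n (X : 'rV[R]_n -> 'rV[R]_n) (phi : R -> 'rV[R]_n -> 'rV[R]_n) :=
  forall x, phi 0 x = x /\ sol X (phi^~ x).

Lemma is_derive_continuous (W : normedModType R) (x : R -> W) (t : R) v :
  is_derive t 1 x v -> {for t, continuous x}.
Proof. by move=> [d _]; apply/differentiable_continuous/derivable1_diffP. Qed.

Lemma sol_continuous n (X : 'rV[R]_n -> 'rV[R]_n) x : sol X x -> continuous x.
Proof. by move=> sx t; exact: is_derive_continuous (sx t). Qed.

Lemma sol_unique n (X : 'rV[R]_n -> 'rV[R]_n) x y : Ck 1 setT X ->
  sol X x -> sol X y -> x 0 = y 0 -> x = y.
Proof.
move=> CX sx sy xy0; apply/funext => t.
have [Mx Mx0 HMx] := curve_bounded `|t| (sol_continuous sx).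
have [My My0 HMy] := curve_bounded `|t| (sol_continuous sy).
have [K K0 HK] := @Ck_lip _ _ _ setT X 0 (Mx + My) CX (@subsetT _ _).
have := @gronwall_all R n (x \- y) (fun t => X (x t) - X (y t)) `|t| K 0
  (normr_ge0 t) (ltW K0) (lexx 0) _ _ t (lexx _).
rewrite /= xy0 subrr normr0 expr0n /= mul0r addr0 mulr0 => H.
apply/eqP; rewrite -subr_eq0 -normr_eq0 -sqrf_eq0 eq_le sqr_ge0 andbT; apply: H.
  by move=> s; exact: is_deriveB.
move=> s st; rewrite addr0; apply: HK; rewrite /cball /= subr0.
  by rewrite (le_trans (HMx _ (ltW st))) // lerDl ltW.
by rewrite (le_trans (HMy _ (ltW st))) // lerDr ltW.
Qed.

Lemma curve_mvt_sym n (z dz : R -> 'rV[R]_n) (t h M : R) : 0 <= M ->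
  (forall s : R, is_derive s 1 z (dz s)) ->
  (forall s, `|s - t| <= `|h| -> `|dz s| <= M) ->
  `|z (t + h) - z t| <= M * `|h|.
Proof.
move=> M0 dZ bZ; have cz : continuous z.
  by move=> s; exact: is_derive_continuous (dZ s).
have [h0|h0] := leP 0 h.
  rewrite (ger0_norm h0) -[X in _ * X](addrK t) [h + t]addrC.
  apply: (@curve_mvt _ _ z dz) => //; first by rewrite lerDl.
    move=> s; rewrite in_itv /= => /andP[s1 s2]; apply: bZ.
    rewrite (ger0_norm h0) gtr0_norm; lra.
  exact: continuous_subspaceT.
rewrite (ltr0_norm h0) distrC [X in _ * X](_ : _ = t - (t + h)); last by ring.
apply: (@curve_mvt _ _ z dz) => //; first by rewrite gerDl ltW.
  move=> s; rewrite in_itv /= => /andP[s1 s2]; apply: bZ.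
  rewrite (ltr0_norm h0) ltr0_norm; lra.
exact: continuous_subspaceT.
Qed.

(** The mean value inequality for u k s - s *: p t, whose derivative is small near t, compares the
    increment of u k with h *: p t; the increment of q then differs from that of u k by two
    approximation errors. *)
Lemma uniform_limit_derive n (u du : nat -> R -> 'rV[R]_n) (q p : R -> 'rV[R]_n)
    (t T : R) :
  `|t| < T -> (forall k (s : R), is_derive s 1 (u k) (du k s)) ->
  {for t, continuous p} ->
  (forall e, 0 < e -> exists k, forall s, `|s| < T ->
     `|u k s - q s| <= e /\ `|du k s - p s| <= e) ->
  is_derive t 1 q (p t).
Proof.
move=> tT dU cp H.
suff C : (fun h => h^-1 *: (q (h *: (1 : R) + t) - q t)) @ 0^' --> p t.
  apply: DeriveDef; first by apply/cvg_ex; exists (p t).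
  exact/cvg_lim.
apply/cvgrPdist_le => e e0.
have e4 : 0 < e / 4 by rewrite divr_gt0.
have /cvgrPdist_lt/(_ _ e4)/nbhs_ballP[d /= d0 Hd] := cp.
have T0 : 0 < T - `|t| by rewrite subr_gt0.
exists (Num.min d (T - `|t|)) => /=; first by rewrite lt_min d0.
move=> h; rewrite /= sub0r normrN lt_min => /andP[hd hT] h0.
have ah0 : 0 < `|h| by rewrite normr_gt0.
have -> : p t - h^-1 *: (q (h *: 1 + t) - q t) =
    h^-1 *: (h *: p t - (q (h + t) - q t)).
  by rewrite [in RHS]scalerBr scalerA mulVf // scale1r [h *: 1]mulr1.
rewrite normrZ normfV mulrC ler_pdivrMr //.
(* The approximation errors are going to be divided by h, so k is chosen after h, with precision
   proportional to |h|. *)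
have [|k Hk] := H (Num.min (e / 4) (e / 4 * `|h|)).
  by rewrite lt_min e4 mulr_gt0.
have inT s : `|s - t| <= `|h| -> `|s| < T.
  by move=> st; rewrite -(subrK t s) (le_lt_trans (ler_normD _ _)) //; lra.
have bd s : `|s - t| <= `|h| -> `|du k s - p t| <= e / 2.
  move=> st; have [_ h1] := Hk s (inT s st).
  have h2 : `|p t - p s| < e / 4.
    by apply: Hd; rewrite /ball /= distrC (le_lt_trans st).
  rewrite -(subrK (p s) (du k s)) -addrA (le_trans (ler_normD _ _)) //.
  rewrite distrC in h2.
  move: h1; rewrite le_min => /andP[h1 _]; lra.
have dz (s : R) : is_derive s 1 (fun s => u k s - s *: p t) (du k s - p t).
  apply: is_deriveB.
  have [d1 d2] := is_diff_scalel s (p t).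
  apply: DeriveDef; first exact: diff_derivable.
  by rewrite deriveE // d2 scale1r.
have e2 : 0 <= e / 2 by rewrite divr_ge0 // ltW.
have := @curve_mvt_sym _ (fun s => u k s - s *: p t) _ t h (e / 2) e2 dz bd.
have -> : u k (t + h) - (t + h) *: p t - (u k t - t *: p t) =
    (u k (t + h) - u k t) - h *: p t.
  by apply/rowP => i; rewrite !mxE; ring.
move=> h1.
have tt : `|t - t| <= `|h| by rewrite subrr normr0.
have th : `|t + h - t| <= `|h| by rewrite [t + h]addrC addrK.
have [h2 _] := Hk t (inT t tt); have [h3 _] := Hk (t + h) (inT (t + h) th).
move: h2 h3; rewrite !le_min => /andP[_ h2] /andP[_ h3].
have -> : h *: p t - (q (h + t) - q t) =
   (u k (t + h) - q (t + h)) - ((u k (t + h) - u k t) - h *: p t) - (u k t - q t).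
  by rewrite [h + t]addrC; apply/rowP => i; rewrite !mxE; ring.
apply: le_trans (ler_normB _ _) _.
apply: le_trans (lerD (ler_normB _ _) (lexx _)) _; lra.
Qed.

Lemma uniform_limit_continuous_at n (u : nat -> R -> 'rV[R]_n) (q : R -> 'rV[R]_n)
    (t T : R) :
  `|t| < T -> (forall k, continuous (u k)) ->
  (forall e, 0 < e -> exists k, forall s, `|s| < T -> `|u k s - q s| <= e) ->
  {for t, continuous q}.
Proof.
move=> tT cu H; apply/cvgrPdist_le => e e0.
have e3 : 0 < e / 3 by rewrite divr_gt0.
have [k Hk] := H _ e3.
have T0 : 0 < T - `|t| by rewrite subr_gt0.
near=> s.
have st : `|t - s| < T - `|t| by near: s; exact: (@nbhsx_ballx _ R t _ T0).
have uts : `|u k t - u k s| < e / 3.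
  near: s; have /cvgrPdist_lt := cu k t; exact.
have sT : `|s| < T.
  by rewrite -(subrKC t s) (le_lt_trans (ler_normD _ _)) // distrC; lra.
have h1 := Hk t tT; have h2 := Hk s sT.
have -> : q t - q s = (u k s - q s) + (u k t - u k s) - (u k t - q t).
  by apply/rowP => i; rewrite !mxE; ring.
apply: le_trans (ler_normB _ _) _.
apply: le_trans (lerD (ler_normD _ _) (lexx _)) _; lra.
Unshelve. all: by end_near. Qed.

(** * The variational equation along an orbit *)

Section Variation.
Variables (n : nat) (X : 'rV[R]_n -> 'rV[R]_n) (phi : R -> 'rV[R]_n -> 'rV[R]_n).
Hypotheses (sX : smooth_on setT X) (fX : isflow X phi).

Let CX k : Ck k setT X. Proof. exact: smoothCk. Qed.

Let phi0 x : phi 0 x = x. Proof. by have [] := fX x. Qed.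

Let dphi x (t : R) : is_derive t 1 (phi^~ x) (X (phi t x)).
Proof. by have [_] := fX x; apply. Qed.

Lemma flow_estimates x0 (T : R) : 0 <= T -> exists rho L K C : R,
  [/\ 0 < rho, 0 < L, 0 < K, 0 < C &
  forall t, `|t| <= T ->
    (forall w, `|'d X (phi t x0) w| <= K * `|w|) /\
    forall v, `|v| < rho ->
      `|phi t (v + x0) - phi t x0| <= L * `|v| /\
      `|X (phi t (v + x0)) - X (phi t x0) -
        'd X (phi t x0) (phi t (v + x0) - phi t x0)| <= C * `|v| ^+ 2].
Proof.
move=> T0.
have [M M0 HM] := curve_bounded T (sol_continuous (fX x0).2).
have sub : cball (0 : 'rV[R]_n) (M + 1) `<=` setT by [].
have [K1 K10 HK1] := Ck_lip (@CX 1) sub.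
have [K K0 HK] := diff_bound (@CX 1) sub.
have [C C0 HC] := Ck_taylor (@CX 2) sub.
pose gf := gfactor n K1 T.
have gf0 : 0 <= gf by exact: gfactor_ge0.
(* Gronwall bounds squares; gf <= (gf + 1)^2 lets the root be taken without radicals. *)
pose L := gf + 1; have L0 : 0 < L by rewrite ltr_wpDl.
have inM t : `|t| <= T -> cball 0 (M + 1) (phi t x0).
  by move=> tT; rewrite /cball /= subr0 (le_trans (HM t tT)) // lerDl.
(* Below the radius [L^-1] the perturbed orbit stays within distance 1 of the reference orbit, hence
   in the ball of radius [M + 1] on which all constants were taken. *)
exists L^-1, L, K, (C * L ^+ 2); split=> //.
- by rewrite invr_gt0.
- by rewrite mulr_gt0 // exprn_gt0.
move=> t tT; split=> [w|v vL]; first exact: HK (inM t tT).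
have vL1 : L * `|v| < 1 by rewrite mulrC -ltr_pdivlMr // mul1r.
have inM' s : `|s| <= T -> `|phi s (v + x0) - phi s x0| < 1 ->
    cball 0 (M + 1) (phi s (v + x0)).
  move=> sT s1; rewrite /cball /= subr0 -(subrK (phi s x0) (phi s (v + x0))).
  by rewrite (le_trans (ler_normD _ _)) // addrC lerD ?HM // ltW.
have G := @gronwall_sym R n (fun s => phi s (v + x0) - phi s x0)
  (fun s => X (phi s (v + x0)) - X (phi s x0)) T K1 0 1 T0 (ltW K10) (lexx 0) ltr01.
rewrite !phi0 addrK expr0n /= mul0r addr0 -/gf in G.
have gv : gf * `|v| ^+ 2 <= (L * `|v|) ^+ 2.
  rewrite exprMn; apply: ler_wpM2r; first exact: sqr_ge0.
  rewrite /L expr2; nra.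
have [|||s1 s2] := G _ _ _ t tT.
- by move=> s; exact: is_deriveB.
- move=> s sT s1; rewrite addr0; apply: HK1; first exact: inM' (ltW sT) s1.
  exact: inM (ltW sT).
- apply: le_lt_trans gv _; rewrite expr1n; apply: exprn_ilt1 => //.
  by rewrite mulr_ge0 // ltW.
have s3 : `|phi t (v + x0) - phi t x0| <= L * `|v|.
  rewrite -(@ler_pXn2r _ 2) ?nnegrE //; last by rewrite mulr_ge0 // ltW.
  exact: le_trans s2 gv.
split=> //; apply: le_trans (HC _ _ (inM' _ tT s1) (inM _ tT)) _.
rewrite -mulrA -exprMn; apply: ler_wpM2l; first exact: ltW.
by rewrite ler_pXn2r ?nnegrE // mulr_ge0 // ltW.
Qed.

(** Extracts a linear bound from a bound on squares, by c <= (c + 1)^2 for c >= 0. *)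
Lemma sqr_gf_le n' (K T e a : R) : 0 <= T -> 0 <= e -> 0 <= a ->
  a ^+ 2 <= gfactor n' K T * (0 ^+ 2 + e ^+ 2 * T) ->
  a <= (gfactor n' K T * T + 1) * e.
Proof.
move=> T0 e0 a0; rewrite expr0n /= add0r => H.
have g0 := gfactor_ge0 n' K T.
rewrite -(@ler_pXn2r _ 2) ?nnegrE //; last by rewrite mulr_ge0 ?addr_ge0 ?mulr_ge0.
apply: le_trans H _; rewrite mulrCA mulrC exprMn; apply: ler_wpM2r.
  exact: sqr_ge0.
have : 0 <= gfactor n' K T * T by rewrite mulr_ge0.
rewrite expr2; nra.
Qed.

Let quot x0 v (h t : R) := h^-1 *: (phi t (h *: v + x0) - phi t x0).
Let dquot x0 v (h t : R) := h^-1 *: (X (phi t (h *: v + x0)) - X (phi t x0)).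

(** A difference quotient of the flow with step h starts at v and satisfies the variational equation
    up to an error of order h. Two of them therefore differ by a solution of an almost linear
    equation that starts at 0, and Gronwall bounds it by the two steps. *)
Lemma quot_cauchy x0 v (T : R) : 0 <= T -> exists h0 C : R,
  [/\ 0 < h0, 0 <= C &
  forall h t, 0 < h < h0 -> `|t| <= T ->
    `|dquot x0 v h t - 'd X (phi t x0) (quot x0 v h t)| <= C * h /\
    forall k, 0 < k < h0 -> `|quot x0 v h t - quot x0 v k t| <= C * (h + k)].
Proof.
move=> T0; have [rho [L [K [C [rho0 L0 K0 C0 H]]]]] := flow_estimates x0 T0.
pose c := C * `|v| ^+ 2; have c0 : 0 <= c by rewrite mulr_ge0 ?sqr_ge0 // ltW.
pose C2 := gfactor n K T * T + 1.
have C20 : 1 <= C2 by rewrite /C2 lerDr mulr_ge0 ?gfactor_ge0.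
have v1 : 0 < `|v| + 1 by rewrite ltr_wpDl.
have hv h : 0 < h < rho / (`|v| + 1) -> `|h *: v| < rho.
  move=> /andP[h0]; rewrite ltr_pdivlMr // => h1; rewrite normrZ gtr0_norm //.
  by apply: le_lt_trans h1; apply: ler_wpM2l; [exact: ltW|rewrite lerDl].
have A h t : 0 < h < rho / (`|v| + 1) -> `|t| <= T ->
    `|dquot x0 v h t - 'd X (phi t x0) (quot x0 v h t)| <= c * h.
  move=> hh tT; have [_ /(_ _ (hv h hh))[_ H2]] := H t tT.
  have /andP[h0 _] := hh.
  rewrite /dquot /quot linearZ -scalerBr normrZ gtr0_norm ?invr_gt0 //.
  rewrite mulrC ler_pdivrMr //; apply: le_trans H2 _.
  by rewrite normrZ gtr0_norm // exprMn /c expr2; nra.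
exists (rho / (`|v| + 1)), (C2 * c); split=> //.
- by rewrite divr_gt0.
- by rewrite mulr_ge0 // (le_trans ler01).
move=> h t hh tT; have /andP[h0 _] := hh; split=> [|k kk].
  apply: le_trans (A h t hh tT) _; apply: ler_wpM2r; first exact: ltW.
  by rewrite ler_peMl.
have /andP[k0 _] := kk.
have hk0 : 0 <= c * (h + k) by rewrite mulr_ge0 // addr_ge0 // ltW.
rewrite -mulrA; apply: sqr_gf_le => //.
have := @gronwall_all R n (fun t => quot x0 v h t - quot x0 v k t)
  (fun t => dquot x0 v h t - dquot x0 v k t) T K (c * (h + k)) T0 (ltW K0) hk0 _ _ t tT.
have q0 a : 0 < a -> quot x0 v a 0 = v.
  by move=> a0; rewrite /quot !phi0 addrK scalerA mulVf ?gt_eqF // scale1r.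
rewrite (q0 h) // (q0 k) // subrr normr0.
apply.
  move=> s; apply: is_deriveB; apply: is_deriveZ; exact: is_deriveB.
move=> s sT; have [H1 _] := H s (ltW sT).
have Ah := A h s hh (ltW sT); have Ak := A k s kk (ltW sT).
have -> : dquot x0 v h s - dquot x0 v k s =
    'd X (phi s x0) (quot x0 v h s - quot x0 v k s) +
    ((dquot x0 v h s - 'd X (phi s x0) (quot x0 v h s)) -
     (dquot x0 v k s - 'd X (phi s x0) (quot x0 v k s))).
  rewrite linearB; apply/rowP => i; rewrite !mxE; ring.
apply: le_trans (ler_normD _ _) _; apply: lerD; first exact: H1.
by apply: le_trans (ler_normB _ _) _; rewrite mulrDr; exact: lerD.
Qed.

(** The solution is the limit of the difference quotients of the flow with steps 1 / (k + 1): they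
    converge uniformly on bounded intervals, as do their derivatives, so the limit satisfies the
    equation. *)
Lemma variation_exists x0 v : exists q : R -> 'rV[R]_n,
  q 0 = v /\ forall t : R, is_derive t 1 q ('d X (phi t x0) (q t)).
Proof.
pose u k t := quot x0 v k.+1%:R^-1 t.
pose du k t := dquot x0 v k.+1%:R^-1 t.
have hk0 k : (0 : R) < k.+1%:R^-1 by rewrite invr_gt0.
have small (e : R) : 0 < e -> exists N, forall k, (N <= k)%N -> k.+1%:R^-1 < e.
  move=> e0; have [N _ HN] := near_infty_natSinv_lt (PosNum e0).
  by exists N => k Nk; exact: HN.
have key (T e : R) : 0 <= T -> 0 < e -> exists N, forall k, (N <= k)%N ->
    forall t, `|t| <= T -> `|du k t - 'd X (phi t x0) (u k t)| <= e /\
    forall l, (N <= l)%N -> `|u k t - u l t| <= e.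
  move=> T0 e0; have [h0 [C [h00 C0 H]]] := quot_cauchy x0 v T0.
  have C1 : 0 < 2 * (C + 1) by rewrite mulr_gt0 // ltr_wpDl.
  have [|N HN] := small (Num.min h0 (e / (2 * (C + 1)))).
    by rewrite lt_min h00 divr_gt0.
  have HN' k : (N <= k)%N ->
      0 < (k.+1%:R^-1 : R) < h0 /\ C * k.+1%:R^-1 <= e / 2.
    move=> /HN; rewrite lt_min => /andP[kh hk].
    split; first by apply/andP; split; [exact: hk0|exact: kh].
    apply: (@le_trans _ _ ((C + 1) * (e / (2 * (C + 1))))).
      by apply: ler_pM => //; [rewrite lerDl|exact: ltW].
    have C2 : C + 1 != 0 by rewrite gt_eqF // ltr_wpDl.
    by rewrite invfM mulrC mulrA mulfVK.
  exists N => k /HN'[hk Ck] t tT; have [H1 H2] := H _ t hk tT; split.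
    by apply: le_trans H1 (le_trans Ck _); lra.
  move=> l /HN'[hl Cl]; apply: le_trans (H2 _ hl) _.
  by rewrite mulrDr [leRHS](splitr e) lerD.
have cu t : cvgn (u ^~ t).
  apply/cauchy_cvgP; apply: cauchy_exP => e e0.
  have e2 : 0 < e / 2 by rewrite divr_gt0.
  have [N HN] := key `|t| (e / 2) (normr_ge0 t) e2.
  exists (u N t); exists N => // l Nl; rewrite -ball_normE /=.
  have [_ /(_ l Nl) h] := HN N (leqnn N) t (lexx _).
  apply: le_lt_trans h _; lra.
pose q t := limn (u ^~ t).
have uq (T e : R) : 0 <= T -> 0 < e -> exists N, forall k, (N <= k)%N ->
    forall t, `|t| <= T -> `|du k t - 'd X (phi t x0) (u k t)| <= e /\
    `|u k t - q t| <= 2 * e.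
  move=> T0 e0; have [N HN] := key T e T0 e0; exists N => k Nk t tT.
  have [H1 H2] := HN k Nk t tT; split=> //.
  have /cvgrPdist_lt/(_ _ e0)[M _ HM] : u ^~ t @ \oo --> q t by exact: cu.
  have h := HM (maxn M N) (leq_maxl _ _).
  rewrite -(subrK (u (maxn M N) t) (u k t)) -addrA (le_trans (ler_normD _ _)) //.
  have h2 := H2 _ (leq_maxr M N); rewrite distrC in h; lra.
have dU k (s : R) : is_derive s 1 (u k) (du k s).
  by apply: is_deriveZ; exact: is_deriveB.
exists q; split.
  rewrite /q (_ : u^~ 0 = fun=> v); first exact: lim_cst.
  by apply/funext => k; rewrite /u /quot !phi0 addrK scalerA mulVf ?scale1r ?gt_eqF.
move=> t; pose T := `|t| + 1.
have T0 : 0 <= T by rewrite addr_ge0.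
have tT : `|t| < T by rewrite ltrDl.
have [rho [L [K [C [rho0 L0 K0 C0 H]]]]] := flow_estimates x0 T0.
have cq : {for t, continuous q}.
  apply: (@uniform_limit_continuous_at _ u q t T) => //.
    by move=> k s; exact: is_derive_continuous (dU k s).
  move=> e e0; have e2 : 0 < e / 2 by rewrite divr_gt0.
  have [N HN] := uq T (e / 2) T0 e2; exists N => s sT.
  have [_] := HN N (leqnn N) s (ltW sT); lra.
apply: (@uniform_limit_derive _ u du q (fun t => 'd X (phi t x0) (q t)) t T) => //.
  have -> : (fun t => 'd X (phi t x0) (q t)) =
      \sum_i (fun t => q t 0 i *: 'D_(delta_mx 0 i) X (phi t x0)).
    apply/funext => s; rewrite fct_sumE; apply: diff_sum_coord.
    exact: (CkS_diff (@CX 0)).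
  apply: (big_ind (fun f : R -> 'rV[R]_n => {for t, continuous f})).
  - exact: cst_continuous.
  - by move=> f g; exact: continuousD.
  move=> i _; apply: cvgZ.
    apply: (cvg_comp q (fun N : 'rV[R]_n => N 0 i)) cq _; exact: coord_continuous.
  apply: (cvg_comp (phi^~ x0) ('D_(delta_mx 0 i) X)).
    exact: (is_derive_continuous (dphi x0 t)).
  have cD : {for phi t x0, continuous ('D_(delta_mx 0 i) X)}.
    apply: differentiable_continuous.
    exact: (CkS_diff (CkD (delta_mx 0 i) (@CX 1))).
  exact: cD.
(* The quotient is within 2 e' of q, and its derivative within e' + 2 K e' of the right-hand side at
   q; both are at most e. *)
move=> e e0; pose e' := e / (2 * (K + 1)).
have K1 : 0 < 2 * (K + 1) by rewrite mulr_gt0 // ltr_wpDl // ltW.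
have e'0 : 0 < e' by rewrite divr_gt0.
have eE : e = e' * (2 * (K + 1)) by rewrite /e' divfK // gt_eqF.
have [N HN] := uq T e' T0 e'0; exists N => s sT.
have [H1 H2] := HN N (leqnn N) s (ltW sT); have [HK _] := H s (ltW sT); split.
  by apply: le_trans H2 _; rewrite eE; nra.
rewrite -(subrK ('d X (phi s x0) (u N s)) (du N s)) -addrA -linearB.
apply: le_trans (ler_normD _ _) _; apply: le_trans (lerD H1 (HK _)) _.
have := ler_wpM2l (ltW K0) H2; rewrite eE; nra.
Qed.

End Variation.

(** The complete lift of [X] to the tangent bundle: its integral curves are the orbits of [X] paired
    with solutions of the variational equation along them. *)
Definition tlift n (X : 'rV[R]_n -> 'rV[R]_n) (z : 'rV[R]_(n + n)) :=
  row_mx (X (lsubmx z)) ('d X (lsubmx z) (rsubmx z)).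

Lemma tlift_smooth n (X : 'rV[R]_n -> 'rV[R]_n) :
  smooth_on setT X -> smooth_on setT (tlift X).
Proof.
move=> sX; apply/smooth_onP => k; have oT := @openT 'rV[R]_(n + n).
have Cl : Ck k setT (@lsubmx R 1 n n) by apply: Ck_lsubmx oT _; exact: Ck_id.
have Cr : Ck k setT (@rsubmx R 1 n n) by apply: Ck_rsubmx oT _; exact: Ck_id.
apply: Ck_row_mx => //.
  by apply: (Ck_comp (U' := setT)) => //; exact: smoothCk.
by apply: (Ck_dir (U' := setT)) => //; exact: smoothCk.
Qed.

Lemma is_derive_row_mx p q (x : R -> 'rV[R]_p) (y : R -> 'rV[R]_q) (t : R) v w :
  is_derive t 1 x v -> is_derive t 1 y w ->
  is_derive t 1 (fun s => row_mx (x s) (y s)) (row_mx v w).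
Proof.
move=> dx dy; apply: is_deriveP_coord => j; rewrite -(fintype.splitK j).
case: (fintype.split j) => k /=.
  rewrite row_mxEl (_ : (fun s => _) = fun s => x s 0 k); last first.
    by apply/funext => s; rewrite row_mxEl.
  exact: is_derive_coord.
rewrite row_mxEr (_ : (fun s => _) = fun s => y s 0 k); last first.
  by apply/funext => s; rewrite row_mxEr.
exact: is_derive_coord.
Qed.

Lemma is_derive_lin p (W : normedModType R) (L : {linear 'rV[R]_p -> W})
    (x : R -> 'rV[R]_p) (t : R) v :
  is_derive t 1 x v -> is_derive t 1 (fun s => L (x s)) (L v).
Proof.
move=> [dx <-]; have cL : continuous L by exact: rV_linear_continuous.
have dL : differentiable L (x t) by exact: linear_differentiable.
have dx' : differentiable x t by apply/derivable1_diffP.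
apply: DeriveDef; first by apply/derivable1_diffP; exact: (differentiable_comp dx').
by rewrite -[fun s => L (x s)]/(L \o x) derive_comp // (diff_lin _ cL).
Qed.

Lemma flow_unique n (X : 'rV[R]_n -> 'rV[R]_n) phi psi : smooth_on setT X ->
  isflow X phi -> isflow X psi -> phi = psi.
Proof.
move=> sX fp fq; apply/funext => t; apply/funext => x.
have [p0 sp] := fp x; have [q0 sq] := fq x.
have := sol_unique (smoothCk (k := 1) sX) sp sq; rewrite p0 q0 => /(_ erefl).
by move/(congr1 (@^~ t)).
Qed.

Lemma sol_flow n (X : 'rV[R]_n -> 'rV[R]_n) phi x : smooth_on setT X ->
  isflow X phi -> sol X x -> x = phi^~ (x 0).
Proof.
move=> sX fp sx; have [p0 sp] := fp (x 0).
exact: (sol_unique (smoothCk (k := 1) sX) sx sp).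
Qed.

Lemma tlift_flow n (X : 'rV[R]_n -> 'rV[R]_n) phi : smooth_on setT X ->
  isflow X phi -> exists Q : 'rV[R]_n -> 'rV[R]_n -> R -> 'rV[R]_n,
    isflow (tlift X)
      (fun t z => row_mx (phi t (lsubmx z)) (Q (lsubmx z) (rsubmx z) t)).
Proof.
move=> sX fX.
have /choice[Q HQ] : forall xv : 'rV[R]_n * 'rV[R]_n, exists q : R -> 'rV[R]_n,
    q 0 = xv.2 /\ forall t : R, is_derive t 1 q ('d X (phi t xv.1) (q t)).
  by move=> [x v]; exact: variation_exists.
exists (fun x v => Q (x, v)) => z; split.
  by rewrite (HQ (_, _)).1 (fX _).1 hsubmxK.
move=> t; rewrite /tlift row_mxKl row_mxKr; apply: is_derive_row_mx.
  exact: (fX _).2.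
exact: (HQ (_, _)).2.
Qed.

(** The candidate derivative is linear in v by uniqueness for the lifted field. What remains of phi
    t (v + x) - phi t x after subtracting it starts at 0 and satisfies the variational equation up
    to an error of order |v|^2. *)
Lemma flow_is_diff n (X : 'rV[R]_n -> 'rV[R]_n) phi Phi t x : smooth_on setT X ->
  isflow X phi -> isflow (tlift X) Phi ->
  is_diff x (phi t) (fun v => rsubmx (Phi t (row_mx x v))).
Proof.
move=> sX fX fT; have [Q fQ] := tlift_flow sX fX.
have sT := tlift_smooth sX.
have -> : (fun v => rsubmx (Phi t (row_mx x v))) = fun v => Q x v t.
  by apply/funext => v; rewrite (flow_unique sT fT fQ) row_mxKl !row_mxKr.
have Q0 v : Q x v 0 = v.
  by have [] := fQ (row_mx x v); rewrite row_mxKl row_mxKr => /eq_row_mx[].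
have dQ v (s : R) : is_derive s 1 (Q x v) ('d X (phi s x) (Q x v s)).
  have [_ /(_ s)] := fQ (row_mx x v); rewrite /tlift !row_mxKl !row_mxKr.
  move=> /(is_derive_lin (@rsubmx R 1 n n)) /=; rewrite row_mxKr.
  by congr (is_derive _ _ _ _); apply/funext => s'; rewrite row_mxKr.
have lQ : linear (fun v => Q x v t).
  move=> a v w.
  have s1 : sol (tlift X) (fun s => row_mx (phi s x) (Q x (a *: v + w) s)).
    have [_ +] := fQ (row_mx x (a *: v + w)); rewrite row_mxKl row_mxKr; exact.
  have s2 : sol (tlift X) (fun s => row_mx (phi s x) (a *: Q x v s + Q x w s)).
    move=> s; rewrite /tlift row_mxKl row_mxKr.
    apply: is_derive_row_mx; first exact: (fX x).2.
    have -> : 'd X (phi s x) (a *: Q x v s + Q x w s) =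
      a *: 'd X (phi s x) (Q x v s) + 'd X (phi s x) (Q x w s) by rewrite linearP.
    exact: (is_deriveD (is_deriveZ a (dQ v s)) (dQ w s)).
  have := sol_unique (smoothCk (k := 1) sT) s1 s2; rewrite !Q0 => /(_ erefl).
  by move=> /(congr1 (@^~ t)) /= /eq_row_mx[].
pose LM := GRing.isLinear.Build _ _ _ _ _ lQ.
pose L : {linear _ -> _} := HB.pack (fun v => Q x v t) LM.
have [rho [L1 [K [C [rho0 L0 K0 C0 H]]]]] := flow_estimates sX fX x (normr_ge0 t).
have C2 : 0 <= gfactor n K `|t| * `|t| + 1.
  by rewrite addr_ge0 // mulr_ge0 ?gfactor_ge0.
apply: (@quad_is_diff _ _ _ L x rho ((gfactor n K `|t| * `|t| + 1) * C)) => //.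
- exact: rV_linear_continuous.
- by rewrite mulr_ge0 // ltW.
move=> v vrho; rewrite -mulrA.
have e0 : 0 <= C * `|v| ^+ 2 by rewrite mulr_ge0 ?sqr_ge0 // ltW.
apply: sqr_gf_le => //.
have := @gronwall_all R n (fun s => phi s (v + x) - phi s x - Q x v s)
  (fun s => X (phi s (v + x)) - X (phi s x) - 'd X (phi s x) (Q x v s))
  `|t| K (C * `|v| ^+ 2) (normr_ge0 t) (ltW K0) e0 _ _ t (lexx _).
rewrite !(fX _).1 addrK Q0 subrr normr0; apply.
  by move=> s; apply: is_deriveB; apply: is_deriveB; exact: (fX _).2.
move=> s st; have [H1 /(_ v vrho)[H2 H3]] := H s (ltW st).
have -> : X (phi s (v + x)) - X (phi s x) - 'd X (phi s x) (Q x v s) =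
   'd X (phi s x) (phi s (v + x) - phi s x - Q x v s) +
   (X (phi s (v + x)) - X (phi s x) - 'd X (phi s x) (phi s (v + x) - phi s x)).
  rewrite [in RHS]linearB; apply/rowP => i; rewrite !mxE; ring.
by apply: le_trans (ler_normD _ _) _; exact: lerD.
Qed.

(** The induction is over all fields and dimensions at once: a directional derivative of the flow of
    [X] is a component of the flow of [tlift X], to which the induction hypothesis applies. *)
Lemma flow_Ck k n (X : 'rV[R]_n -> 'rV[R]_n) phi t : smooth_on setT X ->
  isflow X phi -> Ck k setT (phi t).
Proof.
elim: k n X phi => [|k IH] n X phi sX fX; have [Q fT] := tlift_flow sX fX;
    have D x := flow_is_diff t x sX fX fT.
  by apply: Ck0P => x _; have [] := D x.
apply/CkSP; split=> [x _|v]; first by have [] := D x.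
have CT := IH _ _ _ (tlift_smooth sX) fT.
have oT := @openT 'rV[R]_n.
pose Phi z := row_mx (phi t (lsubmx z)) (Q (lsubmx z) (rsubmx z) t).
apply: (eq_Ck (G := fun x => rsubmx (Phi (row_mx x v)))) => //.
  by move=> x _; have [d dE] := D x; rewrite deriveE // dE.
apply: Ck_rsubmx => //; apply: (Ck_comp (U' := setT)) => //.
by apply: Ck_row_mx => //; [exact: Ck_id|exact: Ck_cst].
Qed.

Lemma flow_smooth n (X : 'rV[R]_n -> 'rV[R]_n) phi t : smooth_on setT X ->
  isflow X phi -> smooth_on setT (phi t).
Proof. by move=> sX fX; apply/smooth_onP => k; exact: flow_Ck fX. Qed.

End Flow.

(** * Commuting flows *)

Section Action.
Context {R : realType}.

Lemma has_deriv_withinP (V : normedModType R) (J : set R) (x : R -> V) (t : R) v :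
  has_deriv_within J x t v <->
  forall e, 0 < e -> exists2 d, 0 < d & forall s, `|s - t| < d -> J s ->
    `|x s - x t - (s - t) *: v| <= e * `|s - t|.
Proof.
have E (s : R) : s != t -> x s - x t - (s - t) *: v =
    (s - t) *: ((s - t)^-1 *: (x s - x t) - v).
  by move=> st; rewrite [RHS]scalerBr scalerA mulfV ?scale1r // subr_eq0.
split=> [/cvgrPdist_le H e e0|H].
  have /nbhs_ballP[d /= d0 Hd] := H e e0; exists d => // s st Js.
  have [->|nst] := eqVneq s t; first by rewrite !subrr scale0r subrr !normr0 mulr0.
  rewrite E // normrZ mulrC; apply: ler_wpM2r => //; rewrite distrC.
  by apply: Hd => //; rewrite /ball /= distrC.
apply/cvgrPdist_le => e e0; have [d d0 Hd] := H e e0.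
apply/nbhs_ballP; exists d => //= s; rewrite /ball /= distrC => st nst Js.
have := Hd s st Js; rewrite E // normrZ mulrC distrC.
by rewrite ler_pM2r // normr_gt0 subr_eq0.
Qed.

Lemma is_deriveP (V : normedModType R) (x : R -> V) (t : R) v :
  is_derive t 1 x v <->
  forall e, 0 < e -> exists2 d, 0 < d & forall s, `|s - t| < d ->
    `|x s - x t - (s - t) *: v| <= e * `|s - t|.
Proof.
have E (h : R) : h != 0 -> x (h + t) - x t - h *: v =
    h *: (h^-1 *: (x (h *: 1 + t) - x t) - v).
  move=> h0; rewrite [RHS]scalerBr scalerA mulfV ?scale1r //.
  by rewrite [h *: 1]mulr1.
split=> [[dx xv] e e0|H].
  have : (fun h => h^-1 *: (x (h *: 1 + t) - x t)) @ 0^' --> v.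
    by rewrite -xv; exact: dx.
  move=> /cvgrPdist_le/(_ _ e0)/nbhs_ballP[d /= d0 Hd]; exists d => // s st.
  have [->|nst] := eqVneq s t; first by rewrite !subrr scale0r subrr !normr0 mulr0.
  have st0 : s - t != 0 by rewrite subr_eq0.
  rewrite -{1}(subrK t s) E // normrZ mulrC; apply: ler_wpM2r => //.
  by rewrite distrC; apply: Hd => //; rewrite /ball /= sub0r normrN.
have C : (fun h => h^-1 *: (x (h *: 1 + t) - x t)) @ 0^' --> v.
  apply/cvgrPdist_le => e e0; have [d d0 Hd] := H e e0.
  apply/nbhs_ballP; exists d => //= h; rewrite /ball /= sub0r normrN => hd h0.
  have := Hd (h + t); rewrite addrK => /(_ hd); rewrite E // normrZ mulrC distrC.
  by rewrite ler_pM2r // normr_gt0.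
by apply: DeriveDef; [apply/cvg_ex; exists v|exact/cvg_lim].
Qed.

Lemma has_deriv_within_is_derive (V : normedModType R) (J : set R) (x : R -> V)
    (t : R) v :
  nbhs t J -> has_deriv_within J x t v -> is_derive t 1 x v.
Proof.
move=> /nbhs_ballP[d1 /= d10 HJ] /has_deriv_withinP H; apply/is_deriveP => e e0.
have [d d0 Hd] := H e e0; exists (Num.min d d1); first by rewrite lt_min d0.
move=> s; rewrite lt_min => /andP[sd sd1]; apply: Hd => //.
by apply: HJ; rewrite /ball /= distrC.
Qed.

Lemma complete_flow n (X : 'rV[R]_n -> 'rV[R]_n) : complete_field X ->
  exists phi, isflow X phi.
Proof.
move=> /choice[x Hx]; exists (fun t x0 => x x0 t) => x0; have [x00 sx] := Hx x0.
split=> // t; apply: (has_deriv_within_is_derive filterT); exact: sx.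
Qed.

Lemma is_derive_diff_comp p (W : normedModType R) (F : 'rV[R]_p -> W)
    (x : R -> 'rV[R]_p) (t : R) v :
  differentiable F (x t) -> is_derive t 1 x v ->
  is_derive t 1 (fun s => F (x s)) ('d F (x t) v).
Proof.
move=> dF [dx <-].
have dx' : differentiable x t by apply/derivable1_diffP.
apply: DeriveDef; first by apply/derivable1_diffP; exact: (differentiable_comp dx').
by rewrite -[fun s => F (x s)]/(F \o x) derive_comp.
Qed.

Lemma is_derive_unique (V : normedModType R) (x : R -> V) (t : R) v w :
  is_derive t 1 x v -> is_derive t 1 x w -> v = w.
Proof. by move=> [_ <-] [_ <-]. Qed.

Lemma flow_scale n (X : 'rV[R]_n -> 'rV[R]_n) phi (c : R) : isflow X phi ->
  isflow (fun x => c *: X x) (fun t => phi (t * c)).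
Proof.
move=> fX x; split=> [|t]; first by rewrite mul0r (fX x).1.
have D : is_derive t 1 (fun s : R => s * c) c.
  rewrite (_ : (fun s => _) = *%R c); last by apply/funext => s; rewrite mulrC.
  have := @is_deriveZ R R R id c t 1 1 (is_derive_id _ _).
  by rewrite /GRing.scale /= mulr1.
exact: (is_derive_curve_comp D ((fX x).2 (t * c))).
Qed.

(** The parameter becomes a state variable with zero velocity, so smoothness in the parameter is
    smoothness in the initial state. *)
Lemma param_flow_smooth p n (Z : 'rV[R]_p -> 'rV[R]_n -> 'rV[R]_n)
    (phi : 'rV[R]_p -> R -> 'rV[R]_n -> 'rV[R]_n) :
  smooth_on setT (fun z : 'rV[R]_(p + n) => Z (lsubmx z) (rsubmx z)) ->
  (forall s, isflow (Z s) (phi s)) ->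
  smooth_on setT (fun z : 'rV[R]_(p + n) => phi (lsubmx z) 1 (rsubmx z)).
Proof.
move=> sZ fZ; have oT := @openT 'rV[R]_(p + n).
pose X (z : 'rV[R]_(p + n)) := row_mx (0 : 'rV[R]_p) (Z (lsubmx z) (rsubmx z)).
have sX : smooth_on setT X.
  apply/smooth_onP => k; apply: Ck_row_mx => //; first exact: Ck_cst.
  exact: smoothCk.
pose Phi (t : R) (z : 'rV[R]_(p + n)) := row_mx (lsubmx z) (phi (lsubmx z) t (rsubmx z)).
have fX : isflow X Phi.
  move=> z; split=> [|t]; first by rewrite /Phi (fZ _ _).1 hsubmxK.
  rewrite /X row_mxKl row_mxKr; apply: is_derive_row_mx; exact: (fZ _ _).2.
apply/smooth_onP => k.
rewrite (_ : (fun z => _) = fun z => rsubmx (Phi 1 z)); last first.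
  by apply/funext => z; rewrite row_mxKr.
apply: (Ck_rsubmx (F := Phi 1)) => //; apply: smoothCk.
exact: (flow_smooth 1 sX fX).
Qed.

Definition commuting n (X Y : 'rV[R]_n -> 'rV[R]_n) :=
  forall x, 'd Y x (X x) = 'd X x (Y x).

Lemma smooth_diff (V W : normedModType R) (F : V -> W) x :
  smooth_on setT F -> differentiable F x.
Proof. by move=> sF; exact: (sF [::]). Qed.

(* Y o phi_t, like d(phi_t) Y, solves the variational equation of X along the orbit. *)
Lemma flow_commuting n (X Y : 'rV[R]_n -> 'rV[R]_n) phi t x :
  smooth_on setT X -> smooth_on setT Y -> isflow X phi -> commuting X Y ->
  'd (phi t) x (Y x) = Y (phi t x).
Proof.
move=> sX sY fX cXY; have [Q fT] := tlift_flow sX fX.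
have [_ dE] := flow_is_diff t x sX fX fT; rewrite dE row_mxKr row_mxKl row_mxKr.
have s1 : sol (tlift X) (fun t => row_mx (phi t x) (Y (phi t x))).
  move=> s; rewrite /tlift row_mxKl row_mxKr; apply: is_derive_row_mx.
    exact: (fX x).2.
  rewrite -cXY; apply: is_derive_diff_comp; last exact: (fX x).2.
  exact: smooth_diff.
have := sol_flow (tlift_smooth sX) fT s1.
rewrite (fX x).1 => /(congr1 (@^~ t)) /=; rewrite row_mxKl row_mxKr.
by move=> /eq_row_mx[_ ->].
Qed.

Lemma is_derive_flow_curve n (X : 'rV[R]_n -> 'rV[R]_n) phi (y : R -> 'rV[R]_n)
    (t : R) w :
  smooth_on setT X -> isflow X phi -> is_derive t 1 y w ->
  is_derive t 1 (fun s => phi s (y s)) (X (phi t (y t)) + 'd (phi t) (y t) w).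
Proof.
move=> sX fX dy.
pose J (z : 'rV[R]_(1 + n)) := phi (lsubmx z 0 0) (rsubmx z).
have sJ : smooth_on setT J.
  (* Time is turned into a parameter: the flow of s X at time 1 is the flow of X at time s. This
     gives smoothness jointly in time and state. *)
  pose Z (s : 'rV[R]_1) x := s 0 0 *: X x.
  have -> : J = fun z => phi (1 * lsubmx z 0 0) (rsubmx z).
    by apply/funext => z; rewrite mul1r.
  apply: (@param_flow_smooth 1 n Z (fun s t => phi (t * s 0 0))) => [|s]; last first.
    exact: flow_scale.
  apply/smooth_onP => k; have oT := @openT 'rV[R]_(1 + n).
  apply: Ck_scale => //.
    by apply: Ck_coord => //; apply: Ck_lsubmx => //; exact: Ck_id.
  apply: (Ck_comp (U' := setT)) => //; first exact: smoothCk.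
  by apply: Ck_rsubmx => //; exact: Ck_id.
have JE s x : J (row_mx (const_mx s) x) = phi s x.
  by rewrite /J row_mxKl row_mxKr mxE.
have dc (u : R) : is_derive u 1 (fun s : R => const_mx s : 'rV[R]_1) (const_mx 1).
  apply: is_deriveP_coord => i; rewrite mxE.
  rewrite (_ : (fun s => _) = id); first exact: is_derive_id.
  by apply/funext => s; rewrite mxE.
have dJ z : differentiable J z by exact: smooth_diff.
pose z0 := row_mx (const_mx t : 'rV[R]_1) (y t).
have e1 : 'd J z0 (row_mx (const_mx 1) 0) = X (phi t (y t)).
  have h1 := is_derive_diff_comp (dJ z0)
    (is_derive_row_mx (dc t) (is_derive_cst (y t) t 1)).
  apply: is_derive_unique h1 _.
  by under eq_fun do rewrite JE; exact: (fX _).2.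
have e2 : 'd J z0 (row_mx 0 w) = 'd (phi t) (y t) w.
  have h1 := is_derive_diff_comp (dJ z0)
    (is_derive_row_mx (is_derive_cst (const_mx t) t 1) dy).
  apply: is_derive_unique h1 _.
  under eq_fun do rewrite JE; apply: is_derive_diff_comp => //.
  exact: smooth_diff (flow_smooth t sX fX).
have := is_derive_diff_comp (dJ z0) (is_derive_row_mx (dc t) dy).
under eq_fun do rewrite JE.
rewrite -e1 -e2 -linearD add_row_mx addr0 add0r; exact.
Qed.

(** The velocity of phi t (psi t x) is X plus the image of Y under the differential of phi t, and
    commuting flows preserve Y. *)
Lemma flow_add n (X Y : 'rV[R]_n -> 'rV[R]_n) phi psi :
  smooth_on setT X -> smooth_on setT Y -> isflow X phi -> isflow Y psi ->
  commuting X Y ->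
  isflow (fun x => X x + Y x) (fun t x => phi t (psi t x)).
Proof.
move=> sX sY fX fY cXY x; split=> [|t]; first by rewrite (fY x).1 (fX x).1.
have := is_derive_flow_curve sX fX ((fY x).2 t).
by rewrite (flow_commuting _ _ sX sY fX cXY).
Qed.

(** * The action generated by complete commuting fields *)

Section Commuting_family.
Variables (r n : nat) (Y : 'I_r -> 'rV[R]_n -> 'rV[R]_n).
Hypotheses (sY : forall k, smooth_on setT (Y k))
  (fY : forall k, exists phi, isflow (Y k) phi)
  (cY : forall j k, commuting (Y j) (Y k)).

(** Sums over a list rather than over all of ['I_r], so that the flow of [span_field] can be built
    by adding one field at a time. *)
Let S (l : seq 'I_r) (s : 'rV[R]_r) x := \sum_(k <- l) s 0 k *: Y k x.

Definition span_field (s : 'rV[R]_r) x := \sum_k s 0 k *: Y k x.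

Let is_diff_S l s x :
  is_diff x (S l s) (fun v => \sum_(k <- l) s 0 k *: 'd (Y k) x v).
Proof.
elim: l => [|k l IH].
  have E1 : S [::] s = cst 0 by apply/funext => y; rewrite /S big_nil.
  have E2 : (fun v => \sum_(k <- [::]) s 0 k *: 'd (Y k) x v) = 0.
    by apply/funext => v; rewrite big_nil.
  by rewrite E1 E2; exact: is_diff_cst.
have E1 : S (k :: l) s = (fun x => s 0 k *: Y k x) + S l s.
  by apply/funext => y; rewrite /S big_cons.
have E2 : (fun v => \sum_(j <- k :: l) s 0 j *: 'd (Y j) x v) =
    (fun v => s 0 k *: 'd (Y k) x v) + fun v => \sum_(j <- l) s 0 j *: 'd (Y j) x v.
  by apply/funext => v; rewrite big_cons.
rewrite E1 E2; apply: is_diffD; apply: is_diffZ; apply: differentiableP.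
exact: smooth_diff.
Qed.

Let diff_S l s x v : 'd (S l s) x v = \sum_(k <- l) s 0 k *: 'd (Y k) x v.
Proof. by have [_ E] := is_diff_S l s x; exact: (congr1 (@^~ v) E). Qed.

Let S_commuting l l' s s' : commuting (S l s) (S l' s').
Proof.
have h m m' (c c' : 'rV[R]_r) x : \sum_(j <- m) c 0 j *: 'd (Y j) x (S m' c' x) =
    \sum_(j <- m) \sum_(k <- m') (c 0 j * c' 0 k) *: 'd (Y j) x (Y k x).
  apply: eq_bigr => j _; rewrite linear_sum scaler_sumr.
  by apply: eq_bigr => k _; rewrite linearZ scalerA.
move=> x; apply: (etrans (diff_S l' s' x _)); apply: (etrans _ (esym (diff_S l s x _))).
apply: (etrans (h _ _ _ _ _)); apply: (etrans _ (esym (h _ _ _ _ _))).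
apply: (etrans (exchange_big _ _ _ _ _ _)) => /=.
by apply: eq_bigr => k _; apply: eq_bigr => j _; rewrite mulrC; congr (_ *: _); exact: cY.
Qed.

Let S_smooth l s : smooth_on setT (S l s).
Proof.
apply/smooth_onP => k; apply: Ck_sum => [|j _]; first exact: openT.
apply: Ck_scale; [exact: openT|exact: Ck_cst|exact: smoothCk].
Qed.

Let S_flow l s : exists phi, isflow (S l s) phi.
Proof.
elim: l => [|k l [phi IH]].
  exists (fun _ => id) => x; split=> // t.
  by rewrite /S big_nil; exact: is_derive_cst.
have [psi Hpsi] := fY k.
exists (fun t x => psi (t * s 0 k) (phi t x)).
have -> : S (k :: l) s = fun x => S [:: k] s x + S l s x.
  by apply/funext => x; rewrite /S big_cons big_seq1.
apply: (@flow_add _ (S [:: k] s) (S l s) (fun t => psi (t * s 0 k)) phi) => //.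
have := flow_scale (s 0 k) Hpsi.
by congr isflow; apply/funext => x; rewrite /S big_seq1.
Qed.

(** E s is the time-one map of [span_field s]. Smoothness in (s, x) is then dependence on a
    parameter, additivity in s is [flow_add], and time t amounts to replacing s by t *: s. *)
Lemma commuting_action : exists E : 'rV[R]_r -> 'rV[R]_n -> 'rV[R]_n,
  [/\ smooth_on setT (fun z : 'rV[R]_(r + n) => E (lsubmx z) (rsubmx z)),
      forall x, E 0 x = x,
      forall s s' x, E (s + s') x = E s (E s' x) &
      forall s x (t : R), is_derive t 1 (fun t => E (t *: s) x)
        (span_field s (E (t *: s) x))].
Proof.
have /choice[phi Hphi] : forall s, exists phi, isflow (span_field s) phi.
  move=> s; have [phi Hphi] := S_flow (index_enum _) s; by exists phi.
have sS s : smooth_on setT (span_field s) by exact: (S_smooth (index_enum _)).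
have scale (s : 'rV[R]_r) (t : R) x : phi (t *: s) 1 x = phi s t x.
  have E : span_field (t *: s) = fun x => t *: span_field s x.
    apply/funext => y; rewrite /span_field scaler_sumr.
    by apply: eq_bigr => k _; rewrite mxE scalerA.
  have := Hphi (t *: s); rewrite E => h.
  have sE : smooth_on setT (fun x => t *: span_field s x) by rewrite -E.
  rewrite (flow_unique sE h (flow_scale t (Hphi s))); by rewrite mul1r.
exists (fun s x => phi s 1 x); split.
- apply: param_flow_smooth => //; apply/smooth_onP => k.
  have oT := @openT 'rV[R]_(r + n).
  apply: Ck_sum => // j _; apply: Ck_scale => //.
    by apply: Ck_coord => //; apply: Ck_lsubmx => //; exact: Ck_id.
  apply: (Ck_comp (U' := setT)) => //; first exact: smoothCk.
  by apply: Ck_rsubmx => //; exact: Ck_id.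
- by move=> x; rewrite -(scale0r (0 : 'rV[R]_r)) scale (Hphi _ x).1.
- move=> s s' x.
  have E : span_field (s + s') = fun x => span_field s x + span_field s' x.
    apply/funext => y; rewrite /span_field -big_split.
    by apply: eq_bigr => k _; rewrite mxE scalerDl.
  have := Hphi (s + s'); rewrite E => h.
  have sE : smooth_on setT (fun x => span_field s x + span_field s' x).
    by rewrite -E.
  have c : commuting (span_field s) (span_field s').
    exact: (S_commuting (index_enum _) (index_enum _)).
  by rewrite (flow_unique sE h (flow_add (sS s) (sS s') (Hphi s) (Hphi s') c)).
- move=> s x t; rewrite scale.
  by under eq_fun do rewrite scale; exact: (Hphi s x).2.
Qed.

End Commuting_family.

End Action.

(** * The inverse function theorem *)

Section Inverse.
Context {R : realType}.

HB.instance Definition _ n :=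
  Uniform_isComplete.Build 'rV[R]_n (@mx_complete R 1 n).

Lemma mulmxr_bound n p (B : 'M[R]_(n, p)) :
  exists2 K, 0 < K & forall v : 'rV[R]_n, `|v *m B| <= K * `|v|.
Proof.
have [|K K0 HK] := @linear_lipschitz R 'rV[R]_n 'rV[R]_p (mulmxr B).
  exact: rV_linear_continuous.
by exists K.
Qed.

Lemma diff_jacobian n (F : 'rV[R]_n -> 'rV[R]_n) x v :
  'd F x v = v *m jacobian F x.
Proof. by rewrite /jacobian mul_rV_lin1. Qed.

Lemma row_unitmx n (A : 'M[R]_n) :
  (forall v : 'rV[R]_n, v *m A = 0 -> v = 0) -> A \in unitmx.
Proof.
move=> inj; rewrite -row_free_unit -kermx_eq0; apply/eqP/row_matrixP => i.
rewrite row0; apply: inj; rewrite -row_mul mulmx_ker; exact: row0.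
Qed.

Section Local.
Variables (n : nat) (F : 'rV[R]_n -> 'rV[R]_n) (p : 'rV[R]_n).
Hypotheses (sF : smooth_on setT F) (dFp : forall v, 'd F p v = v).

Let CF k : Ck k setT F. Proof. exact: smoothCk. Qed.

Lemma near_identity : exists rho M : R,
  [/\ 0 < rho, 0 < M,
      forall x v, cball p rho x -> `|'d F x v - v| <= 2^-1 * `|v| &
      forall x y, cball p rho x -> cball p rho y ->
        `|F x - F y - 'd F y (x - y)| <= M * `|x - y| ^+ 2].
Proof.
have sub : cball p 1 `<=` setT by [].
have [K K0 HK] := Ck_diff_lip (@CF 2) sub.
have [M M0 HM] := Ck_taylor (@CF 2) sub.
(* [K] is a Lipschitz constant of the differential on the unit ball, so within 1 / (2 K) of p the
   differential is within 1/2 of its value at p, the identity. *)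
pose rho := Num.min 1 (2 * K)^-1.
have rho0 : 0 < rho by rewrite lt_min ltr01 invr_gt0 mulr_gt0.
have rsub x : cball p rho x -> cball p 1 x.
  by rewrite /cball /= => h; apply: le_trans h _; rewrite ge_min lexx.
exists rho, M; split=> // [x v xr|x y xr yr]; last by apply: HM; exact: rsub.
have pp : cball p 1 p by rewrite /cball /= subrr normr0.
rewrite -{2}[v]dFp; apply: le_trans (HK _ _ _ (rsub _ xr) pp) _.
apply: ler_wpM2r => //; apply: (@le_trans _ _ (K * (2 * K)^-1)).
  apply: ler_wpM2l; first exact: ltW.
  by apply: le_trans xr _; rewrite ge_min lexx orbT.
by rewrite invfM mulrCA mulfV ?gt_eqF // mulr1.
Qed.

(** Stated for a differential equal to the identity at p, a normalization that [slice_exists]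
    arranges. Near p the map F - id then contracts by 1/2, which gives injectivity directly and
    surjectivity through a fixed point. *)
Theorem inverse_function : exists (U V : set 'rV[R]_n) (G : 'rV[R]_n -> 'rV[R]_n),
  [/\ open U, open V, U p & smooth_on V G] /\
  (forall x, U x -> V (F x) /\ G (F x) = x) /\
  (forall y, V y -> U (G y) /\ F (G y) = y).
Proof.
have [rho [M [rho0 M0 Hd Ht]]] := near_identity.
have dF x : differentiable F x by exact: smooth_diff.
have cid : continuous (@idfun 'rV[R]_n) by move=> x; exact: cvg_id.
have Hl x y : cball p rho x -> cball p rho y ->
    `|(F x - x) - (F y - y)| <= 2^-1 * `|x - y|.
  move=> xr yr; apply: (@diff_lip _ _ _ (cball p rho) (fun x => F x - idfun x)) => //.
  - by move=> s; exact: cball_convex.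
  - by move=> c _; apply: differentiableB.
  - move=> c v cr; rewrite (diff_sub_linear v cid (dF c)); exact: Hd.
have lip x y : cball p rho x -> cball p rho y -> `|x - y| <= 2 * `|F x - F y|.
  move=> xr yr; have := Hl x y xr yr.
  have -> : x - y = (F x - F y) - ((F x - x) - (F y - y)).
    by apply/rowP => i; rewrite !mxE; ring.
  move=> h; have := ler_normB (F x - F y) ((F x - x) - (F y - y)).
  move: h; set a := F x - x - (F y - y); set b := F x - F y.
  lra.
have inj x y : cball p rho x -> cball p rho y -> F x = F y -> x = y.
  move=> xr yr e; apply/eqP; rewrite -subr_eq0 -normr_eq0 eq_le normr_ge0 andbT.
  by have := lip x y xr yr; rewrite e subrr normr0 mulr0.
(* Half of rho is reserved for y - F p; the other half absorbs the variation of F - id over the ball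
   of radius rho, so that the iteration below stays in that ball. *)
pose V : set 'rV[R]_n := ball (F p) (rho / 2).
pose U : set 'rV[R]_n := ball p rho `&` F @^-1` V.
have ballc x : ball p rho x -> cball p rho x.
  by rewrite -ball_normE /ball_ /cball /= distrC => /ltW.
have pp : cball p rho p by rewrite /cball /= subrr normr0 ltW.
have sol y : V y -> exists x, ball p rho x /\ F x = y.
  rewrite /V -ball_normE /ball_ /= => Vy.
  (* The fixed points of T are the preimages of y. *)
  pose T x := y - (F x - x).
  have Tb x : cball p rho x -> `|T x - p| < rho.
    move=> xr; have h := Hl x p xr pp.
    have -> : T x - p = (y - F p) - ((F x - x) - (F p - p)).
      by apply/rowP => i; rewrite !mxE; ring.
    apply: le_lt_trans (ler_normB _ _) _; rewrite /cball /= in xr.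
    rewrite distrC in Vy; lra.
  have TU : {homo T : x / cball p rho x >-> cball p rho x}.
    by move=> x xr; exact: ltW (Tb x xr).
  pose TM := isFun.Build _ _ (cball p rho) (cball p rho) T TU.
  pose Tf : {fun cball p rho >-> cball p rho} := HB.pack T TM.
  have ctr : is_contraction Tf.
    have q0 : (0 : R) <= 2^-1 by [].
    exists (NngNum q0); split; first by rewrite /= invf_lt1 ?ltr1n.
    move=> [x1 x2] [/= x1r x2r]; rewrite /T.
    have -> : y - (F x1 - x1) - (y - (F x2 - x2)) = - ((F x1 - x1) - (F x2 - x2)).
      by apply/rowP => i; rewrite !mxE; ring.
    by rewrite normrN; exact: Hl.
  have [||x xr xT] := banach_fixed_point ctr.
  - exact: compact_closed (@norm_hausdorff _ _) (@cball_compact _ _ _ _).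
  - by exists p.
  exists x; split.
    by rewrite distrC [X in X - p]xT; exact: Tb.
  apply/eqP; rewrite -subr_eq0 -[X in _ == X](subrr x) {3}xT; apply/eqP.
  by apply/rowP => i; rewrite /= !mxE; ring.
have /choice[G HG] : forall y, exists x, V y -> ball p rho x /\ F x = y.
  move=> y; have [Vy|nV] := pselect (V y); last by exists 0.
  by have [x Hx] := sol y Vy; exists x.
have oV : open V by apply: ball_open; rewrite divr_gt0.
have GV y : V y -> U (G y) /\ F (G y) = y.
  by move=> Vy; have [h1 h2] := HG y Vy; split=> //; split=> //; rewrite /= h2.
have GU x : U x -> V (F x) /\ G (F x) = x.
  move=> [xr Vx]; split=> //; have [h1 h2] := HG _ Vx.
  by apply: inj => //; exact: ballc.
exists U, V, G; split; last by [].
split=> //.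
- apply: openI; first exact: ball_open.
  by apply: open_comp => // x _; apply: differentiable_continuous; exact: dF.
- by split; [exact: ballxx|rewrite /V /=; apply: ballxx; rewrite divr_gt0].
have uJ x : cball p rho x -> jacobian F x \in unitmx.
  move=> xr; apply: row_unitmx => v; rewrite -diff_jacobian => v0.
  apply/eqP; rewrite -normr_eq0 eq_le normr_ge0 andbT.
  have := Hd x v xr; rewrite v0 sub0r normrN; have := normr_ge0 v; lra.
have Gr y : V y -> cball p rho (G y).
  by move=> /GV[[h _] _]; exact: ballc.
have dG y : V y -> is_diff y G (fun w => w *m invmx (jacobian F (G y))).
  move=> Vy; have [K K0 HK] := mulmxr_bound (invmx (jacobian F (G y))).
  have : nbhs y V by move: oV; rewrite openE; exact.
  move=> /nbhs_ballP[d /= d0 Hd'].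
  (* By Taylor at G y, the increment of G multiplied by the Jacobian differs from w by at most M
     times its squared norm, and the increment is at most 2 |w|; this gives the factor M * 4. *)
  apply: (@quad_is_diff _ _ _ _ (mulmxr (invmx (jacobian F (G y)))) y d (K * (M * 4))).
  - exact: rV_linear_continuous.
  - by [].
  - by rewrite !mulr_ge0 // ltW.
  move=> w wd; have Vw : V (w + y).
    by apply: Hd'; rewrite -ball_normE /ball_ /= opprD addrCA subrr addr0 normrN.
  have h := Ht _ _ (Gr _ Vw) (Gr _ Vy).
  rewrite (GV _ Vw).2 (GV _ Vy).2 addrK diff_jacobian in h.
  have l := lip _ _ (Gr _ Vw) (Gr _ Vy).
  rewrite (GV _ Vw).2 (GV _ Vy).2 addrK in l.
  rewrite /= -[G (w + y) - G y](mulmxK (uJ _ (Gr _ Vy))) -mulmxBl.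
  apply: le_trans (HK _) _; rewrite -mulrA; apply: ler_wpM2l; first exact: ltW.
  rewrite distrC; apply: le_trans h _; rewrite -mulrA; apply: ler_wpM2l; first exact: ltW.
  have -> : 4 * `|w| ^+ 2 = (2 * `|w|) ^+ 2 by rewrite exprMn -natrX.
  by rewrite ler_pXn2r ?nnegrE // mulr_ge0.
(* The derivative of G is the inverse Jacobian evaluated at G itself, so it is as regular as G is
   already known to be. *)
apply/smooth_onP; elim=> [|k IH]; first by apply: Ck0P => y /dG[].
apply/CkSP; split=> [y /dG[] //|v].
apply: (eq_Ck (G := fun y => v *m invmx (jacobian F (G y)))) => // [y Vy|].
  have [d dE] := dG y Vy; rewrite (deriveE v d).
  exact: (congr1 (@^~ v) dE).
apply: CkP_coord => // i.
rewrite (_ : (fun y => _) = fun y => \sum_j v 0 j * invmx (jacobian F (G y)) j i);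
  last by apply/funext => y; rewrite mxE.
apply: Ck_sum => // j _; apply: Ck_mul => //; first exact: Ck_cst.
apply: Ck_invmx => // [y Vy|i' j']; first exact: uJ (Gr _ Vy).
apply: (eq_Ck (G := fun y => 'D_(delta_mx 0 i') F (G y) 0 j')) => // [y Vy|].
  by rewrite deriveE // diff_jacobian -rowE [RHS]mxE.
apply: Ck_coord => //; apply: (Ck_comp (F := 'D_(delta_mx 0 i') F) (U' := setT)) => //.
exact: CkD (@CF k.+1).
Qed.

End Local.

End Inverse.

(** * Lie derivatives and Lie brackets *)

Section Lie.
Context {R : realType}.

(** * Symmetry of second derivatives *)

Section Schwarz.
Variables (n : nat) (l : 'rV[R]_n -> R).
Hypothesis Cl : Ck 2 setT l.

Let dl x : differentiable l x. Proof. exact: (CkS_diff Cl). Qed.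

Let dDl u x : differentiable ('D_u l) x.
Proof. exact: (CkS_diff (CkD u Cl)). Qed.

Let line (x u : 'rV[R]_n) (s : R) : is_derive s 1 (fun s => s *: u + x) u.
Proof.
have [d dE] := is_diff_scalel s u.
have D : is_derive s 1 (fun s : R => s *: u) u.
  apply: DeriveDef; first exact: diff_derivable.
  by rewrite deriveE // dE scale1r.
by have := is_deriveD D (is_derive_cst x s 1); rewrite addr0.
Qed.

Lemma second_difference x u v (t : R) : 0 < t -> exists a b : R,
  [/\ 0 < a < t, 0 < b < t &
   l (t *: u + (t *: v + x)) - l (t *: u + x) - (l (t *: v + x) - l x) =
   t ^+ 2 * 'D_v ('D_u l) (b *: v + (a *: u + x))].
Proof.
move=> t0; pose f s := l (s *: u + (t *: v + x)) - l (s *: u + x).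
pose df s := 'D_u l (s *: u + (t *: v + x)) - 'D_u l (s *: u + x).
have dF (s : R) : is_derive s 1 f (df s).
  rewrite /df !deriveE //.
  apply: is_deriveB; apply: is_derive_diff_comp => //; exact: line.
have [|a a0t Ea] := MVT t0 (fun s _ => dF s).
  by apply: derivable_within_continuous => s _; have [] := dF s.
pose g s := 'D_u l (s *: v + (a *: u + x)).
have dG (s : R) : is_derive s 1 g ('D_v ('D_u l) (s *: v + (a *: u + x))).
  rewrite deriveE //; apply: is_derive_diff_comp => //; exact: line.
have [|b b0t Eb] := MVT t0 (fun s _ => dG s).
  by apply: derivable_within_continuous => s _; have [] := dG s.
exists a, b; split; [by rewrite in_itv in a0t|by rewrite in_itv in b0t|].
move: Ea; rewrite /f /= !scale0r !add0r => ->.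
rewrite subr0 /df; move: Eb; rewrite /g /= !scale0r !add0r subr0.
by rewrite addrCA => ->; rewrite -mulrA -expr2 mulrC.
Qed.

(** The second difference of [second_difference] is symmetric in u and v, so both mixed derivatives,
    each taken at its own intermediate point, agree. These points are arbitrarily close to x, where
    the mixed derivatives are continuous. *)
Lemma schwarz u v x : 'D_v ('D_u l) x = 'D_u ('D_v l) x.
Proof.
have C2 u' v' : {for x, continuous ('D_v' ('D_u' l))}.
  apply: differentiable_continuous.
  exact: (CkS_diff (CkD v' (CkD u' Cl))).
apply/eqP; rewrite -subr_eq0 -normr_eq0 eq_le normr_ge0 andbT.
apply/ler_addgt0Pr => e e0; rewrite add0r.
have e2 : 0 < e / 2 by rewrite divr_gt0.
have /cvgrPdist_lt/(_ _ e2)/nbhs_ballP[d1 /= d10 H1] := C2 u v.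
have /cvgrPdist_lt/(_ _ e2)/nbhs_ballP[d2 /= d20 H2] := C2 v u.
pose d := Num.min d1 d2; have d0 : 0 < d by rewrite lt_min d10.
pose c := `|u| + `|v| + 1.
have c0 : 0 < c by rewrite ltr_wpDl // addr_ge0.
pose t := d / c; have t0 : 0 < t by rewrite divr_gt0.
have near a b (u' v' : 'rV[R]_n) : 0 < a < t -> 0 < b < t -> `|u'| + `|v'| = `|u| + `|v| ->
    `|x - (b *: v' + (a *: u' + x))| < d.
  move=> /andP[a0 at_] /andP[b0 bt] Euv.
  have -> : x - (b *: v' + (a *: u' + x)) = - (b *: v' + a *: u').
    by apply/rowP => i; rewrite !mxE; ring.
  rewrite normrN; apply: le_lt_trans (ler_normD _ _) _.
  rewrite !normrZ (gtr0_norm a0) (gtr0_norm b0).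
  apply: (@le_lt_trans _ _ (t * (`|u| + `|v|))).
    rewrite -Euv mulrDr addrC; apply: lerD; apply: ler_wpM2r => //; exact: ltW.
  by rewrite /t -mulrA mulrC -ltr_pdivlMr // divff ?gt_eqF // mulrC ltr_pdivrMr
    // mul1r ltrDl.
have [a [b [a0 b0 E1]]] := second_difference x u v t0.
have [a' [b' [a'0 b'0 E2]]] := second_difference x v u t0.
have E : 'D_v ('D_u l) (b *: v + (a *: u + x)) = 'D_u ('D_v l) (b' *: u + (a' *: v + x)).
  have t2 : t ^+ 2 != 0 by rewrite expf_neq0 // gt_eqF.
  apply: (mulfI t2); apply: (etrans (esym E1)); apply: (etrans _ E2).
  rewrite [t *: u + (t *: v + x)]addrCA; ring.
have n1 := near _ _ u v a0 b0 erefl.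
have n2 := near _ _ v u a'0 b'0 (addrC _ _).
have h1 : `|'D_v ('D_u l) x - 'D_v ('D_u l) (b *: v + (a *: u + x))| < e / 2.
  by apply: H1; rewrite -ball_normE /=; apply: lt_le_trans n1 _; rewrite ge_min lexx.
have h2 : `|'D_u ('D_v l) x - 'D_u ('D_v l) (b' *: u + (a' *: v + x))| < e / 2.
  by apply: H2; rewrite -ball_normE /=; apply: lt_le_trans n2 _; rewrite ge_min lexx orbT.
rewrite -E in h2.
set A := 'D_v ('D_u l) (b *: v + (a *: u + x)) in h1 h2.
move: A ('D_v ('D_u l) x) ('D_u ('D_v l) x) h1 h2 => A p q h1 h2.
have -> : p - q = (p - A) - (q - A) by ring.
apply: le_trans (ler_normB _ _) _.
by rewrite [leRHS]splitr; apply: lerD; exact: ltW.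
Qed.

End Schwarz.

Lemma lie_derivativeE n (X : 'rV[R]_n -> 'rV[R]_n) (l : 'rV[R]_n -> R) x :
  differentiable l x -> lie_derivative X l x = 'd l x (X x).
Proof.
move=> dl; rewrite diff_sum_coord // /lie_derivative; apply: eq_bigr => i _.
by rewrite mxE mulrC.
Qed.

Lemma lie_derivative_smooth n (X : 'rV[R]_n -> 'rV[R]_n) (l : 'rV[R]_n -> R) :
  smooth_on setT X -> smooth_on setT l -> smooth_on setT (lie_derivative X l).
Proof.
move=> sX sl; apply/smooth_onP => k; have oT := @openT 'rV[R]_n.
apply: (eq_Ck (G := fun x => 'd l x (X x))) => // [x _|].
  by rewrite lie_derivativeE //; exact: smooth_diff.
apply: (Ck_dir (A := id) (U' := setT)) => //; [exact: smoothCk|exact: Ck_id|].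
exact: smoothCk.
Qed.

Lemma lie_bracket_smooth n (X Y : 'rV[R]_n -> 'rV[R]_n) :
  smooth_on setT X -> smooth_on setT Y -> smooth_on setT (lie_bracket X Y).
Proof.
move=> sX sY; apply/smooth_onP => k; have oT := @openT 'rV[R]_n.
have dir (F G : 'rV[R]_n -> 'rV[R]_n) : smooth_on setT F -> smooth_on setT G ->
    Ck k setT (fun x => 'd F x (G x)).
  move=> sF sG; apply: (Ck_dir (A := id) (U' := setT)) => //; [exact: smoothCk|exact: Ck_id|].
  exact: smoothCk.
rewrite (_ : lie_bracket X Y = fun x => 'd Y x (X x) + -1 *: 'd X x (Y x)).
  by apply: Ck_add => //; [exact: dir|apply: Ck_scale => //; [exact: Ck_cst|exact: dir]].
by apply/funext => x; rewrite scaleN1r.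
Qed.

Lemma is_diff_coord (V : normedModType R) n (F : V -> 'rV[R]_n) x i :
  differentiable F x -> is_diff x (fun y => F y 0 i) (fun v => 'd F x v 0 i).
Proof.
move=> dF; have cc : continuous (fun N : 'rV[R]_n => N 0 i) by exact: coord_continuous.
have lc : linear (fun N : 'rV[R]_n => N 0 i : R) by move=> c A B; rewrite !mxE.
pose LM := GRing.isLinear.Build _ _ _ _ _ lc.
pose L : {linear _ -> _} := HB.pack (fun N : 'rV[R]_n => N 0 i) LM.
have cL : continuous L := cc.
have dL y : differentiable L y by exact: linear_differentiable.
apply: DiffDef; first exact: (differentiable_comp dF (dL _)).
by rewrite -[LHS]/('d (L \o F) x : _ -> _) (diff_comp dF (dL _)) (diff_lin _ cL).
Qed.

(** The double sum is the Hessian of l applied to X x and w. With w = Y x it is symmetric in the two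
    fields and cancels in the commutator, leaving the bracket. *)
Lemma diff_lie_derivative n (X : 'rV[R]_n -> 'rV[R]_n) (l : 'rV[R]_n -> R) x w :
  smooth_on setT X -> smooth_on setT l ->
  'd (lie_derivative X l) x w = 'd l x ('d X x w) +
    \sum_i \sum_j (X x 0 i * w 0 j) *: 'D_(delta_mx 0 j) ('D_(delta_mx 0 i) l) x.
Proof.
move=> sX sl; have dl y : differentiable l y by exact: smooth_diff.
have dDl i y : differentiable ('D_(delta_mx 0 i) l) y.
  exact: (CkS_diff (CkD _ (smoothCk (k := 1) sl))).
have dX : differentiable X x by exact: smooth_diff.
have dXi i : is_diff x (fun y => X y 0 i) (fun v => 'd X x v 0 i).
  exact: is_diff_coord.
have E : lie_derivative X l = \sum_i (fun y => X y 0 i *: 'D_(delta_mx 0 i) l y).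
  by apply/funext => y; rewrite fct_sumE lie_derivativeE // diff_sum_coord.
have D i : is_diff x (fun y => X y 0 i *: 'D_(delta_mx 0 i) l y)
    (fun v => X x 0 i *: 'd ('D_(delta_mx 0 i) l) x v +
              'd X x v 0 i *: 'D_(delta_mx 0 i) l x).
  have [d1 d2] := dXi i; have := is_diff_scale d1 (dDl i x).
  by rewrite d2.
have S (I : seq 'I_n) : is_diff x (\sum_(i <- I) (fun y => X y 0 i *: 'D_(delta_mx 0 i) l y))
   (\sum_(i <- I) (fun v => X x 0 i *: 'd ('D_(delta_mx 0 i) l) x v +
              'd X x v 0 i *: 'D_(delta_mx 0 i) l x)).
  elim: I => [|i I IH]; first by rewrite !big_nil; exact: is_diff_cst.
  by rewrite !big_cons; exact: is_diffD.
have [_ dE] := S (index_enum _); rewrite E (congr1 (@^~ w) dE) fct_sumE big_split addrC /=.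
rewrite (diff_sum_coord _ (dl x)); congr (_ + _); apply: eq_bigr => i _.
rewrite (diff_sum_coord _ (dDl i x)) scaler_sumr.
by apply: eq_bigr => j _; rewrite scalerA.
Qed.

Lemma lie_bracketP n (X Y : 'rV[R]_n -> 'rV[R]_n) (l : 'rV[R]_n -> R) x :
  smooth_on setT X -> smooth_on setT Y -> smooth_on setT l ->
  lie_derivative (lie_bracket X Y) l x =
  lie_derivative X (lie_derivative Y l) x - lie_derivative Y (lie_derivative X l) x.
Proof.
move=> sX sY sl; have dl y : differentiable l y by exact: smooth_diff.
rewrite !(lie_derivativeE _ (smooth_diff _ _)) //; try exact: lie_derivative_smooth.
rewrite !diff_lie_derivative // /lie_bracket linearB opprD addrACA.
rewrite -[LHS]addr0; congr (_ + _); apply/esym/eqP; rewrite subr_eq0; apply/eqP.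
rewrite exchange_big; apply: eq_bigr => i _; apply: eq_bigr => j _.
by rewrite mulrC schwarz //; exact: smoothCk.
Qed.

End Lie.

(** * The fields dual to the output derivatives *)

Section NormalForm.
Context {R : realType} {n : nat}.
Implicit Types (X Y : 'rV[R]_n -> 'rV[R]_n) (l : 'rV[R]_n -> R).

Lemma lie_derivative_cst X (c : R) x : lie_derivative X (fun=> c) x = 0.
Proof. by apply: big1 => i _; rewrite mxE derive_cst mul0r. Qed.

Lemma lie_derivativeZ X (c : 'rV[R]_n -> R) l x :
  lie_derivative (fun x => c x *: X x) l x = c x * lie_derivative X l x.
Proof.
by rewrite /lie_derivative mulr_sumr; apply: eq_bigr => i _; rewrite !mxE mulrCA.
Qed.

Lemma lie_derivativeB X Y l x :
  lie_derivative (fun x => X x - Y x) l x =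
  lie_derivative X l x - lie_derivative Y l x.
Proof.
rewrite /lie_derivative -sumrB; apply: eq_bigr => i _.
by rewrite -mulrBr; congr (_ * _); rewrite !mxE.
Qed.

Section Relative_degree.
Variables (f g : 'rV[R]_n -> 'rV[R]_n) (h : 'rV[R]_n -> R) (r : nat).
Hypotheses (sf : smooth_on setT f) (sg : smooth_on setT g) (sh : smooth_on setT h)
  (rd : uniform_relative_degree f g h r).

Let r0 : (0 < r)%N. Proof. by case: rd. Qed.

Let a x := lie_derivative g (iter_lie f r.-1 h) x.
Let gt := gtilde f g h r.
Let ft := ftilde f g h r.
(** Counted from 0: [T m] is [tau f g h r m.+1]. *)
Let T m := iter_ad ft m gt.

Let a0 x : a x != 0. Proof. by case: rd => _ _; apply. Qed.

Lemma iter_lie_smooth k : smooth_on setT (iter_lie f k h).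
Proof. by elim: k => [//|k IH]; rewrite /iter_lie iterS; exact: lie_derivative_smooth. Qed.

Lemma gtilde_smooth : smooth_on setT (gtilde f g h r).
Proof.
apply/smooth_onP => k; have oT := @openT 'rV[R]_n.
apply: Ck_scale => //; last exact: smoothCk.
apply: Ck_inv => //.
by apply: smoothCk; apply: lie_derivative_smooth => //; exact: iter_lie_smooth.
Qed.

Lemma ftilde_smooth : smooth_on setT (ftilde f g h r).
Proof.
apply/smooth_onP => k; have oT := @openT 'rV[R]_n.
rewrite (_ : ftilde f g h r = fun x => f x + -1 *: (iter_lie f r h x *: gt x)).
  apply: Ck_add => //; first exact: smoothCk.
  apply: Ck_scale => //; first exact: Ck_cst.
  by apply: Ck_scale => //; apply: smoothCk; [exact: iter_lie_smooth|exact: gtilde_smooth].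
by apply/funext => x; rewrite scaleN1r.
Qed.

Lemma iter_ad_smooth m : smooth_on setT (iter_ad (ftilde f g h r) m (gtilde f g h r)).
Proof.
elim: m => [|m IH]; first exact: gtilde_smooth.
rewrite /iter_ad iterS; apply: lie_bracket_smooth => //; exact: ftilde_smooth.
Qed.

Lemma lie_gtilde_out k x : (k <= r.-1)%N ->
  lie_derivative (gtilde f g h r) (iter_lie f k h) x = (k == r.-1)%:R.
Proof.
move=> kr; rewrite /gtilde lie_derivativeZ; have [->|nk] := eqVneq k r.-1.
  by rewrite mulVf // a0.
have [_ H _] := rd; have lt : (k < r.-1)%N by rewrite ltn_neqAle nk.
by rewrite (H k lt x) mulr0.
Qed.

(** The subtracted multiple of [gtilde] cancels L_f^r h, so [ftilde] shifts the output derivatives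
    and annihilates the last one. *)
Lemma lie_ftilde_out k x : (k <= r.-1)%N ->
  lie_derivative (ftilde f g h r) (iter_lie f k h) x =
  if k == r.-1 then 0 else iter_lie f k.+1 h x.
Proof.
move=> kr; rewrite /ftilde lie_derivativeB lie_derivativeZ lie_gtilde_out //.
have [->|nk] := eqVneq k r.-1.
  by rewrite mulr1 -[lie_derivative f _]/(iter_lie f r.-1.+1 h) prednK // subrr.
by rewrite mulr0 subr0.
Qed.

(** In the commutator formula for [ftilde, T m] the term with [ftilde] outside differentiates a
    constant and drops out; the other one raises k by 1 at the price of a sign. Hence the pairing of
    the fields with the jet is, up to order and signs, the identity matrix. *)
Lemma lie_iter_ad_out m k x : (k <= r.-1)%N ->
  lie_derivative (iter_ad (ftilde f g h r) m (gtilde f g h r)) (iter_lie f k h) x =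
  (-1) ^+ m * (k + m == r.-1)%N%:R.
Proof.
elim: m k x => [|m IH] k x kr.
  by rewrite expr0 mul1r addn0; exact: lie_gtilde_out.
rewrite [iter_ad _ _ _]/(lie_bracket ft (T m)) lie_bracketP; last first.
- exact: iter_lie_smooth.
- exact: iter_ad_smooth.
- exact: ftilde_smooth.
have -> : lie_derivative (T m) (iter_lie f k h) = fun=> (-1) ^+ m * (k + m == r.-1)%N%:R.
  by apply/funext => y; exact: IH.
rewrite lie_derivative_cst sub0r.
have [kE|nk] := eqVneq k r.-1.
  have -> : lie_derivative ft (iter_lie f k h) = fun=> 0.
    by apply/funext => y; rewrite lie_ftilde_out // kE eqxx.
  rewrite lie_derivative_cst oppr0 kE -[X in _ == X]addn0 eqn_add2l.
  by rewrite mulr0.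
have -> : lie_derivative ft (iter_lie f k h) = iter_lie f k.+1 h.
  by apply/funext => y; rewrite lie_ftilde_out // (negbTE nk).
rewrite IH; last by rewrite ltn_neqAle nk.
by rewrite exprS mulN1r mulNr addSnnS.
Qed.

(** Since [gtilde] kills l, L_f l equals L_ftilde l, and the commutator formula rewrites its
    derivative along [T m] as minus the derivative of l along [T m.+1]. The bound on m keeps
    [T m.+1] in the family. *)
Lemma lie_iter_ad_lie_f m l x : smooth_on setT l ->
  (forall m, (m < r)%N -> forall x, lie_derivative (T m) l x = 0) -> (m.+1 < r)%N ->
  lie_derivative (T m) (lie_derivative f l) x = 0.
Proof.
move=> sl Hl mr.
have -> : lie_derivative f l = lie_derivative ft l.
  apply/funext => y; rewrite /ft /ftilde lie_derivativeB lie_derivativeZ.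
  by rewrite (Hl 0%N r0) mulr0 subr0.
have := Hl _ mr x; rewrite -[T m.+1]/(lie_bracket ft (T m)) lie_bracketP //.
- have -> : lie_derivative (T m) l = fun=> 0.
    by apply/funext => y; apply: Hl; exact: ltnW.
  by rewrite lie_derivative_cst sub0r => /eqP; rewrite oppr_eq0 => /eqP.
- exact: ftilde_smooth.
- exact: iter_ad_smooth.
Qed.

(* The tau_i reordered and signed so as to be dual to the derivatives of the output. *)
Definition dual_field (k : 'I_r) (x : 'rV[R]_n) :=
  (-1) ^+ (r.-1 - k) *:
    iter_ad (ftilde f g h r) (r.-1 - k) (gtilde f g h r) x.

Lemma lie_dual_field k l x : lie_derivative (dual_field k) l x =
  (-1) ^+ (r.-1 - k) *
    lie_derivative (iter_ad (ftilde f g h r) (r.-1 - k) (gtilde f g h r)) l x.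
Proof. exact: (lie_derivativeZ _ (fun=> (-1) ^+ (r.-1 - k))). Qed.

Definition out_jet (x : 'rV[R]_n) : 'rV[R]_r := \row_k iter_lie f k h x.

Lemma dual_field_smooth k : smooth_on setT (dual_field k).
Proof.
apply/smooth_onP => j; apply: Ck_scale; first exact: openT.
  exact: Ck_cst.
by apply: smoothCk; exact: iter_ad_smooth.
Qed.

Lemma out_jet_smooth : smooth_on setT out_jet.
Proof.
apply/smooth_onP => j; apply: CkP_coord => [|k]; first exact: openT.
rewrite (_ : (fun x => _) = iter_lie f k h); first exact: smoothCk (iter_lie_smooth k).
by apply/funext => x; rewrite mxE.
Qed.

Lemma diff_out_jet x v j : 'd out_jet x v 0 j = 'd (iter_lie f j h) x v.
Proof.
have [_ E] := is_diff_coord j (smooth_diff x out_jet_smooth).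
rewrite -(congr1 (@^~ v) E); congr ('d _ x v).
by apply/funext => y; rewrite mxE.
Qed.

Lemma ord_le_pred (k : 'I_r) : (k <= r.-1)%N.
Proof. by rewrite -ltnS prednK. Qed.

Lemma diff_out_jet_dual k x : 'd out_jet x (dual_field k x) = delta_mx 0 k.
Proof.
apply/rowP => j; rewrite diff_out_jet -lie_derivativeE; last first.
  by apply: smooth_diff; exact: iter_lie_smooth.
rewrite lie_dual_field lie_iter_ad_out ?ord_le_pred // mulrA -exprMn mulrNN mulr1.
rewrite expr1n mul1r mxE eqxx /= -{2}(subnKC (ord_le_pred k)) eqn_add2r.
have [->|jk] := eqVneq j k; first by rewrite eqxx.
suff -> : (j == k :> nat) = false by [].
by apply/negbTE; apply: contraNneq jk => /val_inj ->.
Qed.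

Hypotheses (tau_complete : forall i, (1 <= i <= r)%N -> complete_field (tau f g h r i))
  (tau_commute : forall i j, (1 <= i <= r)%N -> (1 <= j <= r)%N ->
       forall x, lie_bracket (tau f g h r i) (tau f g h r j) x = 0).

Let sub_lt (k : 'I_r) : (1 <= (r.-1 - k).+1 <= r)%N.
Proof. by rewrite /= (leq_ltn_trans (leq_subr _ _)) // prednK. Qed.

Lemma dual_field_flow k : exists phi, isflow (dual_field k) phi.
Proof.
have [phi Hphi] := complete_flow (tau_complete (sub_lt k)).
by exists (fun t => phi (t * (-1) ^+ (r.-1 - k))); exact: flow_scale.
Qed.

Lemma diff_dual_field k x v : 'd (dual_field k) x v =
  (-1) ^+ (r.-1 - k) *: 'd (T (r.-1 - k)) x v.
Proof.
exact: (congr1 (@^~ v) (diffZ _ (smooth_diff x (iter_ad_smooth (r.-1 - k))))).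
Qed.

Lemma dual_field_commuting j k : commuting (dual_field j) (dual_field k).
Proof.
move=> x; apply: (etrans (diff_dual_field k x _)).
apply: (etrans _ (esym (diff_dual_field j x _))); rewrite /dual_field.
rewrite [X in _ *: X = _]linearZ [X in _ = _ *: X]linearZ /= !scalerA mulrC.
congr (_ *: _).
have := tau_commute (sub_lt j) (sub_lt k) x.
by rewrite /lie_bracket /tau /= => /eqP; rewrite subr_eq0 => /eqP.
Qed.

(** The index k stands for m = r.-1 - k, so m.+1 < r means 0 < k: the excluded field is the one dual
    to h, which is tau_r up to sign. *)
Lemma diff_dual_lie_f l (k : 'I_r) x : smooth_on setT l ->
  (forall k x, 'd l x (dual_field k x) = 0) -> (0 < k)%N ->
  'd (lie_derivative f l) x (dual_field k x) = 0.
Proof.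
move=> sl Hl k0; rewrite -lie_derivativeE; last first.
  by apply: smooth_diff; exact: lie_derivative_smooth.
rewrite lie_dual_field lie_iter_ad_lie_f ?mulr0 //.
- move=> m mr y; have m1 : (r.-1 - m < r)%N.
    by rewrite (leq_ltn_trans (leq_subr _ _)) // prednK.
  have /eqP := Hl (Ordinal m1) y; rewrite -lie_derivativeE ?lie_dual_field; last first.
    exact: smooth_diff.
  rewrite mulf_eq0 signr_eq0 /= subKn; last by rewrite -ltnS prednK.
  by move=> /eqP.
- rewrite -subSn ?ord_le_pred // prednK // ltn_subrL k0.
  exact: leq_ltn_trans (ltn_ord k).
Qed.

Lemma input_field_dual x : exists2 k : 'I_r, (k = r.-1 :> nat) & g x = a x *: dual_field k x.
Proof.
have kr : (r.-1 < r)%N by rewrite prednK.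
exists (Ordinal kr) => //; rewrite /dual_field /= subnn expr0 scale1r.
by rewrite [iter_ad _ _ _ _]/(gtilde f g h r x) /gtilde scalerA mulfV ?scale1r ?a0.
Qed.

End Relative_degree.

End NormalForm.

(** * The zero-output level set as a manifold *)

Section Complement.
Context {R : realType}.

(** For D the Jacobian of xi at a point and T the frame dual to it, the rows of B span the tangent
    space of the level set and C reads coordinates in B along the frame. The last identity splits a
    vector into its two parts. *)
Lemma dual_complement n r (T : 'M[R]_(r, n)) (D : 'M[R]_(n, r)) :
  T *m D = 1%:M -> exists (B : 'M[R]_(n - r, n)) (C : 'M[R]_(n, n - r)),
    [/\ B *m D = 0, B *m C = 1%:M, T *m C = 0 & D *m T + C *m B = 1%:M].
Proof.
move=> TD; have rD : \rank D = r.
  apply/eqP; rewrite eqn_leq rank_leq_col /=.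
  by have := mxrankM_maxr T D; rewrite TD mxrank1.
have rK : \rank (kermx D) = (n - r)%N by rewrite mxrank_ker rD.
(* Writing n - r as the rank of the kernel gives [row_base] the number of rows that the statement
   asks for. *)
rewrite -rK; pose B := row_base (kermx D).
have BD : B *m D = 0 by apply/sub_kermxP; rewrite eq_row_base.
pose C := (1%:M - D *m T) *m pinvmx B.
have sub : (1%:M - D *m T <= B)%MS.
  rewrite eq_row_base; apply/sub_kermxP.
  by rewrite mulmxBl mul1mx -mulmxA TD mulmx1 subrr.
exists B, C; split=> //.
- have fB : row_free B by exact: row_base_free.
  have e : B *m (1%:M - D *m T) = B.
    by rewrite mulmxBr mulmx1 (mulmxA B) BD mul0mx subr0.
  by rewrite /C mulmxA e mulmxVp.
- by rewrite /C mulmxA mulmxBr mulmx1 (mulmxA T) TD mul1mx subrr mul0mx.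
- by rewrite /C mulmxKpV // addrC subrK.
Qed.

End Complement.

Section DiffLinear.
Context {R : realType}.

Lemma is_diff_lin_comp (V W : normedModType R) n (L : {linear 'rV[R]_n -> W})
    (F : V -> 'rV[R]_n) x :
  differentiable F x -> is_diff x (fun y => L (F y)) (fun v => L ('d F x v)).
Proof.
move=> dF; have cL : continuous L by exact: rV_linear_continuous.
have dL y : differentiable L y by exact: linear_differentiable.
apply: DiffDef; first exact: (differentiable_comp dF (dL _)).
by rewrite -[LHS]/('d (L \o F) x : _ -> _) (diff_comp dF (dL _)) (diff_lin _ cL).
Qed.

Lemma is_diff_mulmx (V : normedModType R) n p (B : 'M[R]_(n, p))
    (F : V -> 'rV[R]_n) x :
  differentiable F x -> is_diff x (fun y => F y *m B) (fun v => 'd F x v *m B).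
Proof. exact: (is_diff_lin_comp (mulmxr B)). Qed.

End DiffLinear.

Section LevelSet.
Context {R : realType} {n r : nat}.
Variable xi : 'rV[R]_n -> 'rV[R]_r.
Hypothesis sxi : smooth_on setT xi.

Definition level_set : set 'rV[R]_n := [set x | xi x = 0].

Lemma level_setP (z : level_set) : xi (val z) = 0.
Proof. by have := set_valP z. Qed.

Lemma val_level_continuous : continuous (val : level_set -> 'rV[R]_n).
Proof. exact: initial_continuous. Qed.

Lemma cvg_level_set (S : Type) (F : set_system S) (FF : Filter F)
    (a : S -> level_set) (z : level_set) :
  (fun s => val (a s)) @ F --> val z -> a @ F --> z.
Proof.
move=> H A [_ [[W oW <-] Wz] WA].
have : F (fun s => W (val (a s))) by apply: H; exact: open_nbhs_nbhs.
move=> FW; rewrite nbhs_simpl /=; apply: filterS FW => s Ws; exact: WA.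
Qed.

Lemma level_set_hausdorff : hausdorff_space level_set.
Proof.
move=> x y H; apply: val_inj; apply: (@norm_hausdorff R 'rV[R]_n) => A B nA nB.
have [|z [Az Bz]] := H (val @^-1` A) (val @^-1` B) (val_level_continuous nA).
  exact: (val_level_continuous nB).
by exists (val z).
Qed.

Lemma level_set_second_countable : @second_countable level_set.
Proof.
have [B cB [oB bB]] := @rV_second_countable R n.
exists ((fun b => val @^-1` b) @` B); first exact: card_le_trans (card_image_le _ _) cB.
split=> [_ [b /oB ob <-]|z V [_ [[W oW <-] Wz] WV]].
  by apply: open_comp => // x _; exact: val_level_continuous.
have [b [Bb bz] bW] := bB (val z) W (open_nbhs_nbhs (conj oW Wz)).
exists (val @^-1` b); first by split=> //; exists b.
by move=> x bx; apply: WV; exact: bW.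
Qed.

(* Linear coordinates C on the open set sU, with smooth inverse a |-> sG (a *m B). *)
Record slice := Slice {
  scenter : level_set;
  sB : 'M[R]_(n - r, n);
  sC : 'M[R]_(n, n - r);
  sU : set 'rV[R]_n;
  sV : set 'rV[R]_n;
  sG : 'rV[R]_n -> 'rV[R]_n;
  sU_open : open sU;
  sV_open : open sV;
  sU_center : sU (val scenter);
  sG_smooth : smooth_on sV sG;
  sliceK : forall x, sU x -> xi x = 0 -> sV (x *m sC *m sB) /\ sG (x *m sC *m sB) = x;
  slice_onto : forall a, sV (a *m sB) ->
    [/\ sU (sG (a *m sB)), xi (sG (a *m sB)) = 0 & sG (a *m sB) *m sC = a] }.

Lemma slice_exists (Y : 'I_r -> 'rV[R]_n -> 'rV[R]_n) :
  (forall k x, 'd xi x (Y k x) = delta_mx 0 k) ->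
  forall z : level_set, exists c : slice, scenter c = z.
Proof.
move=> dY z; pose p := val z.
pose T : 'M[R]_(r, n) := \matrix_k Y k p.
pose D : 'M[R]_(n, r) := jacobian xi p.
have TD : T *m D = 1%:M.
  by apply/row_matrixP => k; rewrite row_mul rowK /D /jacobian mul_rV_lin1 dY rowE mulmx1.
have [B [C [BD BC TC DC]]] := dual_complement TD.
(* By D T + C B = 1 this map has the identity as differential at p. On the level set its first term
   vanishes, so there F is the linear chart C followed by B. *)
pose F x := xi x *m T + x *m C *m B.
have sF : smooth_on setT F.
  apply/smooth_onP => k; have oT := @openT 'rV[R]_n; apply: Ck_add => //.
    by apply: Ck_mulmx => //; exact: smoothCk.
  by apply: Ck_mulmx => //; apply: Ck_mulmx => //; exact: Ck_id.
have dF v : 'd F p v = v.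
  have dxi : differentiable xi p by exact: smooth_diff.
  have E : F = (fun x => xi x *m T) + (fun x => x *m (C *m B)).
    by apply/funext => x; rewrite /F -mulmxA.
  have did : differentiable (@id 'rV[R]_n) p by [].
  have [_ dE] := is_diffD (is_diff_mulmx T dxi) (is_diff_mulmx (C *m B) did).
  rewrite E; apply: (etrans (congr1 (@^~ v) dE)).
  have e1 : 'd xi p v = v *m D by rewrite /D /jacobian mul_rV_lin1.
  have e2 : 'd (@id 'rV[R]_n) p v = v by rewrite diff_val.
  rewrite -[LHS]/('d xi p v *m T + 'd (@id 'rV[R]_n) p v *m (C *m B)) e1 e2.
  by rewrite -mulmxA -mulmxDr DC mulmx1.
have [U [V [G [[oU oV Up sG] [UK VK]]]]] := inverse_function sF dF.
have h1 x : U x -> xi x = 0 -> V (x *m C *m B) /\ G (x *m C *m B) = x.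
  by move=> Ux xi0; have := UK x Ux; rewrite /F xi0 mul0mx add0r.
have h2 a : V (a *m B) ->
    [/\ U (G (a *m B)), xi (G (a *m B)) = 0 & G (a *m B) *m C = a].
  (* Multiplying F x by D isolates xi x, since T D = 1 and B D = 0; multiplying by C isolates x C,
     since T C = 0 and B C = 1. *)
  move=> /VK[Ux Fx]; split=> //.
    have := congr1 (mulmx^~ D) Fx; rewrite /F mulmxDl -!mulmxA TD BD !mulmx0 addr0.
    by rewrite mulmx1.
  have := congr1 (mulmx^~ C) Fx; rewrite /F mulmxDl -!mulmxA TC BC !mulmx0 add0r.
  by rewrite !mulmx1.
by exists (Slice (scenter := z) oU oV Up sG h1 h2).
Qed.

Definition slice_dom (c : slice) : set level_set := val @^-1` sU c.
Definition slice_phi (c : slice) (z : level_set) : 'rV[R]_(n - r) := val z *m sC c.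
(** Where [sG] misses the level set, the value defaults to the centre of the slice; the manifold
    structure only looks at points of [slice_cod]. *)
Definition slice_psi (c : slice) (a : 'rV[R]_(n - r)) : level_set :=
  insubd (scenter c) (sG c (a *m sB c)).
Definition slice_cod (c : slice) : set 'rV[R]_(n - r) := [set a | sV c (a *m sB c)].

Lemma val_slice_psi c a : slice_cod c a -> val (slice_psi c a) = sG c (a *m sB c).
Proof.
move=> /slice_onto[_ h _]; rewrite /slice_psi val_insubd.
by rewrite mem_set.
Qed.

Lemma slice_codE c : slice_phi c @` slice_dom c = slice_cod c.
Proof.
apply/seteqP; split=> [_ [z zU <-]|a aV].
  by have [] := sliceK zU (level_setP z).
have [h1 h2 h3] := slice_onto aV.
by exists (slice_psi c a); rewrite /slice_dom /slice_phi /= val_slice_psi.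
Qed.

Lemma slice_cod_open c : open (slice_cod c).
Proof.
apply: (@open_comp _ _ (mulmxr (sB c) : 'rV[R]_(n - r) -> 'rV[R]_n)).
  by move=> a _; exact: rV_linear_continuous.
exact: sV_open.
Qed.

Lemma slice_phiK c p : slice_dom c p -> slice_psi c (slice_phi c p) = p.
Proof.
move=> pU; have [h1 h2] := sliceK pU (level_setP p).
by apply: val_inj; rewrite val_slice_psi.
Qed.

Lemma slice_param_smooth c : smooth_on (slice_cod c) (fun a => sG c (a *m sB c)).
Proof.
apply/smooth_onP => k; have oc := @slice_cod_open c.
apply: (Ck_comp (U' := sV c)) => //; first by apply: smoothCk; exact: sG_smooth.
by apply: Ck_mulmx => //; exact: Ck_id.
Qed.

Lemma slice_phi_continuous c : continuous (slice_phi c).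
Proof.
move=> z; apply: (@cvg_comp _ _ _ (val : level_set -> 'rV[R]_n)
  (fun x : 'rV[R]_n => x *m sC c) _ (nbhs (val z))).
  exact: val_level_continuous.
exact: (@rV_linear_continuous _ _ _ (mulmxr (sC c))).
Qed.

Lemma slice_psi_continuous c a : slice_cod c a -> {for a, continuous (slice_psi c)}.
Proof.
move=> ca; suff H : (fun s => val (slice_psi c s)) @ a --> val (slice_psi c a).
  exact: cvg_level_set H.
rewrite val_slice_psi //.
have cc : {for a, continuous (fun a : 'rV[R]_(n - r) => sG c (a *m sB c))}.
  by apply: differentiable_continuous; exact: (@slice_param_smooth c [::]).
have nc : nbhs a (slice_cod c).
  by have := @slice_cod_open c; rewrite openE => /(_ _ ca).
apply: cvg_trans cc; apply: (@near_eq_cvg _ _ (nbhs a)).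
by apply: filterS nc => b cb; rewrite val_slice_psi.
Qed.

Variable cover : forall z : level_set, exists c : slice, scenter c = z.

(** All slices are taken as charts. Their transition maps are smooth because each inverse chart is
    smooth into the ambient space and each chart is the restriction of a linear map. *)
Definition level_manifold : manifold R (n - r).
Proof.
refine (@Manifold R (n - r) level_set slice slice_dom slice_phi slice_psi
  _ _ slice_phiK _ _ _ _ level_set_hausdorff level_set_second_countable).
- move=> c; apply: open_comp; last exact: sU_open.
  by move=> z _; exact: val_level_continuous.
- by move=> c; rewrite slice_codE; exact: slice_cod_open.
- by move=> c p _; exact: slice_phi_continuous.
- by move=> c a; rewrite slice_codE; exact: slice_psi_continuous.
- by move=> z; have [c <-] := cover z; exists c; exact: sU_center.
- move=> c c'; have oc := @slice_cod_open c.
  apply: (@sub_smooth _ _ _ _ (slice_cod c)).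
    move=> _ [z [zU _] <-]; rewrite -slice_codE; by exists z.
  apply: (@eq_smooth_on _ _ _ _ _ (fun a => sG c (a *m sB c) *m sC c')) => //.
    by move=> a ca; rewrite /= /slice_phi val_slice_psi.
  apply/smooth_onP => k; apply: Ck_mulmx => //; apply: smoothCk.
  exact: slice_param_smooth.
Defined.

End LevelSet.

(** * The splitting of the state space *)

Section DiffTools.
Context {R : realType}.

Lemma near_eq_diff (V W : normedModType R) (F G : V -> W) x v :
  (\near x, F x = G x) -> differentiable G x -> 'd F x v = 'd G x v.
Proof.
move=> FG dG; have dF := near_eq_differentiable FG dG.
by rewrite -(deriveE v dF) -(deriveE v dG); exact: near_eq_derive.
Qed.

Lemma diff_compE (V W X : normedModType R) (F : W -> X) (G : V -> W) x v :
  differentiable G x -> differentiable F (G x) ->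
  'd (fun y => F (G y)) x v = 'd F (G x) ('d G x v).
Proof. by move=> dG dF; exact: (congr1 (@^~ v) (diff_comp dG dF)). Qed.

Lemma is_diff_row_mx (V : normedModType R) p q (F : V -> 'rV[R]_p) (G : V -> 'rV[R]_q) x :
  differentiable F x -> differentiable G x ->
  is_diff x (fun y => row_mx (F y) (G y)) (fun v => row_mx ('d F x v) ('d G x v)).
Proof.
move=> dF dG; have dP := differentiable_pair dF dG.
have dR : differentiable (@row_pair R p q) (F x, G x).
  exact/linear_differentiable/row_pair_continuous.
apply: DiffDef; first exact: (differentiable_comp dP dR).
rewrite -[LHS]/('d (@row_pair R p q \o (fun y => (F y, G y))) x : _ -> _).
rewrite (diff_comp dP dR) (diff_pair dF dG).
by rewrite (diff_lin _ (@row_pair_continuous R p q)).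
Qed.

Lemma row_mx_smooth (V : normedModType R) p q (F : V -> 'rV[R]_p) (G : V -> 'rV[R]_q) :
  smooth_on setT F -> smooth_on setT G -> smooth_on setT (fun x => row_mx (F x) (G x)).
Proof.
move=> sF sG; apply/smooth_onP => k; apply: Ck_row_mx; first exact: openT.
  exact: smoothCk.
exact: smoothCk.
Qed.

Lemma diff_bounded (n : nat) (W : normedModType R) (F : 'rV[R]_n -> W) x :
  differentiable F x -> exists2 K, 0 < K & forall v, `|'d F x v| <= K * `|v|.
Proof.
move=> dF; exists (1 + \sum_i `|'D_(delta_mx 0 i) F x|).
  by rewrite ltr_pwDl // sumr_ge0.
move=> v; rewrite (diff_sum_coord v dF); apply: le_trans (ler_norm_sum _ _ _) _.
rewrite mulrDl mul1r mulr_suml -[X in X <= _]add0r; apply: lerD => //.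
apply: ler_sum => i _; rewrite normrZ mulrC; apply: ler_wpM2l => //.
exact: rV_coord_le.
Qed.

Lemma diff_approx (V W : normedModType R) (F : V -> W) x e :
  differentiable F x -> 0 < e ->
  exists2 d, 0 < d & forall y, `|y - x| < d -> `|F y - F x - 'd F x (y - x)| <= e * `|y - x|.
Proof.
move=> dF e0; have /eqaddoP/(_ _ e0)/nbhs_ballP[d /= d0 Hd] := diff_locally dF.
exists d => // y yx; have B : ball (0 : V) d (y - x).
  by rewrite -ball_normE /ball_ /= sub0r normrN.
by have := Hd (y - x) B; rewrite !fctE /= subrK opprD addrA.
Qed.

Lemma has_deriv_within_comp (n : nat) (W : normedModType R) (J : set R)
    (F : 'rV[R]_n -> W) (x : R -> 'rV[R]_n) (t : R) v :
  differentiable F (x t) -> has_deriv_within J x t v ->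
  has_deriv_within J (fun s => F (x s)) t ('d F (x t) v).
Proof.
move=> dF /has_deriv_withinP Hx; apply/has_deriv_withinP => e e0.
have [K K0 HK] := diff_bounded dF.
have v0 : 0 < 1 + `|v| by rewrite ltr_pwDl.
have e1 : 0 < e / 2 / (1 + `|v|) by rewrite !divr_gt0.
have [d1 d10 H1] := diff_approx dF e1.
(* The bound 1 makes x Lipschitz at t with constant 1 + |v|, which controls the linearization error
   of F by half of e; the bound e / 2 / K leaves the other half for the error of x after applying
   the differential. *)
have e2 : 0 < Num.min 1 (e / 2 / K) by rewrite lt_min ltr01 /= !divr_gt0.
have [d2 d20 H2] := Hx _ e2.
exists (Num.min d2 (d1 / (1 + `|v|))); first by rewrite lt_min d20 divr_gt0.
move=> s; rewrite lt_min => /andP[sd2 sd1] Js; have H := H2 s sd2 Js.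
have m1 : Num.min 1 (e / 2 / K) <= 1 by rewrite ge_min lexx.
have m2 : Num.min 1 (e / 2 / K) <= e / 2 / K by rewrite ge_min lexx orbT.
have Hv : `|x s - x t| <= (1 + `|v|) * `|s - t|.
  rewrite -(subrK ((s - t) *: v) (x s - x t)); apply: le_trans (ler_normD _ _) _.
  rewrite normrZ mulrDl mul1r [`|s - t| * _]mulrC; apply: lerD => //.
  by apply: le_trans H _; rewrite ler_piMl.
have Hd : `|x s - x t| < d1.
  by apply: le_lt_trans Hv _; rewrite mulrC -ltr_pdivlMr.
have A1 := H1 _ Hd.
have A2 := HK (x s - x t - (s - t) *: v).
have L (M : {linear 'rV[R]_n -> W}) a b (c : R) : M (a - c *: b) = M a - c *: M b.
  by rewrite linearB linearZ.
rewrite L in A2.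
have -> : F (x s) - F (x t) - (s - t) *: 'd F (x t) v =
   (F (x s) - F (x t) - 'd F (x t) (x s - x t)) +
   ('d F (x t) (x s - x t) - (s - t) *: 'd F (x t) v).
  by rewrite [RHS]addrA subrK.
apply: le_trans (ler_normD _ _) _.
have B1 : e / 2 / (1 + `|v|) * `|x s - x t| <= e / 2 * `|s - t|.
  apply: le_trans (ler_wpM2l (ltW e1) Hv) _.
  by rewrite mulrA divfK // gt_eqF.
have B2 : K * `|x s - x t - (s - t) *: v| <= e / 2 * `|s - t|.
  apply: le_trans (ler_wpM2l (ltW K0) H) _.
  apply: le_trans (ler_wpM2l (ltW K0) (ler_wpM2r (normr_ge0 _) m2)) _.
  by rewrite mulrA [K * _]mulrC divfK // gt_eqF.
apply: le_trans (lerD (le_trans A1 B1) (le_trans A2 B2)) _.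
by rewrite -mulrDl -splitr.
Qed.

(** The chain rule for a chart change A read through the map P: with P the retraction onto the level
    set it compares the coordinates of one tangent vector in two charts. *)
Lemma diff_factor n k m m' (A : 'rV[R]_m -> 'rV[R]_m') (P : 'rV[R]_n -> 'rV[R]_k)
    (B : 'M[R]_(k, m)) (B' : 'M[R]_(k, m')) (x v : 'rV[R]_n) :
  differentiable P x -> differentiable A (P x *m B) ->
  (\forall y \near x, A (P y *m B) = P y *m B') ->
  'd P x v *m B' = 'd A (P x *m B) ('d P x v *m B).
Proof.
move=> dP dA nA.
have [d1 e1] := is_diff_mulmx B dP; have [d2 e2] := is_diff_mulmx B' dP.
apply: etrans (esym (congr1 (@^~ v) e2)) _.
apply: etrans (esym (near_eq_diff v nA d2)) _.
apply: etrans (diff_compE v d1 dA) _.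
by congr ('d A _ _); exact: (congr1 (@^~ v) e1).
Qed.

Lemma curve_cst n (z : R -> 'rV[R]_n) (s t : R) :
  (forall t : R, is_derive t 1 z 0) -> z t = z s.
Proof.
move=> dz; have := @curve_mvt_sym R n z (fun=> 0) s (t - s) 0 (lexx _) dz.
rewrite mul0r [s + _]addrC subrK => H.
apply/eqP; rewrite -subr_eq0 -normr_le0; apply: H => u _; by rewrite normr0.
Qed.

Lemma has_deriv_within_continuous (V : normedModType R) (J : set R) (x : R -> V)
    (t : R) v : has_deriv_within J x t v -> x @ within J (nbhs t) --> x t.
Proof.
move=> /has_deriv_withinP H; apply/cvgrPdist_le => e e0.
have [d d0 Hd] := H 1 ltr01; have v0 : 0 < 1 + `|v| by rewrite ltr_pwDl.
apply/nbhs_ballP; exists (Num.min d (e / (1 + `|v|))) => /=.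
  by rewrite lt_min d0 divr_gt0.
move=> s; rewrite /ball /= distrC lt_min => /andP[sd se] Js.
have := Hd s sd Js; rewrite mul1r => H1.
have -> : x t - x s = - ((x s - x t - (s - t) *: v) + (s - t) *: v).
  by rewrite subrK opprB.
rewrite normrN; apply: le_trans (ler_normD _ _) _; rewrite normrZ.
apply: le_trans (lerD H1 (lexx _)) _; rewrite -[X in X + _]mulr1 -mulrDr.
by rewrite -ler_pdivlMr // ltW.
Qed.

End DiffTools.

(** * The retraction onto the level set and the product decomposition *)

Section Projection.
Context {R : realType} {n r : nat}.
Variables (xi : 'rV[R]_n -> 'rV[R]_r) (Y : 'I_r -> 'rV[R]_n -> 'rV[R]_n)
  (E : 'rV[R]_r -> 'rV[R]_n -> 'rV[R]_n).
Hypotheses (sxi : smooth_on setT xi)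
  (dxi : forall k x, 'd xi x (Y k x) = delta_mx 0 k)
  (sE : smooth_on setT (fun z : 'rV[R]_(r + n) => E (lsubmx z) (rsubmx z)))
  (E0 : forall x, E 0 x = x)
  (ED : forall s s' x, E (s + s') x = E s (E s' x))
  (dE : forall s x (t : R), is_derive t 1 (fun t => E (t *: s) x)
        (span_field Y s (E (t *: s) x))).

Lemma diff_span (V : normedModType R) (F : 'rV[R]_n -> V) s x :
  'd F x (span_field Y s x) = \sum_k s 0 k *: 'd F x (Y k x).
Proof.
rewrite /span_field linear_sum; apply: eq_bigr => k _.
by rewrite linearZ.
Qed.

Lemma xi_action s x : xi (E s x) = xi x + s.
Proof.
pose z (t : R) := xi (E (t *: s) x) - t *: s.
have dz (t : R) : is_derive t 1 z 0.
  have d1 := is_derive_diff_comp (smooth_diff (E (t *: s) x) sxi) (dE s x t).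
  have e1 : 'd xi (E (t *: s) x) (span_field Y s (E (t *: s) x)) = s.
    by rewrite diff_span [RHS]row_sum_delta; apply: eq_bigr => k _; rewrite dxi.
  rewrite e1 in d1.
  have d2 : is_derive t 1 (fun t : R => t *: s) s.
    apply/is_deriveP => e e0; exists 1 => // u _.
    by rewrite -scalerBl subrr normr0 mulr_ge0 // ltW.
  by have := is_deriveB d1 d2; rewrite subrr.
have := curve_cst 0 1 dz; rewrite /z !scale1r !scale0r subr0 E0 => <-.
by rewrite subrK.
Qed.

Definition retract x := E (- xi x) x.

Lemma xi_retract x : xi (retract x) = 0.
Proof. by rewrite xi_action subrr. Qed.

Lemma retract_smooth : smooth_on setT retract.
Proof.
apply/smooth_onP => k; have oT := @openT 'rV[R]_n.
apply: (eq_Ck (G := fun x => (fun z : 'rV[R]_(r + n) => E (lsubmx z) (rsubmx z))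
    (row_mx (-1 *: xi x) x))) => //.
  by move=> x _; rewrite row_mxKl row_mxKr scaleN1r.
have C1 : Ck k setT (fun z : 'rV[R]_(r + n) => E (lsubmx z) (rsubmx z)) by exact: smoothCk.
apply: (Ck_comp (U' := setT) _ _ C1) => //.
apply: Ck_row_mx => //; last exact: Ck_id.
by apply: Ck_scale => //; [exact: Ck_cst|exact: smoothCk].
Qed.

Lemma retract_action s x : retract (E s x) = retract x.
Proof. by rewrite /retract xi_action opprD -ED subrK. Qed.

Lemma retract_id x : xi x = 0 -> retract x = x.
Proof. by move=> x0; rewrite /retract x0 oppr0 E0. Qed.

Lemma action_retract x : E (xi x) (retract x) = x.
Proof. by rewrite /retract -ED subrr E0. Qed.

Lemma diff_retract_dual k x : 'd retract x (Y k x) = 0.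
Proof.
pose s : 'rV[R]_r := delta_mx 0 k.
have := is_derive_diff_comp (smooth_diff (E (0 *: s) x) retract_smooth) (dE s x 0).
rewrite scale0r E0.
have -> : span_field Y s x = Y k x.
  rewrite /span_field (bigD1 k) //= big1 ?addr0 => [|j jk]; last first.
    by rewrite !mxE eqxx (negbTE jk) scale0r.
  by rewrite !mxE !eqxx scale1r.
rewrite (_ : (fun t => _) = fun=> retract x); last first.
  by apply/funext => t; rewrite retract_action.
by move=> H; exact: is_derive_unique H (is_derive_cst _ _ _).
Qed.

Lemma invariant_action (W : nat) (mu : 'rV[R]_n -> 'rV[R]_W)
    (s : 'rV[R]_r) (x : 'rV[R]_n) :
  smooth_on setT mu -> (forall k y, s 0 k != 0 -> 'd mu y (Y k y) = 0) ->
  mu (E s x) = mu x.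
Proof.
move=> smu H; pose z (t : R) := mu (E (t *: s) x).
have dz (t : R) : is_derive t 1 z 0.
  have := is_derive_diff_comp (smooth_diff (E (t *: s) x) smu) (dE s x t).
  rewrite diff_span big1 // => k _.
  by have [->|/H ->] := eqVneq (s 0 k) 0; rewrite ?scale0r ?scaler0.
by have := curve_cst 0 1 dz; rewrite /z scale1r scale0r E0.
Qed.

Hypothesis cover : forall z : level_set xi, exists c : slice xi, scenter c = z.

Let Z := level_manifold cover.
Let P := prod_manifold (euclid r) Z.

Definition level_proj (x : 'rV[R]_n) : level_set xi := SigSub (mem_set (xi_retract x : level_set xi (retract x))).

Lemma level_proj_continuous : continuous level_proj.
Proof.
move=> x; have H := differentiable_continuous (smooth_diff x retract_smooth).
have H' : (fun y => val (level_proj y)) @ x --> val (level_proj x) by exact: H.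
exact: cvg_level_set H'.
Qed.

Lemma split_pair_continuous : continuous (fun x => (xi x, level_proj x)).
Proof.
move=> x; have c1 := differentiable_continuous (smooth_diff x sxi).
exact: cvg_pair c1 (@level_proj_continuous x).
Qed.

(** Makes the image of an ambient vector under the differential of [retract] a tangent vector of the
    level manifold. The base point x may lie off the level set, as long as it retracts to p;
    [driven_field] relies on this. *)
Lemma diff_retract_chart x v (p : level_set xi) (c c' : chart Z) : retract x = val p ->
  dom c p -> dom c' p ->
  'd retract x v *m sC c' = 'd (phi c' \o psi c) (phi c p) ('d retract x v *m sC c).
Proof.
move=> xp cp c'p; pose A (a : 'rV[R]_(n - r)) := sG c (a *m sB c) *m sC c'.
have ca : slice_cod c (phi c p).
  by rewrite -slice_codE; exists p.
have oc := @slice_cod_open _ _ _ _ c.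
have sA : smooth_on (slice_cod c) A.
  apply/smooth_onP => k; apply: Ck_mulmx => //; apply: smoothCk.
  exact: slice_param_smooth.
have nA : \forall a \near phi c p, (phi c' \o psi c) a = A a.
  near=> a; have /val_slice_psi : slice_cod c a.
    by near: a; move: oc; rewrite openE; apply.
  by move=> e; rewrite /A -e.
have dA : differentiable A (phi c p) by exact: (sA [::]).
have dr : differentiable retract x by exact: smooth_diff retract_smooth.
rewrite (near_eq_diff _ nA dA).
have xa : retract x *m sC c = phi c p by rewrite xp.
have nB : \forall y \near x, A (retract y *m sC c) = retract y *m sC c'.
  near=> y; rewrite /A; have /sliceK[|_ ->//] : sU c (retract y); last exact: xi_retract.
  near: y; have : nbhs (retract x) (sU c).
    by have := @sU_open _ _ _ _ c; rewrite openE; apply; rewrite xp.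
  by apply: (differentiable_continuous dr).
have := diff_factor v dr _ nB; rewrite xa; exact.
Unshelve. all: by end_near. Qed.

(** Reduces smoothness in the charts of the product manifold to smoothness of an ambient function H:
    the inverse charts are themselves smooth into R^r x R^n. *)
Lemma chart_smooth (W : normedModType R) (H : 'rV[R]_(r + n) -> W) (c : chart P) :
  smooth_on setT H ->
  smooth_on (phi c @` dom c)
    (fun a => H (row_mx (psi c a).1 (val ((psi c a).2 : level_set xi)))).
Proof.
move=> sH; have oc := @cod_open _ _ _ c.
pose U : set 'rV[R]_(r + (n - r)) := [set a | slice_cod c.2 (rsubmx a)].
have cU : phi c @` dom c `<=` U.
  move=> _ [z [/= _ z2] <-]; rewrite /U /= row_mxKr.
  by rewrite -slice_codE; exists z.2.
apply: (eq_smooth_on (G := fun a => H (row_mx (lsubmx a) (sG c.2 (rsubmx a *m sB c.2))))) => //.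
  by move=> a /cU /val_slice_psi ->.
apply/smooth_onP => k; apply: (Ck_comp (U' := setT)) => //; first exact: smoothCk.
apply: Ck_row_mx => //; first by apply: Ck_lsubmx => //; exact: Ck_id.
apply: (Ck_comp (F := fun a => sG c.2 (a *m sB c.2)) (U' := slice_cod c.2)) => //.
  by apply: smoothCk; exact: slice_param_smooth.
by apply: Ck_rsubmx => //; exact: Ck_id.
Qed.

Lemma level_chart_smooth (W : normedModType R) (H : 'rV[R]_n -> W) (c : chart Z) :
  smooth_on setT H -> smooth_on (phi c @` dom c) (fun a => H (val (psi c a : level_set xi))).
Proof.
move=> sH; have oc := @cod_open _ _ _ c.
apply: (eq_smooth_on (G := fun a => H (sG c (a *m sB c)))) => //.
  by move=> a ca; rewrite val_slice_psi // -slice_codE.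
apply/smooth_onP => k; apply: (Ck_comp (U' := setT)) => //; first exact: smoothCk.
apply: smoothCk; apply: (sub_smooth (U' := slice_cod c)).
  by rewrite slice_codE.
exact: slice_param_smooth.
Qed.

Definition split_map (x : euclid n) : P := ((xi x : euclid r), (level_proj x : Z)).
Definition join_map (z : P) : euclid n := E z.1 (val (z.2 : level_set xi)).

Lemma join_mapE : join_map = (fun z : 'rV[R]_(r + n) => E (lsubmx z) (rsubmx z)) \o
  (fun z : P => row_mx z.1 (val (z.2 : level_set xi))).
Proof. by apply/funext => z; rewrite /= row_mxKl row_mxKr. Qed.

Lemma split_mapK : cancel split_map join_map.
Proof. by move=> x; rewrite /join_map /= action_retract. Qed.

Lemma join_mapK : cancel join_map split_map.
Proof.
move=> [s z]; rewrite /split_map /join_map /=; congr pair.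
  by rewrite xi_action level_setP add0r.
by apply: val_inj; rewrite /= retract_action retract_id // level_setP.
Qed.

Lemma split_coord_smooth (B : 'M[R]_(n, n - r)) :
  smooth_on setT (fun x => row_mx (xi x) (retract x *m B)).
Proof.
apply/smooth_onP => k; have oT := @openT 'rV[R]_n; apply: Ck_row_mx => //.
  exact: smoothCk.
by apply: Ck_mulmx => //; apply: smoothCk; exact: retract_smooth.
Qed.

Lemma split_diffeomorphism : diffeomorphism split_map.
Proof.
exists join_map; split; [exact: split_mapK|exact: join_mapK|split|split].
- move=> x.
  exact: (split_pair_continuous (x := x)).
- move=> c c'; apply: (sub_smooth (U' := setT)) => //.
  exact: split_coord_smooth.
- move=> z.
  have c1 : (fun w : P => row_mx w.1 (val (w.2 : level_set xi))) @ z --> row_mx z.1 (val (z.2 : level_set xi)).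
    apply: cvg_row_mx; first exact: cvg_fst.
    apply: (@cvg_comp _ _ _ snd (val : level_set xi -> 'rV[R]_n) (nbhs z) (nbhs z.2)).
      exact: cvg_snd.
    exact: val_level_continuous.
  rewrite join_mapE.
  exact: cvg_comp c1 (differentiable_continuous (smooth_diff _ sE)).
- move=> c c'; apply: (sub_smooth (U' := phi c @` dom c)).
    by move=> _ [z [cz _] <-]; exists z.
  by rewrite join_mapE; exact: chart_smooth c sE.
Qed.

(** * The normal form of the system in the split coordinates *)

Variables (f g : 'rV[R]_n -> 'rV[R]_n) (i0 : 'I_r).
Hypotheses (sf : smooth_on setT f) (sg : smooth_on setT g).

(** The Z2-component of [f], as a function on the whole state space with values in ambient
    coordinates, so that its invariance along the fields [Y k] can be stated. *)
Definition zero_field x := 'd retract x (f x).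

Hypotheses (dmu : forall k x, k != i0 -> 'd zero_field x (Y k x) = 0)
  (retract_g : forall x, 'd retract x (g x) = 0).

Lemma zero_field_smooth : smooth_on setT zero_field.
Proof.
apply/smooth_onP => k; have oT := @openT 'rV[R]_n.
apply: (Ck_dir (A := id) (U' := setT)) => //; [|exact: Ck_id|exact: smoothCk].
by apply: smoothCk; exact: retract_smooth.
Qed.

Lemma zero_field_action s x :
  zero_field (E s x) = zero_field (E (s 0 i0 *: delta_mx 0 i0) x).
Proof.
(* Deleting the i0 coordinate leaves a displacement along fields that all annihilate
   [zero_field]. *)
pose s' := s - s 0 i0 *: delta_mx 0 i0.
rewrite -[in LHS](subrK (s 0 i0 *: delta_mx 0 i0) s) ED invariant_action //.
  exact: zero_field_smooth.
move=> k y; rewrite !mxE; have [->|ki _] := eqVneq k i0; last exact: dmu.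
by rewrite eqxx mulr1 subrr eqxx.
Qed.

Lemma zero_field_retract x :
  zero_field (E (xi x 0 i0 *: delta_mx 0 i0) (retract x)) = zero_field x.
Proof. by rewrite -zero_field_action action_retract. Qed.

Let driven (y : R) (x : 'rV[R]_n) := E (y *: delta_mx 0 i0) x.

Let retract_driven y (p : level_set xi) : retract (driven y (val p)) = val p.
Proof. by rewrite retract_action retract_id // level_setP. Qed.

(* The right-hand side f2(y, z2): by zero_field_action, the jet enters the projected
   dynamics only through the output. *)
Definition driven_field (y : R) : vector_field Z := fun p =>
  Tangent (fun c c' => diff_retract_chart (f (driven y (val (p : level_set xi))))
                        (retract_driven y p)).

Definition jet_tangent (v : 'rV[R]_n -> 'rV[R]_n) (z : P) : tangent z.1 :=
  euclid_field (fun=> 'd xi (join_map z) (v (join_map z))) z.1.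

Let coordJ (v : 'rV[R]_n -> 'rV[R]_n) (w : 'rV[R]_(r + n)) : 'rV[R]_r :=
  'd xi (E (lsubmx w) (rsubmx w)) (v (E (lsubmx w) (rsubmx w))).

Let coordJ_smooth v : smooth_on setT v -> smooth_on setT (coordJ v).
Proof.
move=> sv; apply/smooth_onP => k; have oT := @openT 'rV[R]_(r + n).
apply: (Ck_dir (U' := setT)) => //; try exact: smoothCk.
apply: (Ck_comp (U' := setT)) => //; exact: smoothCk.
Qed.

Lemma diff_split (C : 'M[R]_(n, n - r)) x v :
  'd (fun x => row_mx (xi x) (retract x *m C)) x v = row_mx ('d xi x v) ('d retract x v *m C).
Proof.
have dr : differentiable retract x by exact: smooth_diff retract_smooth.
have [d1 e1] := is_diff_mulmx C dr.
have [_ e2] := is_diff_row_mx (smooth_diff x sxi) d1.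
apply: etrans (congr1 (@^~ v) e2) _.
by congr row_mx; exact: (congr1 (@^~ v) e1).
Qed.

(** The function y covers two uses: the output coordinate gives the smoothness of F, a constant that
    of each f2 y. *)
Let coordZ (y : 'rV[R]_r -> R) (C : 'M[R]_(n, n - r)) (w : 'rV[R]_(r + n)) :=
  zero_field (driven (y (lsubmx w)) (rsubmx w)) *m C.

Let coordZ_smooth y C : smooth_on setT y -> smooth_on setT (coordZ y C).
Proof.
move=> sy; apply/smooth_onP => k; have oT := @openT 'rV[R]_(r + n).
apply: Ck_mulmx => //.
apply: (Ck_comp (U' := setT)) => //; first by apply: smoothCk; exact: zero_field_smooth.
apply: (eq_Ck (G := fun w => (fun z : 'rV[R]_(r + n) => E (lsubmx z) (rsubmx z))
    (row_mx (y (lsubmx w) *: delta_mx 0 i0) (rsubmx w)))) => //.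
  by move=> w _; rewrite row_mxKl row_mxKr.
have C1 : Ck k setT (fun z : 'rV[R]_(r + n) => E (lsubmx z) (rsubmx z)) by exact: smoothCk.
apply: (Ck_comp (U' := setT) _ _ C1) => //.
apply: Ck_row_mx => //; last by apply: Ck_rsubmx => //; exact: Ck_id.
apply: Ck_scalel => //; apply: (Ck_comp (U' := setT)) => //; first exact: smoothCk.
by apply: Ck_lsubmx => //; exact: Ck_id.
Qed.

Theorem zero_dynamics_model (U : set (R -> R)) (varphi : 'rV[R]_n -> R) :
  (forall u, U u -> exists x, [/\ solves half_line (fun t z => f z + u t *: g z) x,
     forall t, 0 <= t -> xi (x t) = 0 & forall t, 0 <= t -> varphi (x t) = u t]) ->
  contains_internal_model f g (fun x => xi x 0 i0) U.
Proof.
move=> HU; exists r; split.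
  (* The Jacobian of xi has a one-sided inverse of size r, which forces r <= n. *)
  pose T : 'M[R]_(r, n) := \matrix_k Y k 0.
  apply: (@mulmx1_min _ _ _ T (jacobian xi 0)).
  by apply/row_matrixP => k; rewrite row_mul rowK /jacobian mul_rV_lin1 dxi rowE mulmx1.
pose kappa (z : euclid r) : R := (z : 'rV[R]_r) 0 i0.
have skappa : smooth_on setT (fun z : 'rV[R]_r => z 0 i0).
  apply/smooth_onP => k; have oT := @openT 'rV[R]_r.
  by apply: Ck_coord => //; exact: Ck_id.
exists (euclid r), Z, kappa, (jet_tangent f), (jet_tangent g), driven_field, split_map.
split.
- split.
  + by move=> c; apply: (sub_smooth (U' := setT)).
  + move=> c; pose C := sC c.2.
    have sH : smooth_on setT
        (fun w => row_mx (coordJ f w) (coordZ (fun s => s 0 i0) C w)).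
      exact: row_mx_smooth (coordJ_smooth sf) (coordZ_smooth _ skappa).
    have := chart_smooth (c := c) sH; apply: eq_smooth_on => [|a _]; first exact: cod_open.
    by rewrite /coordJ /coordZ row_mxKl row_mxKr.
  + move=> c.
    have sH : smooth_on setT (fun w => row_mx (coordJ g w) (0 : 'rV[R]_(n - r))).
      apply: row_mx_smooth (coordJ_smooth sg) _.
      by apply/smooth_onP => k; exact: Ck_cst.
    have := chart_smooth (c := c) sH; apply: eq_smooth_on => [|a _]; first exact: cod_open.
    by rewrite /coordJ row_mxKl row_mxKr.
  + move=> y c.
    have sH : smooth_on setT (fun x : 'rV[R]_n => coordZ (fun=> y) (sC c) (row_mx 0 x)).
      apply/smooth_onP => k; have oT := @openT 'rV[R]_n.
      apply: (Ck_comp (U' := setT)) => //.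
        by apply: smoothCk; apply: coordZ_smooth; apply/smooth_onP => j; exact: Ck_cst.
      by apply: Ck_row_mx => //; [exact: Ck_cst|exact: Ck_id].
    have := level_chart_smooth (c := c) sH; apply: eq_smooth_on => [|a _]; first exact: cod_open.
    by rewrite /coordZ row_mxKr.
- exact: split_diffeomorphism.
- split=> //.
  + move=> p c c' _ _; apply: etrans (diff_split (sC c'.2) p (f p)) _.
    rewrite -[LHS]/(row_mx ('d xi p (f p)) (zero_field p *m sC c'.2)).
    (* The Z2-component of [f] at p is evaluated instead at the point reached from the retraction of
       p by restoring the i0 coordinate of the jet alone, as in [driven_field]. *)
    by rewrite -zero_field_retract /= split_mapK.
  + move=> p c c' _ _; apply: etrans (diff_split (sC c'.2) p (g p)) _.
    by rewrite retract_g mul0mx /= split_mapK.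
(* A trajectory inside the level set is its own Z2-component: the retraction fixes it, [retract_g]
   removes the input term from its velocity, and the driving output is 0. *)
- exists (fun z => varphi (val (z : level_set xi))) => u /HU[x [sx x0 ux]].
  exists (fun t => level_proj (x t)); split=> [t t0|t t0]; last first.
    by rewrite /= retract_id ?x0 // ux.
  have dr : differentiable retract (x t) by exact: smooth_diff retract_smooth.
  have hx := has_deriv_within_comp dr (sx t t0); split.
    have H := has_deriv_within_continuous hx.
    have H' : (fun s => val (level_proj (x s))) @ within half_line (nbhs t) -->
        val (level_proj (x t)) by exact: H.
    exact: cvg_level_set H'.
  move=> c _; have [d1 e1] := is_diff_mulmx (sC c) dr.
  have := has_deriv_within_comp d1 (sx t t0).
  suff -> : 'd (fun y => retract y *m sC c) (x t) (f (x t) + u t *: g (x t)) =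
    tcoord (driven_field 0 (level_proj (x t))) c by [].
  apply: etrans (congr1 (@^~ _) e1) _.
  rewrite -[RHS]/(zero_field (driven 0 (retract (x t))) *m sC c).
  rewrite /driven scale0r E0 retract_id ?x0 //.
  rewrite -[LHS]/('d retract (x t) (f (x t) + u t *: g (x t)) *m sC c).
  have L (M : {linear 'rV[R]_n -> 'rV[R]_n}) a b (k : R) : M b = 0 -> M (a + k *: b) = M a.
    by move=> Mb; rewrite linearD linearZ /= Mb scaler0 addr0.
  by rewrite L.
Qed.

End Projection.

(** * Application to the output jet and its dual fields *)

Section InternalModel.
Context {R : realType} {n : nat}.
Variables (f g : 'rV[R]_n -> 'rV[R]_n) (h : 'rV[R]_n -> R) (r : nat).
Hypotheses (sf : smooth_on setT f) (sg : smooth_on setT g) (sh : smooth_on setT h)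
  (rd : uniform_relative_degree f g h r)
  (tau_complete : forall i, (1 <= i <= r)%N -> complete_field (tau f g h r i))
  (tau_commute : forall i j, (1 <= i <= r)%N -> (1 <= j <= r)%N ->
       forall x, lie_bracket (tau f g h r i) (tau f g h r j) x = 0).

Theorem internal_model_of_zero_dynamics (U : set (R -> R)) (varphi : 'rV[R]_n -> R) :
  (forall u, U u -> exists x, [/\ solves half_line (fun t z => f z + u t *: g z) x,
     forall t, 0 <= t -> out_jet f h r (x t) = 0 & forall t, 0 <= t -> varphi (x t) = u t]) ->
  contains_internal_model f g h U.
Proof.
move=> HU; have r0 : (0 < r)%N by case: rd.
pose i0 := Ordinal r0; pose xi := out_jet f h r; pose Y := dual_field f g h (r := r).
have sxi : smooth_on setT xi by exact: out_jet_smooth.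
have dxi k x : 'd xi x (Y k x) = delta_mx 0 k by exact: diff_out_jet_dual.
have sY k : smooth_on setT (Y k) by exact: dual_field_smooth.
have fY k : exists phi, isflow (Y k) phi by exact: dual_field_flow.
have cY j k : commuting (Y j) (Y k) by exact: dual_field_commuting.
have [E [sE E0 ED dE]] := commuting_action sY fY cY.
have cover := slice_exists sxi dxi.
have hE : h = fun x => xi x 0 i0 by apply/funext => x; rewrite mxE.
pose rt := retract xi E.
have srt : smooth_on setT rt by exact: retract_smooth.
have drt k x : 'd rt x (Y k x) = 0 by exact: (diff_retract_dual sxi dxi sE E0 ED dE).
rewrite hE; apply: (zero_dynamics_model sxi dxi sE E0 ED dE cover sf sg _ _ HU).
- move=> k x ki; apply/rowP => j; rewrite mxE.
  have sz := zero_field_smooth sxi sE sf.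
  have [_ e1] := is_diff_coord j (smooth_diff x sz).
  apply: etrans (esym (congr1 (@^~ (Y k x)) e1)) _.
  (* Lie derivatives act on scalar functions, so the argument runs over the coordinates of the
     retraction, each constant along all dual fields. *)
  pose l y := rt y 0 j.
  have sl : smooth_on setT l.
    apply/smooth_onP => m; have oT := @openT 'rV[R]_n.
    by apply: Ck_coord => //; exact: smoothCk.
  have -> : (fun y => zero_field xi E f y 0 j) = lie_derivative f l.
    apply/funext => y; rewrite lie_derivativeE; last exact: smooth_diff.
    have [_ e2] := is_diff_coord j (smooth_diff y srt).
    exact: (esym (congr1 (@^~ (f y)) e2)).
  apply: (diff_dual_lie_f sf sg sh rd) => // [k' y|].
    have [_ e2] := is_diff_coord j (smooth_diff y srt).
    apply: etrans (congr1 (@^~ (Y k' y)) e2) _.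
    by rewrite -[LHS]/('d rt y (Y k' y) 0 j) drt mxE.
  by rewrite lt0n; apply: contraNneq ki => k0; apply/eqP/val_inj.
- move=> x; have [k _ ->] := input_field_dual rd x.
  rewrite linearZ /=.
  by rewrite -[X in _ *: X]/('d rt x (Y k x)) drt scaler0.
Qed.

End InternalModel.

(** * Continuous dependence of integral curves *)

Section Dependence.
Context {R : realType} {d : nat} {M : manifold R d} {X : vector_field M}.
Hypothesis sX : smooth_vector_field X.

Let cod (c : chart M) : set 'rV[R]_d := phi c @` dom c.

Let psi_dom (c : chart M) a : cod c a -> dom c (psi c a) /\ phi c (psi c a) = a.
Proof. by move=> [p cp <-]; rewrite phiK. Qed.

Lemma chart_ball_closed (c : chart M) a (b : R) :
  cball a b `<=` cod c -> closed (psi c @` cball a b).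
Proof.
move=> sub; apply: compact_closed; first exact: manifold_hausdorff.
apply: continuous_compact; last exact: cball_compact.
apply/continuous_in_subspaceT => x /set_mem /sub cx.
exact: psi_continuous.
Qed.

Lemma curve_closed (v : R -> M) (K : set M) (s t : R) : closed K ->
  v @ within half_line (nbhs t) --> v t -> 0 <= s -> s < t ->
  (forall u, s <= u < t -> K (v u)) -> K (v t).
Proof.
move=> cK cv s0 st vK; apply: contrapT => nK.
have : nbhs (v t) (~` K) by apply: open_nbhs_nbhs; split => //; exact: closed_openC.
move=> /cv /nbhs_ballP[e /= e0 He].
pose u := Num.max s (t - e / 2).
have e2 : 0 < e / 2 by rewrite divr_gt0.
have ut : u < t by rewrite gt_max st /= gtrBl.
have su : s <= u by rewrite le_max lexx.
have tu : t - e / 2 <= u by rewrite le_max lexx orbT.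
apply: (He u) (vK u _); rewrite ?su //.
  rewrite /ball /= gtr0_norm ?subr_gt0 //.
  rewrite ltrBlDl -ltrBlDr; apply: lt_le_trans tu.
  by rewrite ltrD2l ltrN2 ltr_pdivrMr // mulr_natr mulr2n ltrDl.
exact: le_trans su.
Qed.

Lemma curve_open (v : R -> M) (V : set M) (t : R) : open V ->
  v @ within half_line (nbhs t) --> v t -> V (v t) ->
  exists2 e, 0 < e & forall s, `|s - t| < e -> 0 <= s -> V (v s).
Proof.
move=> oV cv Vt; have /cv /nbhs_ballP[e /= e0 He] : nbhs (v t) V.
  exact: open_nbhs_nbhs.
by exists e => // s st s0; apply: He => //; rewrite /ball /= distrC.
Qed.

Let Xc (c : chart M) a := tcoord (X (psi c a)) c.

Lemma chart_curve_derive (v : R -> M) (c : chart M) (t : R) :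
  integral_curve X half_line v -> 0 < t -> dom c (v t) ->
  is_derive t 1 (phi c \o v) (Xc c (phi c (v t))).
Proof.
move=> iv t0 ct; rewrite /Xc phiK //.
apply: (@has_deriv_within_is_derive _ _ half_line).
  by apply: filterS (lt_nbhsr t0) => s /ltW.
by have [_] := iv t (ltW t0); apply.
Qed.

Lemma chart_curve_continuous (v : R -> M) (c : chart M) (t : R) :
  integral_curve X half_line v -> 0 <= t -> dom c (v t) ->
  (phi c \o v) @ within half_line (nbhs t) --> phi c (v t).
Proof.
by move=> iv t0 ct; have [cv _] := iv t t0; apply: cvg_comp cv _; exact: phi_continuous.
Qed.

(* The curve v cannot leave the chart while it is close to w, because the image in M
   of a closed ball of the chart is compact, hence closed. *)
Lemma chart_gronwall (c : chart M) a (rho K : R) (v w : R -> M) (s0 s1 b : R) :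
  cball a (rho + b) `<=` cod c -> 0 <= K -> 0 < b ->
  (forall x y, cball a (rho + b) x -> cball a (rho + b) y ->
     `|Xc c x - Xc c y| <= K * `|x - y|) ->
  integral_curve X half_line v -> integral_curve X half_line w ->
  0 <= s0 ->
  (forall s, s0 <= s <= s1 -> dom c (w s) /\ `|phi c (w s) - a| <= rho) ->
  dom c (v s0) ->
  gfactor d K (s1 - s0) * `|phi c (v s0) - phi c (w s0)| ^+ 2 < b ^+ 2 ->
  `|phi c (v s0) - phi c (w s0)| < b ->
  forall s, s0 <= s <= s1 -> dom c (v s) /\ `|phi c (v s) - phi c (w s)| < b.
Proof.
move=> sub K0 b0 HK iv iw s00 Hw cv0 Hg H0.
have near_a s : s0 <= s <= s1 -> `|phi c (v s) - phi c (w s)| < b ->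
    cball a (rho + b) (phi c (v s)).
  move=> ss Hb; rewrite /cball /= -(subrK (phi c (w s)) (phi c (v s))) -addrA.
  apply: le_trans (ler_normD _ _) _; rewrite [rho + b]addrC.
  have [_ H1] := Hw s ss; exact: lerD (ltW Hb) H1.
have cw s : s0 <= s <= s1 -> cball a (rho + b) (phi c (w s)).
  move=> /Hw[_ H]; rewrite /cball /=; apply: le_trans H _; by rewrite lerDl ltW.
apply: real_induction.
- move=> t /andP[s0t ts1] IH.
  have [->//|nst] := eqVneq t s0.
  have s0t' : s0 < t by rewrite lt_neqAle eq_sym nst.
  have t0 : 0 <= t by exact: le_trans s0t.
  have in1 s : s0 <= s < t -> s0 <= s <= s1.
    by move=> /andP[-> st] /=; exact: le_trans (ltW st) ts1.
  have cvt : dom c (v t).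
    have [cv _] := iv t t0.
    have : (psi c @` cball a (rho + b)) (v t).
      apply: (curve_closed (chart_ball_closed sub) cv s00 s0t') => s ss.
      have [cs Hb] := IH s ss; exists (phi c (v s)); last by rewrite phiK.
      exact: near_a (in1 s ss) Hb.
    by move=> [x /sub cx <-]; exact: (psi_dom cx).1.
  split=> //.
  have dom_v s : s0 <= s <= t -> dom c (v s).
    move=> /andP[ss st]; move: st; rewrite le_eqVlt => /orP[/eqP->//|st].
    by have [] := IH s; rewrite ?ss.
  have inw s : s0 <= s <= t -> s0 <= s <= s1.
    by move=> /andP[-> st] /=; exact: le_trans st ts1.
  pose y tau := phi c (v (s0 + tau)) - phi c (w (s0 + tau)).
  pose dy tau := Xc c (phi c (v (s0 + tau))) - Xc c (phi c (w (s0 + tau))).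
  have shift tau : 0 <= tau <= t - s0 -> s0 <= s0 + tau <= t.
    by move=> /andP[h1 h2]; rewrite lerDl h1 /= addrC -lerBrDr.
  have ts0 : 0 <= t - s0 by rewrite subr_ge0.
  have C : {within `[0, t - s0], continuous y}.
    apply/subspace_continuousP => tau; rewrite /= in_itv /= => tauI.
    have sI := shift _ tauI; have [sa sb] := andP sI.
    have ge0 : 0 <= s0 + tau by exact: le_trans sa.
    have S : (fun u => s0 + u) @ within `[0, t - s0]%classic (nbhs tau) -->
       within half_line (nbhs (s0 + tau)).
      move=> A /nbhs_ballP[e /= e0 He]; apply/nbhs_ballP; exists e => //= u ue.
      rewrite /= in_itv /= => /shift/andP[ua _]; apply: He.
        by move: ue; rewrite /ball /= opprD addrACA subrr add0r.
      exact: le_trans ua.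
    apply: cvgB.
      exact: cvg_comp S (chart_curve_continuous iv ge0 (dom_v _ sI)).
    exact: cvg_comp S (chart_curve_continuous iw ge0 (Hw _ (inw _ sI)).1).
  have D tau : 0 < tau < t - s0 -> is_derive tau 1 y (dy tau).
    move=> /andP[h1 h2]; have sI : s0 <= s0 + tau < t.
      by rewrite lerDl ltW //= addrC -ltrBrDr.
    have p0 : 0 < s0 + tau by rewrite ltr_wpDl.
    have ds : is_derive tau 1 (fun u => s0 + u) 1.
      apply/is_deriveP => e e0; exists 1 => // u _.
      rewrite [_ *: 1]mulr1 opprD addrACA subrr add0r subrr normr0.
      by rewrite mulr_ge0 // ltW.
    have dv := chart_curve_derive iv p0 (IH _ sI).1.
    have dw := chart_curve_derive iw p0 (Hw _ (in1 _ sI)).1.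
    have := is_deriveB (is_derive_curve_comp ds dv) (is_derive_curve_comp ds dw).
    by rewrite !scale1r.
  have L tau : 0 < tau < t - s0 -> `|dy tau| <= K * `|y tau| + 0.
    move=> /andP[h1 h2]; have sI : s0 <= s0 + tau < t.
      by rewrite lerDl ltW //= addrC -ltrBrDr.
    rewrite addr0; apply: HK; last exact: cw (in1 _ sI).
    exact: near_a (in1 _ sI) (IH _ sI).2.
  have := gronwall ts0 K0 (lexx 0) C D L.
  rewrite expr0n /= mul0r addr0 /y addr0 subrKC => G.
  rewrite -(@ltr_pXn2r _ 2) ?nnegrE //; last exact: ltW.
  apply: le_lt_trans G (le_lt_trans _ Hg).
  by apply: ler_wpM2r; [exact: exprn_ge0|apply: gfactor_le => //; rewrite lerD2r].
- move=> t /andP[s0t ts1] [cvt Hb].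
  have t0 : 0 <= t by exact: le_trans s0t.
  have tI : s0 <= t <= s1 by rewrite s0t ltW.
  have [cv _] := iv t t0; have [e1 e10 He1] := curve_open (@dom_open _ _ _ c) cv cvt.
  have cc : (fun s => phi c (v s) - phi c (w s)) @ within half_line (nbhs t) -->
      phi c (v t) - phi c (w t).
    apply: cvgB; first exact: chart_curve_continuous iv t0 cvt.
    exact: chart_curve_continuous iw t0 (Hw t tI).1.
  have b1 : 0 < b - `|phi c (v t) - phi c (w t)| by rewrite subr_gt0.
  have /cvgrPdist_lt/(_ _ b1)/nbhs_ballP[e2 /= e20 He2] := cc.
  exists (Num.min e1 e2); first by rewrite lt_min e10.
  move=> s /andP[ts se] ss1; have s0' : 0 <= s by rewrite (le_trans t0) // ltW.
  have : `|s - t| < Num.min e1 e2 by rewrite gtr0_norm ?subr_gt0 // ltrBlDl.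
  rewrite lt_min => /andP[se1 se2]; split; first exact: He1.
  have := He2 s; rewrite /ball /= distrC => /(_ se2 s0') H.
  have := lerB_dist (phi c (v s) - phi c (w s)) (phi c (v t) - phi c (w t)).
  rewrite distrC => H'; have := le_lt_trans H' H.
  by rewrite ltrBlDr subrK.
Qed.

(** The length e depends on w near t only, not on the family v or the filter. This uniformity allows
    [real_induction] to advance and also to pass to the endpoint of an interval. *)
Lemma dependence_local (w : R -> M) (t : R) :
  integral_curve X half_line w -> 0 <= t ->
  exists2 e, 0 < e & forall (I : Type) (F : set_system I) (FF : Filter F)
    (v : I -> R -> M) (s0 s1 : R), (forall i, integral_curve X half_line (v i)) ->
    0 <= s0 -> s0 <= s1 -> `|s0 - t| < e -> `|s1 - t| < e ->
    v^~ s0 @ F --> w s0 -> v^~ s1 @ F --> w s1.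
Proof.
move=> iw t0; have [c ct] := dom_cover (w t).
pose a := phi c (w t); have oc := @cod_open _ _ _ c.
have ca : cod c a by exists (w t).
have /nbhs_ballP[e0 /= e00 He0] : nbhs a (cod c) by apply: open_nbhs_nbhs.
(* One rho confines w near a, the second is the margin within which the curves v may differ from w
   and remain in the chart. *)
have [rho rho0 sub] : exists2 rho, 0 < rho & cball a (rho + rho) `<=` cod c.
  exists (e0 / 4); first by rewrite divr_gt0.
  move=> x; rewrite /cball /= => ax; apply: He0; rewrite -ball_normE /ball_ /=.
  by rewrite distrC; apply: le_lt_trans ax _; lra.
have CX : Ck 1 (cod c) (Xc c) by apply: smoothCk; exact: sX.
have [K K0 HK] := Ck_lip CX sub.
have [cw _] := iw t t0.
have [e1 e10 He1] := curve_open (@dom_open _ _ _ c) cw ct.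
have cc := chart_curve_continuous iw t0 ct.
have /cvgrPdist_lt/(_ _ rho0)/nbhs_ballP[e2 /= e20 He2] := cc.
exists (Num.min e1 e2); first by rewrite lt_min e10.
move=> I F FF v s0 s1 iv s00 s01; rewrite !lt_min => /andP[h1 h2] /andP[h3 h4] cv.
have Hw s : s0 <= s <= s1 -> dom c (w s) /\ `|phi c (w s) - a| <= rho.
  move=> /andP[ss ss']; have sp : 0 <= s by exact: le_trans ss.
  have B e : `|s0 - t| < e -> `|s1 - t| < e -> `|s - t| < e.
    rewrite !ltr_norml => /andP[a1 a2] /andP[a3 a4].
    by rewrite (lt_le_trans a1) ?lerD2r //= (le_lt_trans _ a4) // lerD2r.
  split; first by apply: He1 => //; exact: B.
  rewrite distrC; apply: ltW; apply: (He2 s) => //.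
  by rewrite /ball /= distrC; exact: B.
have cs0 : dom c (w s0) by have [] := Hw s0; rewrite ?lexx.
have cs1 : dom c (w s1) by have [] := Hw s1; rewrite ?lexx ?s01.
have nv0 : F (fun i => dom c (v i s0)).
  by apply: cv; apply: open_nbhs_nbhs; split => //; exact: dom_open.
have cphi : (fun i => phi c (v i s0)) @ F --> phi c (w s0).
  by apply: cvg_comp cv _; exact: phi_continuous.
have close (b : R) : 0 < b -> b <= rho ->
    F (fun i => dom c (v i s1) /\ `|phi c (v i s1) - phi c (w s1)| < b).
  move=> b0 br; pose gf := gfactor d K (s1 - s0).
  have g0 : 0 <= gf by exact: gfactor_ge0.
  have g1 : 0 < gf + 1 by rewrite ltr_wpDl.
  (* Below this threshold both the initial distance and its multiple by gf are less than b, so gf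
     times its square is less than b^2. *)
  have del0 : 0 < b / (gf + 1) by rewrite divr_gt0.
  have /cvgrPdist_lt/(_ _ del0) := cphi; apply: filterS2 nv0 => i di.
  rewrite distrC ltr_pdivlMr // mulrDr mulr1 mulrC => Hg.
  have gp : 0 <= gf * `|phi c (v i s0) - phi c (w s0)| by rewrite mulr_ge0.
  have Hb : `|phi c (v i s0) - phi c (w s0)| < b.
    by apply: le_lt_trans Hg; rewrite lerDr.
  have Hg' : gf * `|phi c (v i s0) - phi c (w s0)| < b.
    by apply: le_lt_trans Hg; rewrite lerDl.
  have sub' : cball a (rho + b) `<=` cball a (rho + rho).
    by move=> x; rewrite /cball /= => /le_trans; apply; rewrite lerD2l.
  apply: (@chart_gronwall c a rho K (v i) w s0 s1 b) => //.
  - exact: subset_trans sub' sub.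
  - exact: ltW.
  - by move=> x y /sub' cx /sub' cy; exact: HK.
  - rewrite !expr2 mulrA; apply: le_lt_trans (ler_wpM2l gp (ltW Hb)) _.
    by rewrite ltr_pM2r.
  - by rewrite s01 lexx.
have cphi1 : (fun i => phi c (v i s1)) @ F --> phi c (w s1).
  apply/cvgrPdist_lt => e ep.
  have m0 : 0 < Num.min rho e by rewrite lt_min rho0.
  have m1 : Num.min rho e <= rho by rewrite ge_min lexx.
  apply: filterS (close _ m0 m1) => i [_]; rewrite lt_min distrC => /andP[_].
  by [].
have nv1 : F (fun i => dom c (v i s1)) by apply: filterS (close _ rho0 (lexx _)) => i [].
have : (fun i => psi c (phi c (v i s1))) @ F --> psi c (phi c (w s1)).
  by apply: cvg_comp cphi1 _; apply: psi_continuous; exists (w s1).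
rewrite phiK // => H; apply: cvg_trans H; apply: near_eq_cvg.
by apply: filterS nv1 => i ci; rewrite phiK.
Qed.

Theorem dependence_continuous (w : R -> M) (I : Type) (F : set_system I) (FF : Filter F)
    (v : I -> R -> M) (t : R) :
  integral_curve X half_line w -> (forall i, integral_curve X half_line (v i)) ->
  v^~ 0 @ F --> w 0 -> 0 <= t -> v^~ t @ F --> w t.
Proof.
move=> iw iv c0 t0.
apply: (@real_induction R (fun t => v^~ t @ F --> w t) 0 t); last by rewrite t0 lexx.
- move=> s /andP[s0 st] IH; have [->//|ns] := eqVneq s 0.
  have sp : 0 < s by rewrite lt_neqAle eq_sym ns.
  have [e e0 He] := dependence_local iw s0.
  pose u := Num.max 0 (s - e / 2).
  have e2 : 0 < e / 2 by rewrite divr_gt0.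
  have us : u < s by rewrite gt_max sp /= gtrBl.
  have u0 : 0 <= u by rewrite le_max lexx.
  have su : s - e / 2 <= u by rewrite le_max lexx orbT.
  apply: (He I F FF v u s iv u0 (ltW us)) => //; last by apply: IH; rewrite u0.
    rewrite distrC gtr0_norm ?subr_gt0 // ltrBlDl -ltrBlDr; apply: lt_le_trans su.
    by rewrite ltrD2l ltrN2 ltr_pdivrMr // mulr_natr mulr2n ltrDl.
  by rewrite subrr normr0.
- move=> s /andP[s0 st] Hs; have [e e0 He] := dependence_local iw s0.
  exists e => // u /andP[su ue] _.
  apply: (He I F FF v s u iv s0 (ltW su)) => //.
    by rewrite subrr normr0.
  by rewrite gtr0_norm ?subr_gt0 // ltrBlDl.
Qed.

(** Continuous dependence for the constant sequence v: it converges both to v t and to w t, and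
    limits in M are unique. *)
Lemma integral_curve_unique (v w : R -> M) (t : R) :
  integral_curve X half_line v -> integral_curve X half_line w -> v 0 = w 0 ->
  0 <= t -> v t = w t.
Proof.
move=> iv iw vw t0.
have H := @dependence_continuous w nat \oo _ (fun=> v) t iw (fun=> iv) _ t0.
move: H; rewrite /= vw => /(_ _)/(_ (cvg_cst _)) H.
exact: (cvg_unique (@manifold_hausdorff _ _ M) (cvg_cst _) H).
Qed.

End Dependence.

(** * Zero output under Poisson-stable inputs *)

Section WithinDerivative.
Context {R : realType}.

Lemma has_deriv_within_row_mx p q (J : set R) (x : R -> 'rV[R]_p) (y : R -> 'rV[R]_q)
    (t : R) v w : has_deriv_within J x t v -> has_deriv_within J y t w ->
  has_deriv_within J (fun s => row_mx (x s) (y s)) t (row_mx v w).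
Proof.
move=> dx dy; have := cvg_row_mx _ dx dy; rewrite /has_deriv_within.
under [in X in _ -> X]eq_fun do rewrite opp_row_mx add_row_mx scale_row_mx.
by apply.
Qed.

Lemma has_deriv_within_shift (V : normedModType R) (x : R -> V) (t c : R) v : 0 <= c ->
  has_deriv_within half_line x (t + c) v ->
  has_deriv_within half_line (fun s => x (s + c)) t v.
Proof.
move=> c0 /has_deriv_withinP H; apply/has_deriv_withinP => e e0.
have [d d0 Hd] := H e e0; exists d => // s sd s0.
have E : s + c - (t + c) = s - t by rewrite opprD addrACA subrr addr0.
by have := Hd (s + c); rewrite E; apply => //; exact: addr_ge0.
Qed.

Lemma has_deriv_within_cst_unique (V : normedModType R) (x : R -> V) (t : R) c v :
  0 <= t -> (forall s, 0 <= s -> x s = c) -> has_deriv_within half_line x t v -> v = 0.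
Proof.
move=> t0 xc /has_deriv_withinP H; apply/eqP; rewrite -normr_le0.
apply/ler_addgt0Pr => e e0; rewrite add0r.
have [d d0 Hd] := H e e0; have d2 : 0 < d / 2 by rewrite divr_gt0.
(* A point to the right of t belongs to the half-line even when t = 0. *)
have := Hd (t + d / 2); rewrite addrAC subrr add0r gtr0_norm //.
have s0 : 0 <= t + d / 2 by rewrite addr_ge0 // ltW.
rewrite !xc // subrr sub0r normrN normrZ gtr0_norm // [_ * `|v|]mulrC.
rewrite (ler_pM2r d2); apply => //.
by rewrite ltr_pdivrMr // mulr_natr mulr2n ltrDl.
Qed.

End WithinDerivative.

Section ShiftCurve.
Context {R : realType} {d : nat} {M : manifold R d} {X : vector_field M}.

Lemma integral_curve_shift (w : R -> M) (c : R) : 0 <= c ->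
  integral_curve X half_line w -> integral_curve X half_line (fun t => w (t + c)).
Proof.
move=> c0 iw t t0; have tc0 : 0 <= t + c by exact: addr_ge0.
have [cw dw] := iw _ tc0; split=> [|k kd]; last first.
  exact: (has_deriv_within_shift c0 (dw k kd)).
have S : (fun s => s + c) @ within half_line (nbhs t) --> within half_line (nbhs (t + c)).
  move=> A /nbhs_ballP[e /= e0 He]; apply/nbhs_ballP; exists e => //= u ue u0; apply: He.
    by move: ue; rewrite /ball /= opprD addrACA subrr addr0.
  exact: addr_ge0.
exact: cvg_comp S cw.
Qed.

End ShiftCurve.

(** * The system joined to its exosystem *)

Section DrivenSystem.
Context {R : realType} {n d : nat} {W : manifold R d}.
Variables (f g : 'rV[R]_n -> 'rV[R]_n) (Q : vector_field W) (theta : W -> R).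
Hypotheses (sf : smooth_on setT f) (sg : smooth_on setT g)
  (sQ : smooth_vector_field Q) (stheta : smooth_fun theta).

Definition driven_system : vector_field (prod_manifold (euclid n) W) := fun z =>
  pair_tangent (euclid_field (fun x => f x + theta z.2 *: g x) z.1) (Q z.2).

Lemma driven_system_smooth : smooth_vector_field driven_system.
Proof.
move=> c; apply/smooth_onP => k; have oc := @cod_open _ _ _ c.
have sub a : (phi c @` dom c) a -> (phi c.2 @` dom c.2) (rsubmx a).
  by move=> [z [_ cz] <-]; rewrite row_mxKr; exists z.2.
have CL : Ck k (phi c @` dom c) (fun a : 'rV[R]_(n + d) => lsubmx a).
  by apply: Ck_lsubmx => //; exact: Ck_id.
have CR : Ck k (phi c @` dom c) (fun a : 'rV[R]_(n + d) => rsubmx a).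
  by apply: Ck_rsubmx => //; exact: Ck_id.
apply: Ck_row_mx => //.
  apply: Ck_add => //.
    apply: (Ck_comp (U' := setT)) => //; exact: smoothCk.
  apply: Ck_scale => //.
    apply: (Ck_comp (F := theta \o psi c.2) (U' := phi c.2 @` dom c.2)) => //.
    by apply: smoothCk; exact: stheta.
  apply: (Ck_comp (U' := setT)) => //; exact: smoothCk.
apply: (Ck_comp (F := fun b => tcoord (Q (psi c.2 b)) c.2) (U' := phi c.2 @` dom c.2)) => //.
by apply: smoothCk; exact: sQ.
Qed.

Lemma driven_system_curve (u : R -> R) (x : R -> 'rV[R]_n) (w : R -> W) :
  solves half_line (fun t z => f z + u t *: g z) x -> integral_curve Q half_line w ->
  (forall t, 0 <= t -> u t = theta (w t)) ->
  integral_curve driven_system half_line (fun t => ((x t : euclid n), w t)).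
Proof.
move=> sx iw uE t t0; have [cw dw] := iw t t0; split.
  exact: cvg_pair (has_deriv_within_continuous (sx t t0)) cw.
move=> c [_ cwt]; apply: has_deriv_within_row_mx; last exact: dw.
by have := sx t t0; rewrite uE.
Qed.

End DrivenSystem.

(** * Trajectories with identically zero output *)

Section ZeroOutput.
Context {R : realType} {n : nat}.
Variables (f g : 'rV[R]_n -> 'rV[R]_n) (h : 'rV[R]_n -> R) (r : nat).
Hypotheses (sf : smooth_on setT f) (sh : smooth_on setT h)
  (rd : uniform_relative_degree f g h r).

(** Differentiating L_f^k h = 0 along the trajectory gives L_f^(k+1) h + u L_g L_f^k h = 0. The
    input term vanishes until k = r - 1, where its nonzero coefficient lets the equation be solved
    for u. *)
Lemma zero_output_jet (u : R -> R) (x : R -> 'rV[R]_n) :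
  solves half_line (fun t z => f z + u t *: g z) x ->
  (forall t, 0 <= t -> h (x t) = 0) ->
  (forall t, 0 <= t -> out_jet f h r (x t) = 0) /\
  (forall t, 0 <= t ->
     - iter_lie f r h (x t) / lie_derivative g (iter_lie f r.-1 h) (x t) = u t).
Proof.
move=> sx hx; have [r0 rdl rdr] := rd.
have step k t : (forall t, 0 <= t -> iter_lie f k h (x t) = 0) -> 0 <= t ->
    iter_lie f k.+1 h (x t) + u t * lie_derivative g (iter_lie f k h) (x t) = 0.
  move=> H t0; have sk := iter_lie_smooth sf sh k.
  have dk := smooth_diff (x t) sk.
  have D := has_deriv_within_comp dk (sx t t0).
  have := has_deriv_within_cst_unique t0 H D.
  rewrite -[iter_lie f k.+1 h]/(lie_derivative f (iter_lie f k h)).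
  rewrite !(lie_derivativeE _ dk) => <-.
  have L (A : {linear 'rV[R]_n -> R}) a b (c : R) : A a + c * A b = A (a + c *: b).
    by rewrite linearD linearZ.
  exact: L.
have jet k : (k <= r.-1)%N -> forall t, 0 <= t -> iter_lie f k h (x t) = 0.
  elim: k => [//|k IH] kr t t0; have := step k t (IH (ltnW kr)) t0.
  by rewrite rdl // mulr0 addr0.
split=> t t0.
  by apply/rowP => k; rewrite !mxE; apply: jet (t0); exact: (ord_le_pred rd).
have := step r.-1 t (jet _ (leqnn _)) t0; rewrite prednK // => /eqP.
by rewrite addr_eq0 => /eqP ->; rewrite opprK mulfK.
Qed.

End ZeroOutput.

(** The selection e need not be increasing; i <= e i is what sends the selected times to
    infinity. *)
Lemma bounded_subsequence (R : realType) (n : nat) (x : nat -> 'rV[R]_n) (B : R) :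
  (forall i, `|x i| <= B) -> exists (p : 'rV[R]_n) (e : nat -> nat),
    (forall i, (i <= e i)%N) /\ x (e i) @[i --> \oo] --> p.
Proof.
move=> xB.
have [p [_ Hp]] : cball (0 : 'rV[R]_n) B `&` cluster (x @ \oo) !=set0.
  apply: (@cball_compact R n 0 B); exists 0%N => // i _.
  by rewrite /cball /= subr0.
have /choice[e He] : forall i : nat, exists j, (i <= j)%N /\ `|x j - p| < i.+1%:R^-1.
  move=> i; have i0 : (0 : R) < i.+1%:R^-1 by rewrite invr_gt0.
  have [|_ [[j ij <-] Hj]] := Hp (x @` [set j | (i <= j)%N]) _ _ (nbhsx_ballx p _ i0).
    by exists i => // j ij; exists j.
  by exists j; split => //; move: Hj; rewrite -ball_normE /ball_ /= distrC.
exists p, e; split=> [i|]; first by have [] := He i.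
apply/cvgrPdist_lt => d d0; near=> i.
rewrite distrC; apply: lt_trans (He i).2 _; near: i.
exact: near_infty_natSinv_lt (PosNum d0).
Unshelve. all: by end_near. Qed.

Lemma cvg_pair_fst (S : Type) (F : set_system S) (T1 T2 : topologicalType)
    (a : S -> T1) (b : S -> T2) (l : T1) (m : T2) :
  (fun s => (a s, b s)) @ F --> (l, m) -> a @ F --> l.
Proof. move=> H A nA; apply: (H [set z | A z.1]).
by exists (A, setT) => [|z []//]; split => //; exact: filterT. Qed.

Lemma poisson_zero_output (R : realType) (n d : nat) (W : manifold R d)
    (f g : 'rV[R]_n -> 'rV[R]_n) (h : 'rV[R]_n -> R) (Q : vector_field W) (theta : W -> R)
    (U : set (R -> R)) :
  smooth_on setT f -> smooth_on setT g -> smooth_on setT h ->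
  smooth_vector_field Q -> smooth_fun theta -> poisson_stable Q ->
  generated Q theta U -> adapts f g h U ->
  forall u, U u -> exists x, solves half_line (fun t z => f z + u t *: g z) x /\
    forall t, 0 <= t -> h (x t) = 0.
Proof.
move=> sf sg sh sQ st ps gU ad u Uu.
have [w' [iw' uw']] := (gU u).1 Uu.
(* Poisson stability supplies its own solution w through the initial state of w'; by uniqueness the
   two coincide for t >= 0, so w generates u as well. *)
have [w [w0 iw [s [soo ws]]]] := ps (w' 0).
have uw t : 0 <= t -> u t = theta (w t).
  by move=> t0; rewrite uw' // (integral_curve_unique sQ iw' iw (esym w0) t0).
have [x [_ sx [B xB] hx]] := ad u Uu 0.
(* The times s i tend to infinity but may start negative; shifting the index by N makes all of them
   admissible. *)
have [N _ sN] : \forall i \near \oo, 0 <= s i.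
  by move/cvgryPge: soo; apply.
have [|p [e [eI ep]]] := @bounded_subsequence R n (fun i => x (s (i + N)%N)) B.
  by move=> i; apply/xB/sN; rewrite /= leq_addl.
pose c i := s (e i + N)%N.
have c0 i : 0 <= c i by apply: sN; rewrite /= leq_addl.
have eoo : (fun i => (e i + N)%N) @ \oo --> \oo.
  move=> A [K _ AK]; exists K => // i Ki; apply: AK.
  by rewrite /= (leq_trans Ki) // (leq_trans (eI i)) // leq_addr.
have coo : c @ \oo --> +oo by exact: cvg_comp eoo soo.
have cw : w (c i) @[i --> \oo] --> w 0 by rewrite w0; exact: cvg_comp eoo ws.
(* Adaptation is invoked again, now from the limit point p, for a trajectory on the whole half-line
   driven by the same u; it is the limit of the shifted copies of x. *)
have [y [y0 sy _ _]] := ad u Uu p.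
exists y; split=> // t t0.
have sX := driven_system_smooth sf sg sQ st.
have iz := driven_system_curve sy iw uw.
have izc i := integral_curve_shift (c0 i) (driven_system_curve sx iw uw).
have H0 : (fun i => ((x (0 + c i) : euclid n), w (0 + c i))) @ \oo --> ((y 0 : euclid n), w 0).
  under eq_fun do rewrite add0r.
  by rewrite y0; exact: cvg_pair ep cw.
have H1 := dependence_continuous sX _ iz izc H0 t0.
have H2 : (fun i => x (t + c i)) @ \oo --> y t.
  exact: (@cvg_pair_fst _ _ (euclid n) W _ _ _ _ (H1 _)).
have H3 : (fun i => h (x (t + c i))) @ \oo --> h (y t).
  exact: cvg_comp H2 (differentiable_continuous (smooth_diff (y t) sh)).
have tc : (fun i => t + c i) @ \oo --> +oo.
  apply/cvgryPge => A; have /cvgryPge/(_ (A - t)) := coo.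
  by apply: filterS => i; rewrite lerBlDl.
have H4 : (fun i => h (x (t + c i))) @ \oo --> 0 by exact: cvg_comp tc hx.
exact: (cvg_unique (@norm_hausdorff _ _) H3 H4).
Qed.

Theorem theorem1 (R : realType) (n : nat)
    (f g : 'rV[R]_n -> 'rV[R]_n) (h : 'rV[R]_n -> R)
    (f_smooth : smooth_on setT f) (g_smooth : smooth_on setT g)
    (h_smooth : smooth_on setT h) (f0 : f 0 = 0) (h0 : h 0 = 0)
    (r : nat) (relative_degree : uniform_relative_degree f g h r)
    (tau_complete : forall i, (1 <= i <= r)%N -> complete_field (tau f g h r i))
    (tau_commute : forall i j, (1 <= i <= r)%N -> (1 <= j <= r)%N ->
       forall x, lie_bracket (tau f g h r i) (tau f g h r j) x = 0)
    (d : nat) (W : manifold R d) (Q : vector_field W) (theta : W -> R)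
    (Q_smooth : smooth_vector_field Q) (theta_smooth : smooth_fun theta)
    (Q_poisson : poisson_stable Q)
    (U : set (R -> R)) (U_generated : generated Q theta U)
    (f_adapts : adapts f g h U) :
  contains_internal_model f g h U.
Proof.
(* [varphi] is the feedback that keeps the last output derivative at zero, as found in
   [zero_output_jet]. *)
apply: (internal_model_of_zero_dynamics f_smooth g_smooth h_smooth relative_degree
  tau_complete tau_commute
  (varphi := fun x => - iter_lie f r h x / lie_derivative g (iter_lie f r.-1 h) x)).
move=> u Uu; have [x [sx hx]] := poisson_zero_output f_smooth g_smooth h_smooth
  Q_smooth theta_smooth Q_poisson U_generated f_adapts Uu.
by have [jx ux] := zero_output_jet f_smooth h_smooth relative_degree sx hx; exists x.
Qed.
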